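(* Consider a hyperplane $H$ of $\mathbb{R}^d$ whose distance to the center of the hypercube $[0,1]^d$ is equal to $t$. If $0<t\leq\beta^-$, $\beta^+<t\leq0.20916$, or $\delta<t<0.5$, where $\beta^-$ and $\beta^+$ denote the two solutions (in the variable $t$) of the equation $$ \frac{\sqrt{2-4t^2}-2t}{1-4t^2}=\sqrt{\frac{6}{\pi}}\,e^{-6t^2} $$ satisfying $0.0181611<\beta^-<0.0181612$ and $0.165625<\beta^+<0.165626$, while $\delta$ denotes the root of the polynomial expression $$ 575\sqrt{5}-528\sqrt{6}-120\bigl(25\sqrt{5}-24\sqrt{6}\bigr)t^2+240\bigl(25\sqrt{5}-36\sqrt{6}\bigr)t^4+17280t^5 $$ that satisfies $0.222924<\delta<0.222925$, then the $(d-1)$-dimensional volume of $H\cap[0,1]^d$ cannot be maximal when $H$ is orthogonal to a diagonal of the hypercube $[0,1]^d$ or to a diagonal of any of its proper faces.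
   Context: Here $[0,1]^d$ is the $d$-dimensional unit hypercube, $t$ is a fixed number, and the $(d-1)$-dimensional volume of $H\cap[0,1]^d$ is considered as a function of $H$, where $H$ ranges over the hyperplanes of $\mathbb{R}^d$ whose distance to the center of $[0,1]^d$ is equal to $t$; maximality is meant among these hyperplanes. A diagonal of a face $F$ of $[0,1]^d$ is a segment joining two vertices of $F$ that are symmetric with respect to the center of $F$. Equivalently, a hyperplane is orthogonal to a diagonal of an $n$-dimensional face of $[0,1]^d$ when it admits a unit normal vector with $n$ coordinates equal to $\pm1/\sqrt{n}$ and the $d-n$ other coordinates equal to $0$. *)

(* Defs.v *)
(* MathComp-Analysis, over an arbitrary [R : realType]; points of R^d are row
   vectors ['rV[R]_d]. *)
From HB Require Import structures.
From mathcomp Require Import all_boot all_order all_algebra.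
From mathcomp Require Import all_classical all_reals all_analysis.

Set Implicit Arguments.
Unset Strict Implicit.
Unset Printing Implicit Defensive.

Import Order.TTheory GRing.Theory Num.Theory.

Local Open Scope classical_set_scope.
Local Open Scope ring_scope.

(* Lebesgue measure on R^n, as the n-fold product of the Lebesgue measure on R,
   transported to [n.-tuple R]. *)
Section lebesgue_tuple.
Context (R : realType).
Local Notation mR := (measurableTypeR R).

Section step.
Variables (n : nat) (mu : {sigma_finite_measure set (n.-tuple mR) -> \bar R}).

Definition tuple_cons (p : mR * n.-tuple mR) : n.+1.-tuple mR :=
  [the n.+1.-tuple mR of p.1 :: p.2].

Lemma measurable_tuple_cons : measurable_fun [set: mR * n.-tuple mR] tuple_cons.
Proof.
by apply: measurable_cons; [exact: measurable_fst|exact: measurable_snd].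
Qed.

Definition lebesgue_cons : set (n.+1.-tuple mR) -> \bar R :=
  pushforward (@lebesgue_measure R \x mu)%E tuple_cons.

Let lebesgue_cons0 : lebesgue_cons set0 = 0%E.
Proof. by rewrite /lebesgue_cons /pushforward preimage_set0 measure0. Qed.

Let lebesgue_cons_ge0 A : (0 <= lebesgue_cons A)%E.
Proof. by rewrite /lebesgue_cons /pushforward; exact: measure_ge0. Qed.

Let lebesgue_cons_sigma_additive : semi_sigma_additive lebesgue_cons.
Proof.
move=> F mF tF mUF; rewrite /lebesgue_cons /pushforward preimage_bigcup.
have mpre A : measurable A -> measurable (tuple_cons @^-1` A).
  by move=> mA; rewrite -[X in measurable X]setTI; exact: measurable_tuple_cons.
apply: measure_semi_sigma_additive.
- by move=> k; exact: mpre.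
- apply/trivIsetP => /= i j _ _ ij; rewrite -preimage_setI.
  by move/trivIsetP : tF => /(_ _ _ _ _ ij) ->//; rewrite preimage_set0.
- by rewrite -preimage_bigcup; exact: mpre.
Qed.

HB.instance Definition _ := isMeasure.Build _ _ _ lebesgue_cons
  lebesgue_cons0 lebesgue_cons_ge0 lebesgue_cons_sigma_additive.

Let lebesgue_prod_sigma_finite :
  sigma_finite setT (@lebesgue_measure R \x mu)%E.
Proof.
have /sigma_finiteP[F [TF ndF Foo]] := sigma_finiteT (@lebesgue_measure R).
have /sigma_finiteP[G [TG ndG Goo]] := sigma_finiteT mu.
exists (fun k => F k `*` G k).
  rewrite -setXTT TF TG predeqE => -[x y]; split.
    move=> [/= [k _ Fkx] [l _ Gly]]; exists (maxn k l) => //; split.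
    - by move: x Fkx; exact/subsetPset/ndF/leq_maxl.
    - by move: y Gly; exact/subsetPset/ndG/leq_maxr.
  by move=> [k _ []/= ? ?]; split; exists k.
move=> k; have [? ?] := Foo k; have [? ?] := Goo k.
split; first exact: measurableX.
by rewrite product_measure1E// lte_mul_pinfty// ge0_fin_numE.
Qed.

Let lebesgue_cons_sigma_finite : sigma_finite setT lebesgue_cons.
Proof.
have [F TF mF] := lebesgue_prod_sigma_finite.
pose split_tuple (u : n.+1.-tuple mR) : mR * n.-tuple mR :=
  (thead u, [tuple of behead u]).
have tK : cancel tuple_cons split_tuple.
  by move=> [x u]; rewrite /split_tuple theadE; congr pair; exact/val_inj.
have mst : measurable_fun setT split_tuple.
  apply: measurable_fun_pair; first exact: measurable_tnth.
  exact: measurable_behead.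
exists (fun k => split_tuple @^-1` F k).
  by rewrite -preimage_bigcup -TF preimage_setT.
move=> k; have [mFk Fk] := mF k; split.
  by rewrite -[X in measurable X]setTI; exact: mst.
rewrite /lebesgue_cons /pushforward -comp_preimage.
by rewrite (_ : split_tuple \o tuple_cons = id) //; apply/funext => p; exact: tK.
Qed.

HB.instance Definition _ := Measure_isSigmaFinite.Build _ _ _ lebesgue_cons
  lebesgue_cons_sigma_finite.

End step.

Fixpoint lebesgue_tuple (n : nat) :
    {sigma_finite_measure set (n.-tuple mR) -> \bar R} :=
  if n is m.+1 then lebesgue_cons (lebesgue_tuple m)
  else \d_([tuple] : 0.-tuple mR).

End lebesgue_tuple.

Section hypercube_sections.
Context (R : realType) (d : nat).
Implicit Types (x y u v p : 'rV[R]_d) (H A : set 'rV[R]_d).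

Definition dotp x y : R := \sum_i x 0 i * y 0 i.

(* The library norm on matrices is the sup norm. *)
Definition enorm x : R := Num.sqrt (dotp x x).

Definition cube : set 'rV[R]_d := [set x | forall i, 0 <= x 0 i <= 1].

Definition cube_center : 'rV[R]_d := const_mx 2^-1.

Definition hyperplane H : Prop :=
  exists (a : 'rV[R]_d) (b : R), a != 0 /\ H = [set x | dotp a x = b].

Definition dist_to x H : R := inf [set enorm (y - x) | y in H].

Definition frame_map (f : 'rV[R]_d * 'M[R]_(d.-1, d))
    (u : d.-1.-tuple (measurableTypeR R)) : 'rV[R]_d :=
  f.1 + (\row_i tnth u i) *m f.2.

(* Rows of [f.2] orthonormal: [frame_map f] is an isometry of R^(d-1) onto H. *)
Definition orthonormal_frame H : set ('rV[R]_d * 'M[R]_(d.-1, d)) :=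
  [set f | f.2 *m f.2^T = 1%:M /\ range (frame_map f) = H].

(* (d-1)-dimensional volume of the part of A lying in the hyperplane H: Lebesgue
   measure of A in orthonormal coordinates on H. The choice of the coordinates
   is immaterial since Lebesgue measure is invariant under isometries. *)
Definition hyperplane_volume H A : \bar R :=
  lebesgue_tuple R d.-1
    (frame_map (xget (0, 0) (orthonormal_frame H)) @^-1` A).

Definition section_volume H : \bar R := hyperplane_volume H (H `&` cube).

Definition maximal_section (t : R) H : Prop :=
  [/\ hyperplane H, dist_to cube_center H = t &
      forall H', hyperplane H' -> dist_to cube_center H' = t ->
        (section_volume H' <= section_volume H)%E].

Definition cube_vertex : set 'rV[R]_d :=
  [set x | forall i, x 0 i = 0 \/ x 0 i = 1].

(* The #|S|-dimensional face of the cube through the vertex p whose free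
   coordinates are those in S; S = [set: 'I_d] gives the cube itself. *)
Definition face (S : {set 'I_d}) p : set 'rV[R]_d :=
  [set x | cube x /\ forall i, i \notin S -> x 0 i = p 0 i].

Definition face_center (S : {set 'I_d}) p : 'rV[R]_d :=
  \row_i (if i \in S then 2^-1 else p 0 i).

(* u and v are the ends of a diagonal of [face S p]. *)
Definition face_diagonal (S : {set 'I_d}) p u v : Prop :=
  [/\ (cube_vertex `&` face S p) u, (cube_vertex `&` face S p) v &
      v - face_center S p = face_center S p - u].

Definition orthogonal_to_segment H u v : Prop :=
  forall x y, H x -> H y -> dotp (x - y) (v - u) = 0.

(* Faces of dimension 0 are excluded: their diagonal is a single point, to which
   every hyperplane would be orthogonal. *)
Definition orthogonal_to_face_diagonal H : Prop :=
  exists (S : {set 'I_d}) (p u v : 'rV[R]_d),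
    [/\ (0 < #|S|)%N, cube_vertex p, face_diagonal S p u v &
        orthogonal_to_segment H u v].

End hypercube_sections.

Section thresholds.
Context (R : realType).
Implicit Types t : R.

Definition beta_equation t : Prop :=
  (Num.sqrt (2 - 4 * t ^+ 2) - 2 * t) / (1 - 4 * t ^+ 2) =
  Num.sqrt (6 / pi) * expR (- (6 * t ^+ 2)).

Definition is_beta_minus t : Prop :=
  beta_equation t /\ 181611%:R / 10 ^+ 7 < t < 181612%:R / 10 ^+ 7.

Definition is_beta_plus t : Prop :=
  beta_equation t /\ 165625%:R / 10 ^+ 6 < t < 165626%:R / 10 ^+ 6.

Definition delta_poly t : R :=
  575 * Num.sqrt 5 - 528 * Num.sqrt 6
  - 120 * (25 * Num.sqrt 5 - 24 * Num.sqrt 6) * t ^+ 2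
  + 240 * (25 * Num.sqrt 5 - 36 * Num.sqrt 6) * t ^+ 4
  + 17280%:R * t ^+ 5.

Definition is_delta t : Prop :=
  delta_poly t = 0 /\ 222924%:R / 10 ^+ 6 < t < 222925%:R / 10 ^+ 6.

End thresholds.

(* Main.v *)
(* Write s_n(t) for the volume cut by a hyperplane at distance t from the centre
   and orthogonal to a diagonal of an n-dimensional face. It does not depend on
   d: it equals sqrt n f_n(sqrt n t), with f_n the density of a sum of n
   independent uniform variables on [-1/2, 1/2]. The competitor is the hyperplane
   whose trace on a square passes through a vertex; its section volume C(t) is the
   left-hand side of the equation defining beta^- and beta^+, and the claim is
   that s_n(t) < C(t) for all n.

   For n >= 16, Fourier inversion gives pi f_n(x) as the integral of
   (sin u / u)^n cos(2 x u), and replacing (sin u / u)^n by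
   exp(- n u^2 / 6) (1 - n u^4 / 180) with an explicit error bounds s_n(t) by
   G(t) (1 - c(t) / n) + O(1 / n^2), where G(t) = sqrt (6 / pi) exp(- 6 t^2).
   As G and C cross at beta^- and beta^+, a comparison of their rates of decay
   from these two points concludes. For 3 <= n <= 15, s_n is nonincreasing in t,
   so that finitely many exact rational evaluations suffice. *)

Require Import Defs.
From Stdlib Require Import BinInt.
From HB Require Import structures.
From mathcomp Require Import all_boot all_order all_algebra.
From mathcomp Require Import all_classical all_reals all_analysis measurable_realfun.
From mathcomp Require Import ring lra zify ssrZ.

Set Implicit Arguments.
Unset Strict Implicit.
Unset Printing Implicit Defensive.
Import Order.TTheory GRing.Theory Num.Theory.
Import numFieldNormedType.Exports.
Local Open Scope classical_set_scope.
Local Open Scope ring_scope.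

(** * Lebesgue measure under affine maps *)

(** The analytic obstacle sits at the crossing points. As n grows, s_n(t) tends to G(t), and G = C
    at beta^- and beta^+, so the leading term leaves no margin there and the sign must come from the
    1/n term. Here c(t) = (3 - 72 t^2 + 144 t^4) / 20, which is positive for t below about 0.214,
    hence near both crossings. Where c turns negative, C is already far enough ahead of G to pay for
    it. The error must therefore be O(1/n^2) with explicit constants, and n = 16 is where the
    exponentially small tail of the Fourier integral fits into it. The geometric obstacle is that
    the volume is read in an orthonormal frame selected by choice, about which nothing else is
    known. Sections are projected to a coordinate hyperplane instead: the Jacobian of this
    projection is an entry of the unit normal, whatever the frame, and the forgotten coordinate then
    plays the part of one of the n uniform variables. *)

Section affine_line.
Context (R : realType).
Local Notation mR := (measurableTypeR R).
Local Notation lambda := (@lebesgue_measure R).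

Lemma measurable_affine (a c : R) : measurable_fun [set: mR] (fun x : mR => a * x + c : mR).
Proof. by apply: measurable_funD => //; exact: measurable_funM. Qed.

(** By uniqueness of Lebesgue measure, it suffices to compare with the rescaled pushforward on
    half-open intervals. A negative [a] exchanges the ends, so the preimages are then half-open on
    the other side. *)
Lemma lebesgue_measure_affine (a c : R) (A : set mR) : a != 0 -> measurable A ->
  lambda ((fun x : mR => a * x + c : mR) @^-1` A) = (`|a|^-1%:E * lambda A)%E.
Proof.
move=> a0 mA.
have na0 : 0 < `|a| by rewrite normr_gt0.
pose f := fun x : mR => a * x + c : mR.
have mf : measurable_fun [set: mR] f by exact: measurable_affine.
pose P : {measure set mR -> \bar R} := measure_function_pushforward__canonical__measure_function_Measure lambda mf.
suff h : lambda A = mscale (NngNum (normr_ge0 a)) P A.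
  by rewrite h /P /mscale /= /pushforward muleA -EFinM mulVf ?mul1e// normr_eq0.
apply: lebesgue_measure_unique mA => _ [[u v] _ <-] /=.
rewrite /mscale /= /pushforward.
have [a1|a1] := ltP 0 a.
  rewrite (_ : f @^-1` _ = `](u - c) / a, (v - c) / a]%classic); last first.
    apply/seteqP; split => x; rewrite /f /= !in_itv /= ltr_pdivrMr// ler_pdivlMr//;
      rewrite ltrBlDr lerBrDr mulrC //.
  rewrite !lebesgue_measure_itv /= !lte_fin ltr_pM2r ?invr_gt0// ltrD2r.
  case: ifP => _; last by rewrite mule0.
  rewrite -!EFinB -EFinM gtr0_norm//; congr EFin; field; exact: lt0r_neq0.
have {a1} a1 : a < 0 by rewrite lt_neqAle a0.
rewrite (_ : f @^-1` _ = `[(v - c) / a, (u - c) / a[%classic); last first.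
  apply/seteqP; split => x; rewrite /f /= !in_itv /= ltr_ndivlMr// ler_ndivrMr//;
    rewrite ltrBlDr lerBrDr mulrC andbC //.
rewrite !lebesgue_measure_itv /= !lte_fin ltr_nM2r ?invr_lt0// ltrD2r.
case: ifP => _; last by rewrite mule0.
rewrite -!EFinB -EFinM ltr0_norm//; congr EFin; field; exact: ltr0_neq0.
Qed.

Lemma ge0_integral_affine (a c : R) (h : mR -> \bar R) : a != 0 ->
  measurable_fun setT h -> (forall x, 0 <= h x)%E ->
  (\int[lambda]_x h (a * x + c)%R = `|a|^-1%:E * \int[lambda]_x h x)%E.
Proof.
move=> a0 mh h0.
pose f := fun x : mR => a * x + c : mR.
have mf : measurable_fun [set: mR] f by exact: measurable_affine.
have E := @ge0_integral_pushforward _ _ _ _ _ f mf lambda setT h measurableT mh.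
rewrite preimage_setT /= in E.
rewrite -{}E; last by move=> x _; exact: h0.
have ia0 : 0 <= `|a|^-1 by [].
rewrite (_ : `|a|^-1%:E = (NngNum ia0)%:num%:E)%E //.
rewrite -ge0_integral_mscale//.
apply: eq_measure_integral => A mA _.
rewrite /= /mscale /= -(lebesgue_measure_affine c) //.
Qed.

End affine_line.

Section lebesgue_tuple_slices.
Context (R : realType).
Local Notation mR := (measurableTypeR R).
Local Notation lambda := (@lebesgue_measure R).
Local Notation Lam n := (lebesgue_tuple R n).

Lemma measurable_tuple_slice n (A : set (n.+1.-tuple mR)) (x : mR) : measurable A ->
  measurable [set u : n.-tuple mR | A (tuple_cons (x, u))].
Proof.
move=> mA; have -> : [set u : n.-tuple mR | A (tuple_cons (x, u))] = xsection (@tuple_cons R n @^-1` A) x.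
  by apply/seteqP; split => u; rewrite /xsection /= inE.
apply: measurable_xsection; rewrite -[X in measurable X]setTI.
exact: measurable_tuple_cons.
Qed.

Lemma lebesgue_tuple_slice n (A : set (n.+1.-tuple mR)) :
  lebesgue_tuple R n.+1 A =
  (\int[lambda]_x lebesgue_tuple R n [set u | A (tuple_cons (x, u))])%E.
Proof.
rewrite /= /lebesgue_cons /pushforward /product_measure1.
apply: eq_integral => x _; congr (lebesgue_tuple R n _).
by apply/seteqP; split => u; rewrite /xsection /= inE.
Qed.

Lemma measurable_fun_tuple_slice n (A : set (n.+1.-tuple mR)) : measurable A ->
  measurable_fun setT (fun x : mR => lebesgue_tuple R n [set u | A (tuple_cons (x, u))]).
Proof.
move=> mA; have mA' : measurable (@tuple_cons R n @^-1` A).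
  by rewrite -[X in measurable X]setTI; exact: measurable_tuple_cons.
have := measurable_fun_xsection (Lam n) mA'.
congr (measurable_fun _ _); apply/funext => x /=.
congr (lebesgue_tuple R n _).
by apply/seteqP; split => u; rewrite /xsection /= inE.
Qed.

(** Tonelli in the other order. It is the order suited to shears, which move the first coordinate by
    an amount depending on the others. *)
Lemma lebesgue_tuple_slice2 n (A : set (n.+1.-tuple mR)) : measurable A ->
  lebesgue_tuple R n.+1 A =
  (\int[lebesgue_tuple R n]_u lambda [set x : mR | A (tuple_cons (x, u))])%E.
Proof.
move=> mA; have mA' : measurable (@tuple_cons R n @^-1` A).
  by rewrite -[X in measurable X]setTI; exact: measurable_tuple_cons.
have := indic_fubini_tonelli lambda (Lam n) mA'.
rewrite indic_fubini_tonelli_FE// indic_fubini_tonelli_GE//.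
rewrite lebesgue_tuple_slice => h; transitivity (\int[lambda]_x (lebesgue_tuple R n \o xsection (@tuple_cons R n @^-1` A)) x)%E.
  apply: eq_integral => x _ /=; congr (lebesgue_tuple R n _).
  by apply/seteqP; split => u; rewrite /xsection /= inE.
rewrite {}h; apply: eq_integral => x _ /=; congr (lambda _).
by apply/seteqP; split => u; rewrite /ysection /= inE.
Qed.

End lebesgue_tuple_slices.

Section lebesgue_tuple_affine.
Context (R : realType).
Local Notation mR := (measurableTypeR R).
Local Notation lambda := (@lebesgue_measure R).
Local Notation Lam n := (lebesgue_tuple R n).

Definition row_of_tuple n (u : n.-tuple mR) : 'rV[R]_n := \row_i tnth u i.

Definition tuple_of_row n (r : 'rV[R]_n) : n.-tuple mR := [tuple r 0 i | i < n].

Definition affine_tuple n m (c : 'rV[R]_m) (B : 'M[R]_(n, m)) (u : n.-tuple mR) : m.-tuple mR :=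
  tuple_of_row (c + row_of_tuple u *m B).

Lemma tuple_of_rowK n : cancel (@tuple_of_row n) (@row_of_tuple n).
Proof. by move=> r; apply/rowP => i; rewrite mxE tnth_mktuple. Qed.

Lemma row_of_tupleK n : cancel (@row_of_tuple n) (@tuple_of_row n).
Proof. by move=> r; apply/eq_from_tnth => i; rewrite tnth_mktuple mxE. Qed.

Lemma measurable_affine_tuple n m (c : 'rV[R]_m) (B : 'M[R]_(n, m)) :
  measurable_fun setT (affine_tuple c B).
Proof.
apply/measurable_fun_tnthP => i.
rewrite (_ : _ \o _ = fun u : n.-tuple mR => c 0 i + \sum_j tnth u j * B j i); last first.
  apply/funext => u /=; rewrite tnth_mktuple !mxE; congr (_ + _).
  by apply: eq_bigr => j _; rewrite mxE.
apply: measurable_funD => //.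
apply: measurable_sum => j; apply: measurable_funM => //.
exact: measurable_tnth.
Qed.

Lemma measurable_preimage_affine_tuple n m (c : 'rV[R]_m) (B : 'M[R]_(n, m)) A :
  measurable A -> measurable (affine_tuple c B @^-1` A).
Proof.
by move=> mA; rewrite -[X in measurable X]setTI; exact: measurable_affine_tuple.
Qed.

Lemma affine_tuple_comp n m p (c : 'rV[R]_m) (B : 'M[R]_(n, m)) (c' : 'rV[R]_p) (B' : 'M[R]_(m, p)) u :
  affine_tuple c' B' (affine_tuple c B u) = affine_tuple (c' + c *m B') (B *m B') u.
Proof. by rewrite /affine_tuple tuple_of_rowK mulmxDl addrA mulmxA. Qed.

(** The translation [c] is quantified inside because slicing a block matrix turns its off-diagonal
    row into a translation that varies with the slice. *)
Definition scales_volume n (B : 'M[R]_n) : Prop := forall (c : 'rV[R]_n) A, measurable A ->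
  lebesgue_tuple R n (affine_tuple c B @^-1` A) = (`|\det B|^-1%:E * lebesgue_tuple R n A)%E.

Lemma scales_volumeM n (B C : 'M[R]_n) :
  scales_volume B -> scales_volume C -> scales_volume (B *m C).
Proof.
move=> hB hC c A mA.
rewrite det_mulmx normrM invfM EFinM -muleA -(hC c) // -(hB 0); last exact: measurable_preimage_affine_tuple.
congr (lebesgue_tuple _ _ _); apply/seteqP; split => u /=;
  by rewrite affine_tuple_comp mul0mx addr0.
Qed.

Lemma row_of_tuple_cons n (x : mR) (u : n.-tuple mR) :
  row_of_tuple (tuple_cons (x, u)) = row_mx x%:M (row_of_tuple u).
Proof.
apply/rowP => i; case: (@fintype.splitP 1 n i) => j ij.
  have -> : i = @lshift 1 n j by exact/val_inj.
  by rewrite (@row_mxEl _ 1 1 n) !mxE (ord1 j) eqxx (tnth_nth 0).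
have -> : i = @rshift 1 n j by exact/val_inj.
by rewrite (@row_mxEr _ 1 1 n) !mxE !(tnth_nth 0).
Qed.

Lemma tuple_of_row_mx n (x : R) (r : 'rV[R]_n) :
  tuple_of_row (row_mx x%:M r : 'rV[R]_n.+1) = tuple_cons (x, tuple_of_row r).
Proof.
apply: (can_inj (@row_of_tupleK n.+1)).
by rewrite row_of_tuple_cons !tuple_of_rowK.
Qed.

Lemma row_split n (c : 'rV[R]_n.+1) : exists (x : R) (r : 'rV[R]_n), c = row_mx x%:M r.
Proof.
exists (c 0 0), (@rsubmx _ 1 1 n c); rewrite -[LHS](@hsubmxK _ 1 1 n c).
congr (@row_mx _ 1 1 n _ _); apply/rowP => i; rewrite (ord1 i) !mxE eqxx mulr1n.
by congr (c _ _); apply/val_inj.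
Qed.

Lemma affine_tuple_block n (c0 a x : R) (c1 r : 'rV[R]_n) (w : 'cV[R]_n) (D : 'M[R]_n)
    (u : n.-tuple mR) :
  affine_tuple (row_mx c0%:M c1 : 'rV[R]_n.+1) (block_mx a%:M r w D : 'M[R]_n.+1)
    (tuple_cons (x, u)) =
  tuple_cons (c0 + (a * x + (row_of_tuple u *m w) 0 0),
              affine_tuple (c1 + x *: r) D u).
Proof.
rewrite /affine_tuple -tuple_of_row_mx row_of_tuple_cons.
rewrite (@mul_row_block R 1 1 n 1 n) (@add_row_mx R 1 1 n) -scalar_mxM mul_scalar_mx.
rewrite [row_of_tuple u *m w]mx11_scalar -!raddfD /= addrA mulrC !mxE eqxx mulr1n.
by rewrite !addrA.
Qed.

Lemma scales_volume_lower n (a : R) (r : 'rV[R]_n) (D : 'M[R]_n) : a != 0 ->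
  scales_volume D -> @scales_volume n.+1 (block_mx a%:M r 0 D : 'M[R]_(1 + n)).
Proof.
move=> a0 hD c A mA.
have [c0 [c1 ->]] := row_split c.
rewrite !lebesgue_tuple_slice.
transitivity (\int[lambda]_x (`|\det D|^-1%:E * lebesgue_tuple R n [set u | A (tuple_cons ((a * x + c0)%R, u))]))%E.
  apply: eq_integral => x _.
  rewrite -(hD (c1 + x *: r)); last exact: measurable_tuple_slice.
  congr (lebesgue_tuple _ _ _); apply/seteqP; split => u /=;
    by rewrite affine_tuple_block mulmx0 mxE addr0 addrC.
rewrite ge0_integralZl//; last first.
  have := measurable_fun_tuple_slice mA.
  move=> /measurableT_comp; apply; exact: measurable_affine.
have := @ge0_integral_affine R a c0 (fun y => lebesgue_tuple R n [set u | A (tuple_cons (y, u))]) a0.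
move=> -> //; last exact: measurable_fun_tuple_slice.
by rewrite (@det_ublock R 1 n) det_scalar1 muleA -EFinM normrM invfM mulrC.
Qed.

(** This is translation invariance, since the vector [c] of [scales_volume] is arbitrary. *)
Lemma scales_volume1 n : scales_volume (1%:M : 'M[R]_n).
Proof.
elim: n => [|n IHn].
  move=> c A mA; rewrite det1 normr1 invr1 mul1e; congr (lebesgue_tuple _ _ _).
  by apply/seteqP; split => u /=; rewrite [affine_tuple _ _ _]tuple0 [u]tuple0.
rewrite (_ : 1%:M = (block_mx 1%:M 0 0 1%:M : 'M[R]_(1 + n))); last by rewrite -scalar_mx_block.
exact: scales_volume_lower (oner_neq0 _) IHn.
Qed.

Lemma scales_volume_shear n (w : 'cV[R]_n) :
  @scales_volume n.+1 (block_mx 1%:M 0 w 1%:M : 'M[R]_(1 + n)).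
Proof.
move=> c A mA.
have [c0 [c1 ->]] := row_split c.
rewrite (@det_lblock R 1 n) !det1 mulr1 normr1 invr1 mul1e.
rewrite lebesgue_tuple_slice2; last exact: measurable_preimage_affine_tuple.
pose A' := affine_tuple (row_mx 0%:M c1 : 'rV[R]_(1 + n)) (1%:M : 'M[R]_n.+1) @^-1` A.
have mA' : measurable A' by exact: measurable_preimage_affine_tuple.
transitivity (lebesgue_tuple R n.+1 A'); last first.
  by rewrite /A' scales_volume1// det1 normr1 invr1 mul1e.
rewrite (lebesgue_tuple_slice2 mA'); apply: eq_integral => u _.
pose b := c0 + (row_of_tuple u *m w) 0 0.
have mS : measurable [set x | A' (tuple_cons (x, u))].
  have := @measurable_ysection _ _ _ _ (@tuple_cons R n @^-1` A') u.
  rewrite (_ : ysection _ _ = [set x | A' (tuple_cons (x, u))]).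
    by apply; rewrite -[X in measurable X]setTI; exact: measurable_tuple_cons.
  by apply/seteqP; split => x; rewrite /ysection /= inE.
have := lebesgue_measure_affine b (oner_neq0 R) mS.
have E y : affine_tuple (row_mx 0%:M c1 : 'rV[R]_n.+1) (1%:M : 'M[R]_n.+1) (tuple_cons (y, u)) =
    tuple_cons (y, affine_tuple c1 1%:M u).
  have := affine_tuple_block 0 1 y c1 0 0 1%:M u.
  rewrite scaler0 addr0 mulmx0 mxE addr0 mul1r add0r => <-.
  by congr (affine_tuple _ _ _); rewrite (@scalar_mx_block R 1 n).
rewrite normr1 invr1 mul1e => <-; congr (lambda _); apply/seteqP; split => x /=;
  by rewrite /A' /= E affine_tuple_block scaler0 addr0 /b mul1r addrCA.
Qed.

(** Gaussian elimination: a matrix with nonzero corner entry is a shear times a block triangular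
    matrix whose last block is the Schur complement [D'], to which the induction hypothesis
    applies. *)
Theorem scales_volume_unit n (B : 'M[R]_n) : B \in unitmx -> scales_volume B.
Proof.
elim: n B => [|n IHn] B uB; first by rewrite (_ : B = 1%:M); [exact: scales_volume1|rewrite [LHS]flatmx0 [RHS]flatmx0].
have pivot (C : 'M[R]_(1 + n)) : C \in unitmx -> C 0 0 != 0 -> scales_volume C.
  move=> uC C00.
  rewrite -[C]submxK.
  set r := ursubmx C; set w := dlsubmx C; set D := drsubmx C.
  have -> : ulsubmx C = (C 0 0)%:M.
    by rewrite [LHS]mx11_scalar; congr (_%:M); rewrite !mxE; congr (C _ _); apply/val_inj.
  set a := C 0 0 in C00 *.
  pose D' := D - (a^-1 *: w) *m r.
  have E : block_mx a%:M r w D = (block_mx 1%:M 0 (a^-1 *: w) 1%:M) *m (block_mx a%:M r 0 D') :> 'M[R]_(1 + n).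
    rewrite mulmx_block !mul1mx !mul0mx !addr0 /D'.
    by rewrite mul_mx_scalar scalerA divff// scale1r [_ + (D - _)]addrC subrK.
  have detE : \det C = a * \det D'.
    rewrite -[C]submxK (_ : ulsubmx C = a%:M); last first.
      by rewrite [LHS]mx11_scalar; congr (_%:M); rewrite !mxE; congr (C _ _); apply/val_inj.
    by rewrite E det_mulmx det_lblock !det1 !mul1r det_ublock det_scalar1.
  rewrite E; apply: scales_volumeM; first exact: scales_volume_shear.
  apply: scales_volume_lower => //; apply: IHn.
  by move: uC; rewrite !unitmxE !unitfE detE mulf_eq0 negb_or => /andP[].
have [B00|] := eqVneq (B 0 0) 0; last exact: pivot.
have [i Bi] : exists i : 'I_n.+1, B i 0 != 0.
  apply/existsP; apply: contraTT uB => /existsPn Bi.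
  rewrite unitmxE unitfE negbK; apply/eqP.
  rewrite (expand_det_col _ ord0) big1// => i _.
  by have := Bi i; rewrite negbK => /eqP ->; rewrite mul0r.
have i0 : i != 0 by apply: contra_neq Bi => ->.
have [j ij] : exists j : 'I_n, i = lift ord0 j.
  by case: (unliftP ord0 i) i0 => [j -> _|->]; [exists j|rewrite eqxx].
(* Left multiplication by [S 1] adds row [i] of [B] to its first row, which creates a nonzero pivot;
   [S (-1)] undoes it. *)
pose S (s : R) : 'M[R]_(1 + n) := block_mx 1%:M (s *: delta_mx 0 j) 0 1%:M.
have SS : S (-1) *m S 1 = 1%:M.
  rewrite /S mulmx_block !mul1mx !mul0mx !mulmx0 !mulmx1 !addr0 add0r -scalerDl subrr scale0r.
  by rewrite -scalar_mx_block.
have dS s : \det (S s) = 1 by rewrite det_ublock !det1 mulr1.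
rewrite -[B]mul1mx -SS -mulmxA; apply: scales_volumeM.
  by apply: scales_volume_lower; [exact: oner_neq0|exact: scales_volume1].
apply: pivot.
  by rewrite unitmxE det_mulmx dS mul1r -unitmxE.
have Sk k : S 1 0 (lift ord0 k) = (k == j)%:R.
  rewrite (_ : lift ord0 k = @rshift 1 n k); last exact/val_inj.
  rewrite (_ : 0 = @lshift 1 n 0); last exact/val_inj.
  by rewrite block_mxEur !mxE eqxx mul1r.
have S0 : S 1 0 0 = 1.
  rewrite (_ : 0 = @lshift 1 n 0); last exact/val_inj.
  by rewrite block_mxEul !mxE eqxx.
have -> : (S 1 *m B) 0 0 = B 0 0 + B i 0.
  rewrite mxE big_ord_recl (bigD1 j)//= big1 ?addr0.
    by rewrite S0 Sk eqxx !mul1r ij.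
  by move=> k kj; rewrite Sk (negbTE kj) mul0r.
by rewrite B00 add0r.
Qed.

End lebesgue_tuple_affine.

(** * Sections as graphs over a face *)

Section section_volume_graph.
Context (R : realType).
Local Notation mR := (measurableTypeR R).
Local Notation lambda := (@lebesgue_measure R).

Lemma dotpE d (x y : 'rV[R]_d) : dotp x y = (x *m y^T) 0 0.
Proof. by rewrite !mxE; apply: eq_bigr => i _; rewrite mxE. Qed.

Lemma dotp_mx11 d (x y : 'rV[R]_d) : x *m y^T = (dotp x y)%:M.
Proof. by rewrite dotpE [LHS]mx11_scalar. Qed.

Lemma dotpC d (x y : 'rV[R]_d) : dotp x y = dotp y x.
Proof. by apply: eq_bigr => i _; rewrite mulrC. Qed.

Lemma dotpDl d (x y z : 'rV[R]_d) : dotp (x + y) z = dotp x z + dotp y z.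
Proof. by rewrite !dotpE mulmxDl mxE. Qed.

Lemma dotpZl d (k : R) (x z : 'rV[R]_d) : dotp (k *: x) z = k * dotp x z.
Proof. by rewrite !dotpE -scalemxAl mxE. Qed.

Lemma dotpDr d (x y z : 'rV[R]_d) : dotp z (x + y) = dotp z x + dotp z y.
Proof. by rewrite dotpC dotpDl !(dotpC z). Qed.

Lemma dotpZr d (k : R) (x z : 'rV[R]_d) : dotp z (k *: x) = k * dotp z x.
Proof. by rewrite dotpC dotpZl (dotpC z). Qed.

Lemma dotpBl d (x y z : 'rV[R]_d) : dotp (x - y) z = dotp x z - dotp y z.
Proof. by rewrite -scaleN1r dotpDl dotpZl mulN1r. Qed.

Lemma dotpBr d (x y z : 'rV[R]_d) : dotp z (x - y) = dotp z x - dotp z y.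
Proof. by rewrite dotpC dotpBl !(dotpC z). Qed.

Lemma dotp_eq0 d (x : 'rV[R]_d) : dotp x x = 0 -> x = 0.
Proof.
move=> /eqP; rewrite psumr_eq0 => [/allP h|i _]; last by rewrite -expr2 sqr_ge0.
apply/rowP => i; rewrite mxE; apply/eqP.
by have := h i (mem_index_enum _); rewrite mulf_eq0 orbb.
Qed.

Lemma usubmx_row n p (Q : 'M[R]_(n.+1, p)) : row 0 Q = @usubmx _ 1 n p Q.
Proof. by apply/rowP => i; rewrite !mxE; congr (Q _ _); apply/val_inj. Qed.

(* Householder reflection exchanging [a] and the first basis vector. *)
Lemma orthogonal_completion n (a : 'rV[R]_n.+1) : dotp a a = 1 ->
  exists M : 'M[R]_(n, n.+1), let Q := col_mx a M : 'M[R]_(1 + n) in Q *m Q^T = 1%:M.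
Proof.
move=> a1; pose e : 'rV[R]_n.+1 := delta_mx 0 0; pose v := a - e.
pose Q : 'M[R]_n.+1 := 1%:M - (2 / dotp v v) *: (v^T *m v).
have ev : dotp e e = 1.
  rewrite /dotp (bigD1 ord0)//= big1 ?addr0 ?mxE ?eqxx ?mulr1// => i i0.
  by rewrite !mxE (negbTE i0) andbF mul0r.
have vvE : dotp v v = - 2 * dotp e v.
  have -> : dotp v v = dotp a a - 2 * dotp a e + dotp e e.
    by rewrite /v !(dotpBl,dotpBr) (dotpC e a); ring.
  by rewrite /v dotpBr a1 ev (dotpC e a); ring.
have eQ : e *m Q = a.
  rewrite mulmxBr mulmx1 -scalemxAr mulmxA dotp_mx11 mul_scalar_mx scalerA.
  have [v0|v0] := eqVneq (dotp v v) 0.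
    by rewrite (dotp_eq0 v0) scaler0 subr0; apply/esym/eqP; rewrite -subr_eq0 -/v (dotp_eq0 v0).
  have -> : 2 / dotp v v * dotp e v = -1.
    by move: v0; rewrite vvE => v0; field; move: v0; rewrite mulf_eq0 negb_or => /andP[].
  by rewrite scaleN1r opprK /v addrC subrK.
have QT : Q^T = Q.
  by rewrite /Q linearB /= trmx1 linearZ /= trmx_mul trmxK.
have QQ : Q *m Q^T = 1%:M.
  rewrite QT /Q mulmxBr mulmx1 mulmxBl mul1mx -scalemxAr -scalemxAl scalerA.
  rewrite mulmxA -[v^T *m v *m v^T]mulmxA dotp_mx11 mul_mx_scalar -scalemxAl scalerA.
  rewrite opprB addrA -[RHS]addr0; rewrite -addrA -addrA; congr (_ + _).
  rewrite -!scalerBl -scaleNr -scalerDl.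
  have [v0|v0] := eqVneq (dotp v v) 0.
    by rewrite (dotp_eq0 v0) mulmx0 scaler0.
  suff -> : - (2 / dotp v v) + (2 / dotp v v * (2 / dotp v v) * dotp v v - 2 / dotp v v) = 0 by rewrite scale0r.
  by field.
exists (@dsubmx _ 1 n n.+1 Q) => /=.
suff -> : col_mx a (@dsubmx _ 1 n n.+1 Q) = Q by [].
rewrite -[RHS](@vsubmxK _ 1 n n.+1); congr (@col_mx _ 1 n n.+1 _ _).
rewrite -eQ -rowE; exact: usubmx_row.
Qed.

Lemma orthonormal_frame_exists n (a : 'rV[R]_n.+1) b : dotp a a = 1 ->
  orthonormal_frame [set x | dotp a x = b] !=set0.
Proof.
move=> a1; have [M] := orthogonal_completion a1; set Q := col_mx a M => /= QQ.
have QQ' : Q^T *m Q = 1%:M by apply: mulmx1C.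
move: QQ; rewrite {1 2}/Q tr_col_mx mul_col_row scalar_mx_block => /eq_block_mx[_ aM _ MM].
move: QQ'; rewrite /Q tr_col_mx mul_row_col => aaMM.
exists (b *: a, M); split => //=; apply/seteqP; split => x /=.
  move=> [u _ <-]; rewrite /frame_map /= dotpDr dotpZr a1 mulr1.
  by rewrite dotpE trmx_mul mulmxA aM mul0mx mxE addr0.
move=> xb; exists (tuple_of_row (x *m M^T)) => //.
rewrite /frame_map /= -/(row_of_tuple _) tuple_of_rowK -mulmxA.
rewrite -[RHS]mulmx1 -aaMM mulmxDr; congr (_ + _).
by rewrite mulmxA dotp_mx11 mul_scalar_mx dotpC xb.
Qed.

Lemma frame_orthogonal n (a : 'rV[R]_n.+1) b f :
  orthonormal_frame [set x | dotp a x = b] f -> dotp a f.1 = b /\ a *m f.2^T = 0.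
Proof.
move=> [/= MM /seteqP [fH _]].
have h u : dotp a (f.1 + row_of_tuple u *m f.2) = b by apply: fH; exists u.
have f1 : dotp a f.1 = b.
  have := h (tuple_of_row 0); rewrite tuple_of_rowK mul0mx addr0 //.
split=> //; apply/rowP => i; rewrite [RHS]mxE.
have := h (tuple_of_row (delta_mx 0 i)); rewrite tuple_of_rowK dotpDr f1 -[RHS]addr0 => /addrI.
rewrite -rowE dotpC /dotp => E; rewrite mxE -[RHS]E; apply: eq_bigr => k _.
by rewrite !mxE mulrC.
Qed.

(** The matrix [W] with rows [a] and [M] is orthogonal, so its adjugate is [\det W *: W^T]. Up to
    sign, the minor is the cofactor of the entry [a 0 j] of [W]. *)
Lemma frame_minor n (a : 'rV[R]_n.+1) (M : 'M[R]_(n, n.+1)) j : dotp a a = 1 ->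
  M *m M^T = 1%:M -> a *m M^T = 0 -> `|\det (col' j M)| = `|a 0 j|.
Proof.
move=> a1 MM aM; pose W : 'M[R]_(1 + n) := col_mx a M.
have WW : W *m W^T = 1%:M.
  rewrite /W tr_col_mx mul_col_row aM MM dotp_mx11 a1 scalar_mx_block.
  by congr (block_mx _ _ _ _); rewrite -[LHS]trmxK trmx_mul trmxK aM trmx0.
have dW : `|\det W| = 1.
  have := congr1 determinant WW; rewrite det_mulmx det_tr det1 -expr2 => /eqP.
  by rewrite sqrf_eq1 => /orP[] /eqP ->; rewrite ?normrN normr1.
have E : \adj W = \det W *: W^T.
  rewrite -[LHS]mulmx1 -WW mulmxA mul_adj_mx mul_scalar_mx //.
have W0 : W 0 j = a 0 j.
  rewrite (_ : 0 = @lshift 1 n 0); last exact/val_inj.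
  by rewrite col_mxEu.
have : cofactor W 0 j = \det W * a 0 j.
  by have /matrixP/(_ j 0) := E; rewrite mxE [RHS]mxE [W^T _ _]mxE W0.
move=> /(congr1 Num.norm); rewrite [RHS]normrM dW mul1r => <-.
rewrite /cofactor normrM normrX normrN1 expr1n mul1r.
congr (`|\det _|); apply/matrixP => k l; rewrite [LHS]mxE [RHS]mxE [RHS]mxE.
rewrite (_ : lift 0 k = @rshift 1 n k); last exact/val_inj.
by rewrite col_mxEd.
Qed.

(** Shape of a section after one coordinate is forgotten: [B] will express that the forgotten
    coordinate, an affine function of the others on the hyperplane, lies in [0, 1]. *)
Definition cube_slab n (c : 'I_n -> R) (B : set mR) : set (n.-tuple mR) :=
  [set y | (forall i, 0 <= tnth y i <= 1) /\ B (\sum_i c i * tnth y i)].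

Lemma measurable_cube_slab n (c : 'I_n -> R) (B : set mR) : measurable B ->
  measurable (cube_slab c B).
Proof.
move=> mB; apply: measurableI; last first.
  rewrite -[X in measurable X]setTI.
  have : measurable_fun setT (fun y : n.-tuple mR => \sum_i c i * tnth y i : mR).
    apply: measurable_sum => j; apply: measurable_funM => //; exact: measurable_tnth.
  exact.
rewrite [X in measurable X](_ : _ = \bigcap_(i in [set: 'I_n]) [set y : n.-tuple mR | 0 <= tnth y i <= 1]).
  apply: fin_bigcap_measurable => // i _.
  rewrite (_ : [set _ | _] = (fun y : n.-tuple mR => tnth y i) @^-1` `[0, 1]%classic).
    by rewrite -[X in measurable X]setTI; exact: measurable_tnth.
  by apply/seteqP; split => y /=; rewrite in_itv.
by apply/seteqP; split => y /= h i //=; exact: h.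
Qed.

(** Forgetting the coordinate [j] maps the hyperplane bijectively onto R^n, and in any orthonormal
    frame its Jacobian is the minor of [frame_minor]. The frame picked by [xget] thus has no
    influence on the value. *)
Theorem section_volume_graph n (a : 'rV[R]_n.+1) (b : R) (j : 'I_n.+1) :
  dotp a a = 1 -> a 0 j != 0 ->
  section_volume [set x | dotp a x = b] =
  (`|a 0%R j|^-1%:E * lebesgue_tuple R n
    (cube_slab (fun i => a 0%R (lift j i)) [set s | 0 <= (b - s) / a 0 j <= 1]%R))%E.
Proof.
move=> a1 aj; rewrite /section_volume /hyperplane_volume.
set H := [set x | _].
have [f fH] := orthonormal_frame_exists b a1.
have := xgetPex (0, 0) (ex_intro _ f fH : exists f, orthonormal_frame H f).
move: (xget _ _) => {f fH} f fH.
have [f1 aM] := frame_orthogonal fH.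
have MM := fH.1.
have minor := frame_minor j a1 MM aM.
have uN : col' j f.2 \in unitmx.
  by rewrite unitmxE unitfE -normr_eq0 minor normr_eq0.
rewrite -minor -(scales_volume_unit uN (col' j f.1)); last first.
  apply: measurable_cube_slab.
  rewrite (_ : [set _ | _] = (fun s : mR => - (a 0 j)^-1 * s + b / a 0 j : mR) @^-1` `[0, 1]%classic).
    by rewrite -[X in measurable X]setTI; exact: measurable_affine.
  apply/seteqP; split => s /=; rewrite in_itv /= mulrBl addrC mulNr (mulrC s) //.
congr (lebesgue_tuple R n _).
have fu u : dotp a (frame_map f u) = b.
  have /seteqP [h _] := fH.2; apply: h; by exists u.
have coord u i : tnth (affine_tuple (col' j f.1) (col' j f.2) u) i = frame_map f u 0 (lift j i).
  rewrite tnth_mktuple !mxE; congr (_ + _); apply: eq_bigr => k _; by rewrite !mxE.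
have jcoord u : (b - \sum_i a 0 (lift j i) * tnth (affine_tuple (col' j f.1) (col' j f.2) u) i) / a 0 j
    = frame_map f u 0 j.
  rewrite -{1}(fu u) /dotp (bigD1_ord j)//= -addrA -sumrB big1 ?addr0; last first.
    by move=> i _; rewrite coord subrr.
  by rewrite mulrC mulKf.
apply/seteqP; split => u /=.
  move=> [_ cu]; split => [i|]; first by rewrite coord; exact: cu.
  by have := cu j; rewrite -(jcoord u).
move=> [cu cj]; split; first exact: fu.
move=> i; have [k ->|->] := unliftP j i; first by rewrite -coord.
by move: cj; rewrite -(jcoord u).
Qed.

End section_volume_graph.

(** * Derivatives and integrals on the line *)

Section calculus.
Context (R : realType).
Implicit Types (f F G : R -> R).

Lemma is_derive_continuous F f : (forall x : R, is_derive x 1 F (f x)) -> continuous F.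
Proof.
move=> dF x; apply: differentiable_continuous; apply/derivable1_diffP.
by have [] := dF x.
Qed.

Lemma integral_is_derive F f a b : (forall x : R, is_derive x 1 F (f x)) ->
  continuous f -> a < b ->
  (\int[@lebesgue_measure R]_(x in `[a, b]) (f x)%:E = (F b - F a)%:E)%E.
Proof.
move=> dF cf ab.
have cF := is_derive_continuous dF.
rewrite (@continuous_FTC2 _ f F) //.
- exact: continuous_subspaceT.
- split => [x _||]; first by have [] := dF x.
  + by apply: cvg_at_right_filter; exact: cF.
  + by apply: cvg_at_left_filter; exact: cF.
- by move=> x _; rewrite derive1E; exact: (@derive_val _ _ _ _ _ _ _ (dF x)).
Qed.

Lemma nondecreasing_is_derive F f a : (forall x : R, is_derive x 1 F (f x)) ->
  (forall x, a < x -> 0 <= f x) -> forall x y, a <= x -> x <= y -> F x <= F y.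
Proof.
move=> dF f0; apply: ger0_derive1_ndecry.
- by move=> x _; have [] := dF x.
- move=> x; rewrite in_itv /= andbT => ax.
  by rewrite derive1E (@derive_val _ _ _ _ _ _ _ (dF x)) f0.
- exact/continuous_subspaceT/(is_derive_continuous dF).
Qed.

Lemma nonincreasing_is_derive F f a : (forall x : R, is_derive x 1 F (f x)) ->
  (forall x, a < x -> f x <= 0) -> forall x y, a <= x -> x <= y -> F y <= F x.
Proof.
move=> dF f0; apply: ler0_derive1_nincry.
- by move=> x _; have [] := dF x.
- move=> x; rewrite in_itv /= andbT => ax.
  by rewrite derive1E (@derive_val _ _ _ _ _ _ _ (dF x)) f0.
- exact/continuous_subspaceT/(is_derive_continuous dF).
Qed.

Lemma derive_eq F (x f g : R) : is_derive x 1 F f -> f = g -> is_derive x 1 F g.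
Proof. by move=> ? <-. Qed.

Lemma der_cst (c x : R) : is_derive x 1 (fun=> c) 0.
Proof. exact: is_derive_cst. Qed.

Lemma der_id (x : R) : is_derive x 1 (fun y => y) 1.
Proof. exact: is_derive_id. Qed.

Lemma derD F G (x f g : R) : is_derive x 1 F f -> is_derive x 1 G g ->
  is_derive x 1 (fun y => F y + G y) (f + g).
Proof. by move=> ? ?; exact: is_deriveD. Qed.

Lemma derB F G (x f g : R) : is_derive x 1 F f -> is_derive x 1 G g ->
  is_derive x 1 (fun y => F y - G y) (f - g).
Proof. by move=> ? ?; exact: is_deriveB. Qed.

Lemma derN F (x f : R) : is_derive x 1 F f -> is_derive x 1 (fun y => - F y) (- f).
Proof. by move=> ?; exact: is_deriveN. Qed.

Lemma derM F G (x f g : R) : is_derive x 1 F f -> is_derive x 1 G g ->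
  is_derive x 1 (fun y => F y * G y) (f * G x + F x * g).
Proof.
move=> dF dG; have := is_deriveM dF dG.
by move=> h; apply: is_derive_eq h _; rewrite /GRing.scale /= addrC mulrC.
Qed.

Lemma der_comp F G (x f g : R) : is_derive (G x) 1 F f -> is_derive x 1 G g ->
  is_derive x 1 (fun y => F (G y)) (f * g).
Proof.
move=> dF dG; have h := @is_derive1_comp R F G x f g dF dG.
exact: is_derive_eq h _.
Qed.

Lemma derX F n (x f : R) : is_derive x 1 F f ->
  is_derive x 1 (fun y => F y ^+ n) (n%:R * F x ^+ n.-1 * f).
Proof.
move=> dF; have h := @is_deriveX R R F n x 1 f dF.
rewrite (_ : (fun y => _) = F ^+ n); last by apply/funext => y; rewrite exprfctE.
exact: is_derive_eq h _.
Qed.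

Lemma der_expR F (x f : R) : is_derive x 1 F f ->
  is_derive x 1 (fun y => expR (F y)) (expR (F x) * f).
Proof. exact: der_comp. Qed.

Lemma der_sin F (x f : R) : is_derive x 1 F f ->
  is_derive x 1 (fun y => sin (F y)) (cos (F x) * f).
Proof. exact: der_comp. Qed.

Lemma der_cos F (x f : R) : is_derive x 1 F f ->
  is_derive x 1 (fun y => cos (F y)) (- sin (F x) * f).
Proof. exact: der_comp. Qed.

Lemma der_sum (I : Type) (r : seq I) (F : I -> R -> R) (f : I -> R) (x : R) :
  (forall i, is_derive x 1 (F i) (f i)) ->
  is_derive x 1 (fun y => \sum_(i <- r) F i y) (\sum_(i <- r) f i).
Proof.
move=> dF; elim: r => [|i r IH].
  rewrite big_nil (_ : (fun y => _) = fun=> 0); first exact: der_cst.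
  by apply/funext => y; rewrite big_nil.
rewrite big_cons (_ : (fun y => _) = fun y => F i y + \sum_(i <- r) F i y).
  exact: derD.
by apply/funext => y; rewrite big_cons.
Qed.

Lemma cont_cst (c : R) : continuous (fun _ : R => c).
Proof. by move=> x; exact: cvg_cst. Qed.

Lemma cont_id : continuous (fun x : R => x).
Proof. by move=> x; exact: cvg_id. Qed.

Lemma contD F G : continuous F -> continuous G -> continuous (fun x => F x + G x).
Proof. by move=> cF cG x; apply: cvgD; [exact: cF|exact: cG]. Qed.

Lemma contM F G : continuous F -> continuous G -> continuous (fun x => F x * G x).
Proof. by move=> cF cG x; apply: cvgM; [exact: cF|exact: cG]. Qed.

Lemma contN F : continuous F -> continuous (fun x => - F x).
Proof. by move=> cF x; apply: cvgN; exact: cF. Qed.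

Lemma cont_comp F G : continuous F -> continuous G -> continuous (fun x => F (G x)).
Proof. by move=> cF cG x; apply: (@continuous_comp _ _ _ G F); [exact: cG|exact: cF]. Qed.

Lemma contX F n : continuous F -> continuous (fun x => F x ^+ n).
Proof. by move=> cF; apply: (@cont_comp (fun y => y ^+ n) F _ cF) => x; exact: exprn_continuous. Qed.

Lemma cont_expR F : continuous F -> continuous (fun x => expR (F x)).
Proof. by move=> cF; apply: (@cont_comp expR F _ cF) => x; exact: continuous_expR. Qed.

Lemma cont_sin F : continuous F -> continuous (fun x => sin (F x)).
Proof. by move=> cF; apply: (@cont_comp sin F _ cF) => x; exact: continuous_sin. Qed.

Lemma cont_cos F : continuous F -> continuous (fun x => cos (F x)).
Proof. by move=> cF; apply: (@cont_comp cos F _ cF) => x; exact: continuous_cos. Qed.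

Lemma cont_sum (I : Type) (r : seq I) (F : I -> R -> R) :
  (forall i, continuous (F i)) -> continuous (fun y => \sum_(i <- r) F i y).
Proof.
move=> cF; elim: r => [|i r IH].
  by rewrite (_ : (fun y => _) = fun=> 0); [exact: cont_cst|apply/funext => y; rewrite big_nil].
rewrite (_ : (fun y => _) = fun y => F i y + \sum_(i <- r) F i y); first exact: contD.
by apply/funext => y; rewrite big_cons.
Qed.

(** Truncated power. For [m = 0] it is the constant 1 and not a step function, which is why
    [box_density 0] is defined apart from [spline]. *)
Definition tpow (m : nat) (x : R) : R := Num.max 0 x ^+ m.

Lemma is_derive_tpow m (x : R) : is_derive x 1 (tpow m.+2) (m.+2%:R * tpow m.+1 x).
Proof.
have [x0|x0|->] := ltgtP x 0.
- have -> : m.+2%:R * tpow m.+1 x = 0.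
    by rewrite /tpow max_l ?ltW// expr0n mulr0.
  apply: (@near_eq_is_derive R R R (cst 0) (tpow m.+2) x 1).
  near=> y; rewrite /tpow max_l ?expr0n//; apply: ltW; near: y; exact: lt_nbhsl.
- have -> : m.+2%:R * tpow m.+1 x = m.+2%:R * x ^+ m.+1.
    by rewrite /tpow max_r ?ltW.
  apply: (@near_eq_is_derive R R R (fun y : R => y ^+ m.+2) (tpow m.+2) x 1).
    near=> y; rewrite /tpow max_r//; apply: ltW; near: y; exact: lt_nbhsr.
  by apply: is_derive_eq (derX m.+2 (der_id x)) _; rewrite mulr1.
have -> : m.+2%:R * tpow m.+1 0 = 0.
  by rewrite /tpow max_l // expr0n mulr0.
(* At the break point the difference quotient is at most |h| in modulus when |h| <= 1, because the
   exponent is at least 2. *)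
have h : (fun h : R => h^-1 *: (tpow m.+2 (h *: 1 + 0) - tpow m.+2 0)) @ 0^' --> (0 : R).
  apply/cvgrPdist_le => e e0; near=> h.
  rewrite sub0r normrN /tpow maxxx expr0n subr0 addr0 scaler1 /GRing.scale /=.
  have h1 : `|h| <= 1 by near: h; apply: dnbhs0_le.
  have h2 : `|h| <= e by near: h; apply: dnbhs0_le.
  have h0 : h != 0 by near: h; exact: nbhs_dnbhs_neq.
  rewrite normrM normfV ler_pdivrMl ?normr_gt0// normrX.
  have m0 : `|Num.max 0 h| <= `|h| by case: (leP 0 h) => // _; rewrite normr0.
  apply: (le_trans (lerXn2r _ _ _ m0)); rewrite ?nnegrE//.
  rewrite exprS ler_wpM2l// exprS; apply: (le_trans _ h2).
  by rewrite ler_piMr// exprn_ile1.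
split; first by apply/cvg_ex; exists 0.
by apply/cvg_lim.
Unshelve. all: end_near. Qed.

End calculus.

Ltac der := lazymatch goal with
  | |- is_derive _ _ (fun _ => ?c) _ => notypeclasses refine (der_cst c _)
  | |- is_derive _ _ (fun y => @?F y + @?G y) _ => notypeclasses refine (@derD _ F G _ _ _ _ _); der
  | |- is_derive _ _ (fun y => - @?F y) _ => notypeclasses refine (@derN _ F _ _ _); der
  | |- is_derive _ _ (fun y => @?F y * @?G y) _ => notypeclasses refine (@derM _ F G _ _ _ _ _); der
  | |- is_derive _ _ (fun y => @?F y ^+ ?n) _ => notypeclasses refine (@derX _ F n _ _ _); der
  | |- is_derive _ _ (fun y => expR (@?F y)) _ => notypeclasses refine (@der_expR _ F _ _ _); der
  | |- is_derive _ _ (fun y => tpow ?n.+2 (@?F y)) _ => notypeclasses refine (@der_comp _ _ F _ _ _ (is_derive_tpow _ _) _); der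
  | |- is_derive _ _ (fun y => sin (@?F y)) _ => notypeclasses refine (@der_sin _ F _ _ _); der
  | |- is_derive _ _ (fun y => cos (@?F y)) _ => notypeclasses refine (@der_cos _ F _ _ _); der
  | |- is_derive _ _ (fun y => \sum_(i <- _) _) _ => notypeclasses refine (@der_sum _ _ _ _ _ _ _); intro; der
  | |- is_derive _ _ (fun y => y) _ => notypeclasses refine (der_id _)
  | |- _ => idtac
  end.
Ltac derive_tac := notypeclasses refine (@derive_eq _ _ _ _ _ _ _); [der | cbv beta].

Ltac cont := lazymatch goal with
  | |- continuous (fun _ => ?c) => exact: cont_cst
  | |- continuous (fun y => @?F y + @?G y) => refine (@contD _ F G _ _); cont
  | |- continuous (fun y => - @?F y) => refine (@contN _ F _); cont
  | |- continuous (fun y => @?F y * @?G y) => refine (@contM _ F G _ _); cont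
  | |- continuous (fun y => @?F y ^+ ?n) => refine (@contX _ F n _); cont
  | |- continuous (fun y => expR (@?F y)) => refine (@cont_expR _ F _); cont
  | |- continuous (fun y => sin (@?F y)) => refine (@cont_sin _ F _); cont
  | |- continuous (fun y => cos (@?F y)) => refine (@cont_cos _ F _); cont
  | |- continuous (fun y => y) => exact: cont_id
  | |- _ => idtac
  end.

(** * The density of a sum of uniform variables *)

Section box_density.
Context (R : realType).
Local Notation mR := (measurableTypeR R).
Local Notation lambda := (@lebesgue_measure R).

(* Its value is the density at [x] of a
   sum of [k.+1] independent uniform variables on [-1/2, 1/2] when [0 < k]. *)
Definition spline (k : nat) (x : R) : R :=
  (\sum_(i < k.+2) (-1 : R) ^+ i * 'C(k.+1, i)%:R * tpow k ((k.+1%:R : R) / 2 - x - i%:R)) / k`!%:R.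

Definition box_density (k : nat) : R -> R :=
  if k is 0 then fun x => (`|x| <= 1 / 2 :> R)%:R else spline k.

Definition spline_primitive (k : nat) (x : R) : R :=
  - (\sum_(i < k.+2) (-1 : R) ^+ i * 'C(k.+1, i)%:R * tpow k.+1 ((k.+1%:R : R) / 2 - x - i%:R)) / (k.+1)`!%:R.

Lemma is_derive_spline_primitive k (x : R) : (0 < k)%N ->
  is_derive x 1 (spline_primitive k) (spline k x).
Proof.
case: k => // k _; rewrite /spline_primitive /spline.
derive_tac.
rewrite mulr0 addr0 factS natrM invfM mulrA; congr (_ / _).
rewrite -sumrN mulr_suml; apply: eq_bigr => i _.
rewrite mul0r add0r addr0 sub0r mulrN1 mulrN opprK -mulrA [k.+2%:R * _]mulrC -!mulrA divff ?mulr1// pnatr_eq0.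
Qed.

(** Pascal's rule on the coefficients. The left-hand side is the integral of [spline k] over the
    unit interval centred at [z], that is, its convolution with one more uniform density. *)
Lemma spline_rec k (z : R) :
  spline_primitive k (z + 1 / 2) - spline_primitive k (z - 1 / 2) = spline k.+1 z.
Proof.
rewrite /spline_primitive /spline -mulrBl opprK addrC; congr (_ / _).
have E1 : \sum_(i < k.+2) (-1 : R) ^+ i * 'C(k.+1, i)%:R * tpow k.+1 ((k.+1%:R : R) / 2 - (z - 1 / 2) - i%:R) =
    \sum_(i < k.+3) (-1 : R) ^+ i * 'C(k.+1, i)%:R * tpow k.+1 ((k.+2%:R : R) / 2 - z - i%:R).
  rewrite [RHS]big_ord_recr /= bin_small// mulr0 mul0r addr0.
  apply: eq_bigr => i _; congr (_ * tpow _ _).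
  by rewrite -[in RHS]natr1; ring.
have E2 : \sum_(i < k.+2) (-1 : R) ^+ i * 'C(k.+1, i)%:R * tpow k.+1 ((k.+1%:R : R) / 2 - (z + 1 / 2) - i%:R) =
    - \sum_(i < k.+3) (-1 : R) ^+ i * (if val i is j.+1 then 'C(k.+1, j) else 0)%:R * tpow k.+1 ((k.+2%:R : R) / 2 - z - i%:R).
  rewrite [in RHS]big_ord_recl /= mulr0 mul0r add0r -sumrN.
  apply: eq_bigr => i _; rewrite exprS !mulN1r !mulNr opprK; congr (_ * tpow _ _).
  by rewrite /bump /= -[in RHS]natr1 add1n -[i.+1%:R]natr1; field.
rewrite E1 E2 opprK -big_split /=; apply: eq_bigr => i _.
rewrite -mulrDl -mulrDr -natrD; congr (_ * _%:R * _).
by case: (val i) => [|j]; rewrite ?bin0 ?addn0 // binS.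
Qed.

Lemma is_derive_splineS k (x : R) : (0 < k)%N ->
  is_derive x 1 (spline k.+1) (spline k (x + 1 / 2) - spline k (x - 1 / 2)).
Proof.
move=> k0; have E : spline k.+1 = fun z => spline_primitive k (z + 1 / 2) - spline_primitive k (z - 1 / 2).
  by apply/funext => z; rewrite spline_rec.
rewrite E; have dS := is_derive_spline_primitive _ k0.
notypeclasses refine (@derive_eq _ _ _ _ _ (derB (der_comp (dS _) _) (der_comp (dS _) _)) _); [der|der|].
by ring.
Qed.

Lemma continuous_tpow k : (0 < k)%N -> continuous (@tpow R k).
Proof.
move=> k0; apply: contX => x.
by apply: continuous_max; [exact: cvg_cst|exact: cvg_id].
Qed.

Lemma continuous_spline k : (0 < k)%N -> continuous (spline k).
Proof.
move=> k0; apply: contM; last exact: cont_cst.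
apply: cont_sum => i; apply: contM; first exact: cont_cst.
by apply: cont_comp; [exact: continuous_tpow|cont].
Qed.

Lemma integral_spline k (z : R) : (0 < k)%N ->
  (\int[lambda]_(x in `[0%R, 1%R]) (spline k (z - (x - 1 / 2)))%:E = (spline k.+1 z)%:E)%E.
Proof.
move=> k0; have dS := is_derive_spline_primitive _ k0.
pose F x := - spline_primitive k (z - (x - 1 / 2)).
have dF (x : R) : is_derive x 1 F (spline k (z - (x - 1 / 2))).
  notypeclasses refine (@derive_eq _ _ _ _ _ (derN (der_comp (dS _) _)) _); [der|].
  by ring.
rewrite (integral_is_derive dF) //.
  by congr EFin; rewrite /F -spline_rec opprK [LHS]addrC; congr (spline_primitive _ _ - spline_primitive _ _); field.
by apply: (@cont_comp _ (spline k)); [exact: continuous_spline|cont].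
Qed.

Lemma spline1E (x : R) : spline 1 x = Num.max 0 (1 - `|x|).
Proof.
rewrite /spline /tpow !big_ord_recl big_ord0 /= /bump /=.
rewrite !bin0 !bin1 binn divr1.
have -> : (2 / 2 : R) = 1 by field.
case: (leP 0 x) => x0; rewrite ?(ger0_norm x0) ?(ltr0_norm x0);
repeat match goal with |- context [Num.max ?a ?b] => case: (leP a b) => ? end; try lra.
Qed.

Lemma integral_box0 (z : R) :
  (\int[lambda]_(x in `[0%R, 1%R]) (box_density 0 (z - (x - 1 / 2)))%:E = (spline 1 z)%:E)%E.
Proof.
rewrite spline1E /=.
pose I := `[Num.max 0 z, Num.min 1 (z + 1)]%classic : set R.
transitivity (\int[lambda]_(x in `[0%R, 1%R]) ((\1_I x)%:E))%E.
  apply: eq_integral => x; rewrite inE /= in_itv /= => /andP[x0 x1].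
  rewrite indicE /I; congr (_%:R)%:E; congr nat_of_bool.
  apply/idP/idP.
    rewrite mem_setE in_itv /= ler_norml => /andP[? ?]; rewrite ge_max le_min x0 x1 /=; apply/andP; split; lra.
  rewrite mem_setE in_itv /= ge_max le_min => /andP[/andP[_ ?] /andP[_ ?]].
  rewrite ler_norml; apply/andP; split; lra.
rewrite integral_indic//; last exact: measurable_itv.
rewrite setIidl; last first.
  by move=> x; rewrite /I /= !in_itv /= ge_max le_min => /andP[/andP[-> _] /andP[-> _]].
rewrite /I /= lebesgue_measure_itv /= lte_fin.
case: (leP 0 z) => z0; rewrite ?(ger0_norm z0) ?(ltr0_norm z0);
  repeat match goal with |- context [Num.min ?a ?b] => case: (leP a b) => ? end;
  repeat match goal with |- context [Num.max ?a ?b] => case: (leP a b) => ? end;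
  case: ltP => ?; rewrite -?EFinB; congr EFin; lra.
Qed.

Lemma integral_box_density k (z : R) :
  (\int[lambda]_(x in `[0%R, 1%R]) (box_density k (z - (x - 1 / 2)))%:E = (box_density k.+1 z)%:E)%E.
Proof. by case: k => [|k]; [exact: integral_box0|exact: integral_spline]. Qed.

Lemma box_density_ge0 k (x : R) : 0 <= box_density k x.
Proof.
elim: k x => [|k IH] x; first by rewrite /= ler0n.
by rewrite -lee_fin -integral_box_density integral_ge0// => y _; rewrite lee_fin.
Qed.

Lemma measurable_box_density k : measurable_fun setT (box_density k : mR -> mR).
Proof.
case: k => [|k]; last by apply: continuous_measurable_fun; exact: continuous_spline.
rewrite (_ : box_density 0 = \1_(`[- (1 / 2), 1 / 2]%classic : set R)).
  exact: measurable_indic.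
apply/funext => x; rewrite /= indicE; congr (nat_of_bool _)%:R.
by apply/idP/idP; rewrite mem_setE in_itv /= ler_norml.
Qed.

(** A uniform variable on [0, 1] is symmetric about 1/2; this absorbs the sign of a negative
    coefficient. *)
Lemma integral_onem (h : R -> \bar R) : measurable_fun setT h -> (forall x, 0 <= h x)%E ->
  (\int[lambda]_(x in `[0%R, 1%R]) h (1 - x)%R = \int[lambda]_(x in `[0%R, 1%R]) h x)%E.
Proof.
move=> mh h0; rewrite integral_mkcond [RHS]integral_mkcond.
have := @ge0_integral_affine R (-1) 1 (h \_ `[0%R, 1%R]).
rewrite oppr_eq0 oner_eq0 normrN normr1 invr1 mul1e => <- //.
- apply: eq_integral => x _; rewrite mulN1r addrC !patchE !mem_setE !in_itv /=.
  by rewrite subr_ge0 lerBlDr lerDl andbC.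
- by apply/(measurable_restrictT _ _).1 => //; exact: measurable_funTS.
- by move=> x; rewrite patchE; case: ifP.
Qed.

Lemma measurable_box_density_comp k (a c : R) :
  measurable_fun setT (fun x : mR => (box_density k (a * x + c))%:E).
Proof.
apply/measurable_EFinP; apply: (measurableT_comp (measurable_box_density k)).
exact: measurable_affine.
Qed.

Lemma box_densityN k (x : R) : box_density k (- x) = box_density k x.
Proof.
elim: k x => [|k IH] x; first by rewrite /= normrN.
apply: EFin_inj; rewrite -!integral_box_density.
rewrite -integral_onem.
- by apply: eq_integral => y _; congr EFin; rewrite -IH; congr box_density; field.
- have := measurable_box_density_comp k (-1) (- x + 1 / 2).
  by congr (measurable_fun _ _); apply/funext => y; congr (box_density k _)%:E; ring.
- by move=> y; rewrite lee_fin box_density_ge0.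
Qed.

(** Induction on the degree: the derivative at z > 0 is the difference of the values of the previous
    spline at z + 1/2 and z - 1/2. By evenness the second point may be replaced by |z - 1/2|, which
    is at most z + 1/2. *)
Lemma spline_nonincreasing k (x y : R) : (0 < k)%N -> 0 <= x -> x <= y -> spline k y <= spline k x.
Proof.
case: k => // k _; elim: k x y => [|k IH] x y x0 xy.
  rewrite !spline1E !ger0_norm ?(le_trans x0)//.
  case: (leP 0 (1 - x)); case: (leP 0 (1 - y)); lra.
apply: (nonincreasing_is_derive (fun z => is_derive_splineS z (ltn0Sn k)) _ x0 xy) => z z0.
have -> : spline k.+1 (z - 1 / 2) = spline k.+1 `|z - 1 / 2|.
  have [?|?] := leP 0 (z - 1 / 2); first by rewrite ger0_norm.
  by rewrite ltr0_norm//; exact/esym/(box_densityN k.+1).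
rewrite subr_le0; apply: IH; first exact: normr_ge0.
by rewrite ler_norml; apply/andP; split; lra.
Qed.

End box_density.

Section slab_volume.
Context (R : realType).
Local Notation mR := (measurableTypeR R).
Local Notation lambda := (@lebesgue_measure R).

(** Coordinates are integrated out one by one: after division by [al], a coefficient of modulus [al]
    convolves with a unit box, and a zero coefficient contributes the factor 1. The window of width
    [al] is itself the first box, so m nonzero coefficients give the density of m + 1 uniform
    variables, which is [box_density m]. *)
Theorem slab_volume n (c : 'I_n -> R) (al z : R) : 0 < al ->
  (forall i, c i = 0 \/ `|c i| = al) ->
  lebesgue_tuple R n (cube_slab c [set s | `|z - (s - \sum_i c i / 2)| <= al / 2]) =
  (box_density (\sum_i (c i != 0%R))%N (z / al))%:E.
Proof.
move=> al0; elim: n c z => [|n IH] c z hc.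
  rewrite !big_ord0 /= diracE; congr (_%:R)%:E; congr nat_of_bool.
  have E : (`|z - (0 - 0)| <= al / 2) = (`|z / al| <= 1 / 2).
    by rewrite !subr0 normrM normfV (gtr0_norm al0) ler_pdivrMr// mulrC mul1r.
  apply/idP/idP => [|h]; rewrite inE /cube_slab /= big_ord0.
    by rewrite E => -[].
  by rewrite E; split => // -[].
rewrite lebesgue_tuple_slice.
pose c' i := c (lift ord0 i).
have hc' i : c' i = 0 \/ `|c' i| = al by exact: hc.
transitivity (\int[lambda]_(x in `[0%R, 1%R]) (box_density (\sum_i (c' i != 0%R))%N ((z - c ord0 * (x - 1 / 2)) / al)%R)%:E)%E.
  rewrite [RHS]integral_mkcond; apply: eq_integral => x _.
  rewrite patchE mem_setE in_itv /=; case: ifP => x01; last first.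
    rewrite (_ : [set _ | _] = set0) ?measure0//.
    by apply/seteqP; split => u //= -[/(_ ord0)]; rewrite (tnth_nth 0) /= x01.
  have E (u : n.-tuple mR) : z - (\sum_i c i * tnth (tuple_cons (x, u)) i - \sum_i c i / 2) =
      z - c ord0 * (x - 1 / 2) - (\sum_i c' i * tnth u i - \sum_i c' i / 2).
    rewrite !big_ord_recl (tnth_nth 0) /=.
    rewrite (_ : \sum_i _ = \sum_i c' i * tnth u i); first by rewrite /c'; field.
    by apply: eq_bigr => i _; rewrite !(tnth_nth 0).
  rewrite -IH//; congr (lebesgue_tuple _ _ _); apply/seteqP; split => u /= [cu].
    rewrite /= E => h; split=> // i.
    by have := cu (lift ord0 i); rewrite !(tnth_nth 0).
  rewrite /= => h; split; last by rewrite /= E.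
  move=> i; have [j ->|->] := unliftP ord0 i; last by rewrite (tnth_nth 0).
  by have := cu j; rewrite !(tnth_nth 0).
rewrite big_ord_recl; set k := (\sum_i (c' i != 0%R))%N.
have [c0|c0] := hc ord0.
  rewrite c0 eqxx add0n (eq_integral (fun=> (box_density k (z / al))%:E)); last first.
    by move=> x _; rewrite mul0r subr0.
  by rewrite integral_cst//= lebesgue_measure_itv /= lte_fin ltr01 -EFinB subr0 mule1.
have c00 : c ord0 != 0 by rewrite -normr_eq0 c0 gt_eqF.
rewrite c00 add1n -integral_box_density.
have [cp|cn] := leP 0 (c ord0).
  apply: eq_integral => x _; congr (box_density k _)%:E.
  by rewrite -c0 ger0_norm//; field.
rewrite -integral_onem.
- apply: eq_integral => x _; congr (box_density k _)%:E.
  have -> : al = - c ord0 by rewrite -c0 ltr0_norm.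
  by field; rewrite ?oppr_eq0 ?c00.
- have := measurable_box_density_comp k (- (c ord0 / al)) ((z + c ord0 / 2) / al).
  by congr (measurable_fun _ _); apply/funext => y; congr (box_density k _)%:E; ring.
- by move=> y; rewrite lee_fin box_density_ge0.
Qed.
End slab_volume.

(** * Sections orthogonal to a diagonal, and the competing section *)

Section diagonal_sections.
Context (R : realType).
Local Notation mR := (measurableTypeR R).

Lemma dotp_ge0 d (x : 'rV[R]_d) : 0 <= dotp x x.
Proof. by apply: sumr_ge0 => i _; rewrite -expr2 sqr_ge0. Qed.

Lemma dist_to_hyperplane d (a p : 'rV[R]_d) b : dotp a a = 1 ->
  dist_to p [set x | dotp a x = b] = `|dotp a p - b|.
Proof.
move=> a1; apply/eqP; rewrite eq_le; apply/andP; split.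
  apply: ge_inf; first by exists 0 => _ [y _ <-]; exact: sqrtr_ge0.
  exists (p + (b - dotp a p) *: a).
    by rewrite /= dotpDr dotpZr a1; ring.
  by rewrite addrAC subrr add0r /enorm dotpZl dotpZr a1 mulr1 -expr2 sqrtr_sqr distrC.
apply: lb_le_inf.
  exists (enorm (p + (b - dotp a p) *: a - p)), (p + (b - dotp a p) *: a) => //=.
  by rewrite dotpDr dotpZr a1; ring.
move=> _ [y /= <- <-]; rewrite distrC -dotpBr -sqrtr_sqr ler_wsqrtr//.
rewrite -subr_ge0; move: (y - p) => v.
(* Cauchy-Schwarz for a unit vector: the part of [v] orthogonal to [a] has nonnegative square. *)
have := dotp_ge0 (v - dotp a v *: a).
by rewrite !(dotpBl,dotpBr,dotpZl,dotpZr) a1 (dotpC v a); congr (0 <= _); ring.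
Qed.

(** The forgotten coordinate has a coefficient of modulus [al], so the condition on it is exactly
    the window of [slab_volume]. It is no longer among the integrated coordinates, whence the
    predecessor in the index. *)
Lemma section_volume_box n (a : 'rV[R]_n.+1) b al : dotp a a = 1 -> 0 < al ->
  (forall i, a 0 i = 0 \/ `|a 0 i| = al) ->
  section_volume [set x | dotp a x = b] =
  (al^-1 * box_density (\sum_i (a 0%R i != 0%R)).-1 ((b - dotp a (cube_center R n.+1)) / al))%:E.
Proof.
move=> a1 al0 ha.
have [j aj] : exists j, a 0 j != 0.
  apply/existsP; apply: contraPT a1 => /existsPn h.
  rewrite /dotp big1 => [/eqP|i _]; first by rewrite eq_sym oner_eq0.
  by have := h i; rewrite negbK => /eqP ->; rewrite mul0r.
have ajal : `|a 0 j| = al by have [aj0|//] := ha j; rewrite aj0 eqxx in aj.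
rewrite (section_volume_graph b a1 aj) ajal.
pose z := b - a 0 j / 2 - \sum_i a 0 (lift j i) / 2.
rewrite (_ : [set s | _] = [set s | `|z - (s - \sum_i a 0 (lift j i) / 2)| <= al / 2]); last first.
  apply/funext => s /=; apply/propext.
  rewrite (_ : z - _ = ((b - s) / a 0 j - 1 / 2) * a 0 j); last by rewrite /z; field.
  rewrite normrM ajal (_ : al / 2 = 1 / 2 * al); last by field.
  rewrite ler_pM2r// ler_norml; split => /andP[? ?]; apply/andP; split; lra.
rewrite (slab_volume _ al0); last by move=> i; exact: ha.
rewrite -EFinM (bigD1_ord j)//= aj add1n /=; congr (_ * box_density _ (_ / _))%:E.
by rewrite /z /dotp (bigD1_ord j)//= mxE -addrA -opprD; congr (_ - (_ + _)); apply: eq_bigr => i _; rewrite mxE.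
Qed.

Definition corner_volume (t : R) : R := (Num.sqrt (2 - 4 * t ^+ 2) - 2 * t) / (1 - 4 * t ^+ 2).

(** With s^2 = 2 - 4 t^2, the denominator 1 - 4 t^2 is half of (s - 2t)(s + 2t). All later estimates
    use this form, where the numerator is constant. *)
Lemma corner_volumeE (t : R) : 0 <= t -> t < 1 / 2 ->
  corner_volume t = 2 / (2 * t + Num.sqrt (2 - 4 * t ^+ 2)).
Proof.
move=> t0 t1; rewrite /corner_volume; set s := Num.sqrt _.
have s0 : 0 < s by rewrite sqrtr_gt0; nra.
have s2 : s ^+ 2 = 2 - 4 * t ^+ 2 by rewrite sqr_sqrtr//; nra.
apply/eqP; rewrite eqr_div; [|nra|nra].
apply/eqP; have -> : 1 - 4 * t ^+ 2 = (s ^+ 2 - 4 * t ^+ 2) / 2 by rewrite s2; field.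
by field.
Qed.

(* The line of normal [(c, s)] at distance [t] from the centre passes through a
   vertex of the square exactly when [c - s = 2 t]. *)
Lemma corner_section d (t : R) : 0 < t -> t < 1 / 2 ->
  exists H : set 'rV[R]_d.+2, [/\ hyperplane H, dist_to (cube_center R d.+2) H = t &
    section_volume H = (corner_volume t)%:E].
Proof.
move=> t0 t1; pose r := Num.sqrt (2 - 4 * t ^+ 2).
have r0 : 0 < r by rewrite sqrtr_gt0; nra.
have r2 : r ^+ 2 = 2 - 4 * t ^+ 2 by rewrite sqr_sqrtr//; nra.
pose c := (r + 2 * t) / 2; pose s := (r - 2 * t) / 2.
have c0 : 0 < c by rewrite /c; nra.
have s0 : 0 < s by rewrite /s; nra.
pose a : 'rV[R]_d.+2 := \row_i (if i == 0 then c else if i == lift 0 0 then s else 0).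
have dota x : dotp a x = c * x 0 0 + s * x 0 (lift 0 0).
  rewrite /dotp !big_ord_recl big1 => [|i _]; first by rewrite !mxE /= addr0.
  by rewrite !mxE /= mul0r.
have a1 : dotp a a = 1.
  rewrite dota !mxE /= /c /s; transitivity ((r ^+ 2 + 4 * t ^+ 2) / 2); first by field.
  by rewrite r2; field.
pose b := t + dotp a (cube_center R d.+2).
exists [set x | dotp a x = b]; split.
- exists a, b; split=> //; apply/eqP => a0; move: a1; rewrite a0 /dotp big1 => [/eqP|i _].
    by rewrite eq_sym oner_eq0.
  by rewrite mxE mul0r.
- by rewrite dist_to_hyperplane// /b opprD addrCA subrr addr0 normrN gtr0_norm.
rewrite (@section_volume_graph _ _ a b 0)//; last by rewrite mxE /= gt_eqF.
(* Since c = s + 2t, every value of the second coordinate in [0, 1] puts the first one in [0, 1].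
   The projection is a whole unit cube and the volume is 1 / c. *)
rewrite (_ : cube_slab _ _ = cube_slab (fun=> 0) setT); last first.
  apply/seteqP; split => u /= [cu h]; split=> //.
  move: (cu 0); rewrite big_ord_recl big1 => [|i _]; last by rewrite mxE /= mul0r.
  rewrite !mxE /= addr0 => /andP[u0 u1].
  rewrite /b dota !mxE ler_pdivlMr// ler_pdivrMr// mul0r mul1r.
  have ct : c = s + 2 * t by rewrite /c /s; field.
  by apply/andP; split; nra.
(* Zero coefficients make the window condition vacuous: this instance computes the volume of the
   unit cube. *)
have := @slab_volume R d.+1 (fun=> 0) 1 0 ltr01 (fun _ => or_introl erefl).
rewrite (_ : cube_slab _ _ = cube_slab (fun=> 0) setT); last first.
  apply/seteqP; split => u /= [cu h]; split=> //.
  have E1 : \sum_(i < d.+1) (0 : R) * tnth u i = 0 by apply: big1 => i _; rewrite mul0r.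
  have E2 : \sum_(i < d.+1) (0 : R) / 2 = 0 by apply: big1 => i _; rewrite mul0r.
  by rewrite E1 E2 /= !subr0 normr0 divr_ge0.
move=> ->; rewrite big1 => [|i _]; last by rewrite eqxx.
rewrite /= mul0r normr0 divr_ge0//= mule1 mxE /= gtr0_norm//.
rewrite corner_volumeE ?(ltW t0)//; congr EFin.
by rewrite /c invf_div addrC.
Qed.

Lemma orthogonal_to_face_diagonal_normal d (H : set 'rV[R]_d) : hyperplane H ->
  orthogonal_to_face_diagonal H -> exists (w : 'rV[R]_d) (b : R) (n : nat),
  [/\ H = [set x | dotp w x = b], (0 < n)%N, dotp w w = n%:R, (n = \sum_i (w 0%R i != 0%R))%N &
      forall i, w 0 i = 0 \/ `|w 0 i| = 1].
Proof.
move=> [a [b [a0 ->]]] [S [p [u [v [S0 pv [[uv [uc uf]] [vv [vc vf]] E] orth]]]]].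
pose w := v - u.
have wE i : w 0 i = if i \in S then 1 - 2 * u 0 i else 0.
  have := congr1 (fun x : 'rV[R]_d => x 0 i) E; rewrite !mxE.
  case: ifPn => [iS h|iS _]; last by rewrite uf// vf// subrr.
  have -> : v 0 i = 1 - u 0 i by rewrite -[LHS](subrK 2^-1) h; field.
  by ring.
have w1 i : i \in S -> `|w 0 i| = 1.
  move=> iS; rewrite wE iS; case: (uv i) => ->; first by rewrite mulr0 subr0 normr1.
  by rewrite mulr1 (_ : 1 - 2 = -1) ?normrN ?normr1//; ring.
have w0 i : i \notin S -> w 0 i = 0 by move=> iS; rewrite wE (negbTE iS).
have wi i : (w 0 i != 0) = (i \in S).
  apply/idP/idP => [|/w1 h]; first by apply: contraNT => /w0 ->.
  by rewrite -normr_eq0 h oner_eq0.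
have ww : dotp w w = #|S|%:R.
  rewrite -sum1_card natr_sum [RHS]big_mkcond /=; apply: eq_bigr => i _.
  case: ifPn => [/w1 h|/w0 ->]; last by rewrite mul0r.
  by rewrite -expr2 -real_normK ?num_real// h expr1n.
have aa0 : dotp a a != 0 by apply: contra_neq a0; exact: dotp_eq0.
pose k := dotp w a / dotp a a.
(* The part [w'] of [w] orthogonal to [a] is a direction of the hyperplane, hence orthogonal to the
   diagonal [w]. Being orthogonal to both [w] and [a], it is orthogonal to itself. *)
have wk : w = k *: a.
  apply/eqP; rewrite -subr_eq0; apply/eqP/dotp_eq0; set w' := w - _.
  have w'a : dotp a w' = 0 by rewrite /w' dotpBr dotpZr /k (dotpC w a); field.
  have p0 : dotp a ((b / dotp a a) *: a) = b by rewrite dotpZr; field.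
  have p1 : dotp a ((b / dotp a a) *: a + w') = b by rewrite dotpDr p0 w'a addr0.
  have := orth _ _ p1 p0; rewrite addrAC subrr add0r -/w => w'w.
  have : dotp w' (w - k *: a) = 0 by rewrite dotpBr dotpZr w'w (dotpC w') w'a mulr0 subr0.
  exact.
have k0 : k != 0.
  apply: contraTneq S0 => k0; rewrite -leqNgt leqn0 -(eqr_nat R) -ww wk k0 scale0r.
  by rewrite /dotp big1 // => i _; rewrite mxE mul0r.
exists w, (k * b), #|S|; split => //.
- apply/seteqP; split => x /=; rewrite wk dotpZl; first by move=> ->.
  exact: mulfI.
- by rewrite -sum1_card big_mkcond /=; apply: eq_bigr => i _; rewrite wi; case: (i \in S).
- by move=> i; case: (boolP (i \in S)) => [/w1|/w0]; [right|left].
Qed.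

Theorem diagonal_section_volume d (H : set 'rV[R]_d.+1) t : hyperplane H ->
  dist_to (cube_center R d.+1) H = t -> orthogonal_to_face_diagonal H ->
  exists k : nat, section_volume H =
    (Num.sqrt k.+1%:R * box_density k (Num.sqrt k.+1%:R * t))%:E.
Proof.
move=> hH hd /(orthogonal_to_face_diagonal_normal hH)[w [b [n [E n0 ww nE w1]]]].
exists n.-1; rewrite prednK//.
have sn0 : 0 < Num.sqrt (n%:R : R) by rewrite sqrtr_gt0 ltr0n.
have sn2 : Num.sqrt (n%:R : R) ^+ 2 = n%:R by rewrite sqr_sqrtr.
set q := Num.sqrt _ in sn0 sn2 *.
pose a := q^-1 *: w.
have a1 : dotp a a = 1.
  by rewrite dotpZl dotpZr ww -sn2; field; rewrite gt_eqF.
have Ea : H = [set x | dotp a x = b / q].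
  rewrite E; apply/seteqP; split => x /=; rewrite dotpZl mulrC; first by move=> ->.
  by move=> /(congr1 ( *%R^~ q)); rewrite !mulfVK ?gt_eqF.
have ha i : a 0 i = 0 \/ `|a 0 i| = q^-1.
  rewrite mxE normrM; have [->|->] := w1 i; [left|right]; first by rewrite mulr0.
  by rewrite mulr1 gtr0_norm// invr_gt0.
have iq : 0 < q^-1 by rewrite invr_gt0.
move: hd; rewrite Ea dist_to_hyperplane// => hd.
rewrite (section_volume_box _ a1 iq ha) invrK; congr (_ * _)%:E.
have -> : (\sum_i (a 0%R i != 0%R) = n)%N.
  by rewrite nE; apply: eq_bigr => i _; rewrite mxE mulf_eq0 invr_eq0 gt_eqF.
rewrite -hd; have [h|h] := leP 0 (dotp a (cube_center R d.+1) - b / q).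
  by rewrite -opprB mulNr box_densityN ger0_norm// mulrC.
by rewrite ltr0_norm// opprB mulrC.
Qed.

End diagonal_sections.

(** * Fourier inversion for the density *)

Section line_integrals.
Context (R : realType).
Local Notation mR := (measurableTypeR R).
Local Notation lambda := (@lebesgue_measure R).

Lemma ge0_integral_halfline (F f : R -> R) l : (forall x : R, is_derive x 1 F (f x)) ->
  continuous f -> (forall x, 0 <= x -> 0 <= f x) -> F x @[x --> +oo] --> l ->
  (\int[lambda]_(x in `[0%R, +oo[) (f x)%:E = (l - F 0%R)%:E)%E.
Proof.
move=> dF cf f0 Fl.
have cF := is_derive_continuous dF.
rewrite (ge0_continuous_FTC2y _ (continuous_subspaceT cf) Fl) //.
- by apply: cvg_at_right_filter; exact: cF.
- by move=> x _; rewrite derive1E; exact: (@derive_val _ _ _ _ _ _ _ (dF x)).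
Qed.

Lemma integral_line_even (f : R -> R) : continuous f -> (forall x, 0 <= f x) -> (forall x, f (- x) = f x) ->
  (\int[lambda]_x (f x)%:E = 2%:E * \int[lambda]_(x in `[0%R, +oo[) (f x)%:E)%E.
Proof.
move=> cf f0 ev; rewrite (ge0_symfun_integralT f0 cf); last by move=> x /=; rewrite ev.
by rewrite set_itvcy.
Qed.

Lemma cont_inv1sqr : continuous (fun x : R => (1 + x ^+ 2)^-1).
Proof. by move=> x; have := @continuous_oneDsqrV R x. Qed.

Lemma integral_inv1sqr : (\int[lambda]_x ((1 + x ^+ 2)^-1)%:E = pi%:E)%E.
Proof.
rewrite integral_line_even.
- by have := @integral0y_oneDsqr R; rewrite /oneDsqr => ->; rewrite -EFinM; congr EFin; field.
- exact: cont_inv1sqr.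
- by move=> x; rewrite invr_ge0 addr_ge0// sqr_ge0.
- by move=> x; rewrite sqrrN.
Qed.

Definition intble (f : R -> R) := lambda.-integrable setT (EFin \o f).

Lemma inv1sqr_gt0 (x : R) : 0 < (1 + x ^+ 2)^-1.
Proof. by rewrite invr_gt0 ltr_pwDl// sqr_ge0. Qed.

Lemma intble_inv1sqr : intble (fun x => (1 + x ^+ 2)^-1).
Proof.
apply/integrableP; split.
  by apply/measurable_EFinP; apply: continuous_measurable_fun; exact: cont_inv1sqr.
under eq_integral do rewrite /= ger0_norm ?(ltW (inv1sqr_gt0 _))//.
by rewrite integral_inv1sqr ltry.
Qed.

Lemma intble_dominated (f : R -> R) C : measurable_fun setT (f : mR -> mR) ->
  (forall u, `|f u| <= C / (1 + u ^+ 2)) -> intble f.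
Proof.
move=> mf fC; have := integrableZl measurableT C intble_inv1sqr.
apply: le_integrable => //; first exact/measurable_EFinP.
move=> x _ /=; rewrite lee_fin; apply: (le_trans (fC x)).
by rewrite ler_norm.
Qed.

Lemma Rintegral_inv1sqr : \int[lambda]_x (1 + x ^+ 2)^-1 = pi.
Proof. by rewrite /Rintegral integral_inv1sqr. Qed.

End line_integrals.

Section dirichlet_integral.
Context (R : realType).
Local Notation mR := (measurableTypeR R).
Local Notation lambda := (@lebesgue_measure R).

Lemma cvg_pinfty0_bound (f : R -> R) C : (forall x, 0 < x -> `|f x| <= C / x) ->
  f x @[x --> +oo] --> (0 : R).
Proof.
move=> fC; apply/cvgrPdist_le => e e0; near=> x.
have x0 : 0 < x by near: x; exact: nbhs_pinfty_gt.
have xC : C / e <= x by near: x; apply: nbhs_pinfty_ge; exact: num_real.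
rewrite sub0r normrN; apply: (le_trans (fC x x0)).
by rewrite ler_pdivrMr// mulrC -ler_pdivrMr.
Unshelve. all: end_near. Qed.

Lemma expRN_le_inv n (y : R) : 0 < y -> expR (- y) <= n.+1`!%:R / y ^+ n.+1.
Proof.
move=> y0; have h := @expR_ge1Dxn R y n (ltW y0).
have y1 : 0 < y ^+ n.+1 / n.+1`!%:R by rewrite divr_gt0 ?exprn_gt0// ltr0n fact_gt0.
rewrite expRN -invf_div lef_pV2 ?posrE ?expR_gt0//; apply: le_trans h.
by rewrite lerDr.
Qed.

Lemma integral_halfline_sexp (u : R) : 0 < u ->
  (\int[lambda]_(s in `[0%R, +oo[) (s * expR (- (u * s)))%:E = (u^-1 ^+ 2)%:E)%E.
Proof.
move=> u0; have un0 : u != 0 by rewrite gt_eqF.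
pose F (s : R) := - ((s / u + u^-1 ^+ 2) * expR (- (u * s))).
have dF (s : R) : is_derive s 1 F (s * expR (- (u * s))).
  by rewrite /F; derive_tac; field.
rewrite (ge0_integral_halfline dF (l := 0)).
- by congr EFin; rewrite /F mulr0 oppr0 expR0; ring.
- by cont.
- by move=> s s0; rewrite mulr_ge0 ?expR_ge0.
apply: (@cvg_pinfty0_bound _ (3 / u ^+ 3)) => s s0.
have us : 0 < u * s by rewrite mulr_gt0.
rewrite /F normrN ger0_norm; last by rewrite mulr_ge0 ?expR_ge0// addr_ge0 ?sqr_ge0// divr_ge0 ?ltW.
rewrite mulrDl; have h1 := expRN_le_inv 1 us; have h0 := expRN_le_inv 0 us.
have a1 : s / u * expR (- (u * s)) <= s / u * (2 / (u * s) ^+ 2).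
  by rewrite ler_wpM2l// divr_ge0 ?ltW.
have a2 : u^-1 ^+ 2 * expR (- (u * s)) <= u^-1 ^+ 2 * (1 / (u * s) ^+ 1).
  by rewrite ler_wpM2l// sqr_ge0.
apply: (le_trans (lerD a1 a2)); rewrite le_eqVlt; apply/orP; left; apply/eqP.
by field; rewrite un0 gt_eqF.
Qed.

Lemma integral_halfline_expcos (s a : R) : 0 < s ->
  (\int[lambda]_(u in `[0%R, +oo[) (s * expR (- (u * s)) * (1 - cos (a * u)))%:E =
   (a ^+ 2 / (s ^+ 2 + a ^+ 2))%:E)%E.
Proof.
move=> s0; have sn0 : s != 0 by rewrite gt_eqF.
have sa : 0 < s ^+ 2 + a ^+ 2 by rewrite ltr_pwDl ?exprn_gt0// sqr_ge0.
pose F (u : R) := - (expR (- (u * s)) * (1 + s / (s ^+ 2 + a ^+ 2) * (a * sin (a * u) - s * cos (a * u)))).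
have dF (u : R) : is_derive u 1 F (s * expR (- (u * s)) * (1 - cos (a * u))).
  by rewrite /F; derive_tac; field; rewrite gt_eqF.
rewrite (ge0_integral_halfline dF (l := 0)).
- congr EFin; rewrite /F mul0r oppr0 expR0 mulr0 sin0 cos0; field; by rewrite gt_eqF.
- by cont.
- by move=> u u0; rewrite !mulr_ge0 ?expR_ge0 ?subr_ge0 ?cos_le1 ?ltW.
pose C := 1 + `|s / (s ^+ 2 + a ^+ 2)| * (`|a| + `|s|).
have C0 : 0 <= C by rewrite addr_ge0// mulr_ge0// addr_ge0.
apply: (@cvg_pinfty0_bound _ (C / s)) => u u0.
have us : 0 < u * s by rewrite mulr_gt0.
rewrite /F normrN normrM ger0_norm ?expR_ge0//.
have h0 : expR (- (u * s)) <= 1 / (u * s) by have := expRN_le_inv 0 us; rewrite expr1.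
rewrite (_ : C / s / u = 1 / (u * s) * C); last by field; rewrite sn0 gt_eqF.
apply: ler_pM; rewrite ?expR_ge0//.
rewrite /C; apply: (le_trans (ler_normD _ _)); rewrite normr1 lerD2l normrM ler_wpM2l//.
apply: (le_trans (ler_normB _ _)); rewrite !normrM.
by apply: lerD; rewrite ler_piMr// ?sin_max ?cos_max.
Qed.

Lemma measurable_invr : measurable_fun setT (fun u : mR => u^-1 : mR).
Proof.
rewrite -(setUv [set 0 : mR]); apply/measurable_funU => //; first exact: measurableC.
split; first exact: measurable_fun_set1.
apply: open_continuous_measurable_fun.
  by rewrite openC; exact: closed_eq.
by move=> x; rewrite inE /= => /eqP x0; exact: inv_continuous.
Qed.

(** Continuous extension of (1 - cos (a u)) / u^2. As the inverse of 0 is 0, the first term vanishes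
    at u = 0 and the second one restores the limit a^2 / 2. *)
Definition dirichlet (a u : R) : R :=
  (1 - cos (a * u)) * u^-1 ^+ 2 + (u == 0)%:R * (a ^+ 2 / 2).

Lemma dirichlet_ge0 a u : 0 <= dirichlet a u.
Proof.
apply: addr_ge0; apply: mulr_ge0; rewrite ?ler0n ?sqr_ge0 ?subr_ge0 ?cos_le1//.
by rewrite divr_ge0 ?sqr_ge0.
Qed.

Lemma measurable_eq0 : measurable_fun setT (fun u : mR => (u == 0)%:R : mR).
Proof.
rewrite (_ : (fun u => _) = \1_[set 0]); first exact: measurable_indic.
by apply/funext => u; rewrite indicE; congr (nat_of_bool _)%:R; apply/idP/idP; rewrite inE /= => /eqP.
Qed.

Lemma measurable_dirichlet a : measurable_fun setT (dirichlet a : mR -> mR).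
Proof.
apply: measurable_funD; apply: measurable_funM => //.
- by apply: continuous_measurable_fun; cont.
- by apply: measurable_funX; exact: measurable_invr.
- exact: measurable_eq0.
Qed.

Lemma ae_eq_neq0 (f g : R -> \bar R) : (forall u, u != 0 -> f u = g u) -> ae_eq lambda setT f g.
Proof.
move=> fg; exists [set 0]; split => //; first exact: lebesgue_measure_set1.
by move=> u /=; apply: contra_notP => /eqP u0 _; exact: fg.
Qed.

(** Write 1 / u^2 as the integral of s exp(- |u| s) over s > 0 and exchange the integrals: the inner
    one becomes 2 a^2 / (s^2 + a^2), whose primitive is an arctangent. Working with 1 - cos instead
    of sin (a u) / u keeps the integrand nonnegative, so that Tonelli applies. *)
Lemma integral_dirichlet (a : R) : (\int[lambda]_u (dirichlet a u)%:E = (pi * `|a|)%:E)%E.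
Proof.
have [->|a0] := eqVneq a 0.
  rewrite normr0 mulr0 integral0_eq// => u _.
  by rewrite /dirichlet mul0r cos0 subrr mul0r expr0n /= mul0r mulr0 addr0.
pose G (p : mR * mR) := Num.max 0 p.2 * expR (- (`|p.1| * p.2)) * (1 - cos (a * p.1)).
have mG : measurable_fun setT (fun p => (G p)%:E).
  apply/measurable_EFinP; rewrite /G; apply: measurable_funM; first apply: measurable_funM.
  - by apply: measurable_maxr.
  - apply: measurableT_comp => //; apply: measurable_funN; apply: measurable_funM => //.
    by apply: measurableT_comp.
  - apply: measurable_funB => //.
    apply: measurableT_comp; first by apply: continuous_measurable_fun; exact: continuous_cos.
    exact: measurable_funM.
have G0 p : (0 <= (G p)%:E)%E.
  by rewrite lee_fin /G; apply: mulr_ge0; [apply: mulr_ge0|]; rewrite ?expR_ge0 ?subr_ge0 ?cos_le1// le_max lexx.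
have := @fubini_tonelli _ _ _ _ _ lambda lambda _ mG G0.
rewrite (_ : \int[lambda]_x _ = \int[lambda]_x (dirichlet a x)%:E)%E; last first.
  apply: ge0_ae_eq_integral => //.
  - exact: (measurable_fun_fubini_tonelli_F (m2 := lambda) (fun p : mR * mR => (G p)%:E)).
  - by apply/measurable_EFinP; exact: measurable_dirichlet.
  - by move=> x _; exact: integral_ge0.
  - by move=> x _; rewrite lee_fin dirichlet_ge0.
  apply: ae_eq_neq0 => x x0.
  rewrite /dirichlet (negbTE x0) mul0r addr0.
  have := integral_halfline_sexp (_ : 0 < `|x|); rewrite normr_gt0 => /(_ x0) E.
  transitivity (\int[lambda]_(s in `[0%R, +oo[) ((1 - cos (a * x))%:E * (s * expR (- (`|x| * s)))%:E))%E.
    rewrite [RHS]integral_mkcond; apply: eq_integral => s _; rewrite patchE mem_setE in_itv /= andbT /G /=.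
    case: ifP => s0; first by rewrite max_r// mulrC EFinM.
    by rewrite max_l ?mul0r// ltW// ltNge s0.
  rewrite ge0_integralZl//.
  - by rewrite E EFinM -[x^-1 ^+ 2]real_normK ?num_real// normfV.
  - by apply/measurable_EFinP; apply: measurable_funTS; apply: continuous_measurable_fun; cont.
  - move=> s; rewrite /= in_itv /= andbT => s0; rewrite lee_fin mulr_ge0 ?expR_ge0//.
move=> ->.
transitivity (\int[lambda]_(s in `]0%R, +oo[) (2%:E * (a ^+ 2 / (s ^+ 2 + a ^+ 2))%:E))%E.
  rewrite [RHS]integral_mkcond; apply: eq_integral => s _; rewrite patchE mem_setE in_itv /= andbT.
  case: ifP => s0; last first.
    rewrite integral0_eq// => x _; rewrite /G /= max_l ?mul0r// leNgt s0 //.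
  pose h (x : R) := s * expR (- (`|x| * s)) * (1 - cos (a * x)).
  have hG x : (G (x, s))%:E = (h x)%:E by rewrite /G /= max_r// ltW.
  under eq_integral do rewrite hG.
  rewrite integral_line_even.
  - rewrite -(integral_halfline_expcos a s0); congr (_ * _)%E; apply: eq_integral => x.
    by rewrite inE /= in_itv /= andbT /h => x0; rewrite ger0_norm.
  - rewrite /h; apply: contM; last by cont.
    apply: contM; first exact: cont_cst.
    apply: cont_expR; apply: contN; apply: contM; last exact: cont_cst.
    exact: norm_continuous.
  - by move=> x; rewrite /h; apply: mulr_ge0; rewrite ?subr_ge0 ?cos_le1// mulr_ge0 ?expR_ge0 ?ltW.
  - by move=> x; rewrite /h normrN mulrN cosN.
have sa (s : R) : 0 < s ^+ 2 + a ^+ 2.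
  by rewrite ltr_wpDl ?sqr_ge0// lt_neqAle sqr_ge0 eq_sym expf_eq0 a0.
have ch : continuous (fun s : R => a ^+ 2 / (s ^+ 2 + a ^+ 2)).
  apply: contM; first exact: cont_cst.
  have cd : continuous (fun s : R => s ^+ 2 + a ^+ 2) by cont.
  by move=> s; apply: cvgV; [rewrite gt_eqF|exact: cd].
have h0 (s : R) : 0 <= a ^+ 2 / (s ^+ 2 + a ^+ 2) by rewrite divr_ge0 ?sqr_ge0// ltW.
rewrite ge0_integralZl//; last 2 first.
- by apply/measurable_EFinP; apply: measurable_funTS; apply: continuous_measurable_fun.
- by move=> x _; rewrite lee_fin.
rewrite /= integral_itv_obnd_cbnd; last first.
  by apply/measurable_EFinP; apply: measurable_funTS; apply: continuous_measurable_fun.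
rewrite -integral_line_even//; last by move=> x; rewrite sqrrN.
have := @ge0_integral_affine R a^-1 0 (fun s => ((1 + s ^+ 2)^-1)%:E).
rewrite invr_eq0 => /(_ a0); rewrite integral_inv1sqr normfV invrK -EFinM mulrC => <-.
- apply: eq_integral => s _; congr EFin; rewrite addr0.
  by field; rewrite a0 addrC gt_eqF.
- by apply/measurable_EFinP; apply: continuous_measurable_fun; exact: cont_inv1sqr.
- by move=> s; rewrite lee_fin ltW ?inv1sqr_gt0.
Qed.

End dirichlet_integral.

Section fourier_inversion.
Context (R : realType).
Local Notation mR := (measurableTypeR R).
Local Notation lambda := (@lebesgue_measure R).

Definition sinc (u : R) : R := sin u * u^-1 + (u == 0)%:R.

Lemma sinc0 : sinc 0 = 1.
Proof. by rewrite /sinc sin0 mul0r eqxx add0r. Qed.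

Lemma sincE (u : R) : u != 0 -> sinc u = sin u / u.
Proof. by move=> u0; rewrite /sinc (negbTE u0) addr0. Qed.

Lemma measurable_sinc : measurable_fun setT (sinc : mR -> mR).
Proof.
apply: measurable_funD; last exact: measurable_eq0.
apply: measurable_funM; last exact: measurable_invr.
by apply: continuous_measurable_fun; exact: continuous_sin.
Qed.

Lemma sin_le (x : R) : 0 <= x -> sin x <= x.
Proof.
move=> x0; pose F (y : R) := y - sin y.
have dF (y : R) : is_derive y 1 F (1 - cos y) by rewrite /F; derive_tac; ring.
have F'0 (y : R) : 0 < y -> 0 <= 1 - cos y by rewrite subr_ge0 cos_le1.
have := nondecreasing_is_derive dF F'0 (lexx 0) x0.
by rewrite /F sin0 subr0 subr_ge0.
Qed.

Lemma norm_sin_le (x : R) : `|sin x| <= `|x|.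
Proof.
wlog x0 : x / 0 <= x => [h|].
  have [/h//|/ltW x0] := leP 0 x.
  by rewrite -normrN -sinN -[leRHS]normrN; apply: h; rewrite oppr_ge0.
rewrite (ger0_norm x0) ler_norml sin_le// andbT lerNl -sinN.
pose F (y : R) := y + sin y.
have dF (y : R) : is_derive y 1 F (1 + cos y) by rewrite /F; derive_tac; ring.
have F'0 (y : R) : 0 < y -> 0 <= 1 + cos y by rewrite -lerBlDl sub0r cos_geN1.
have := nondecreasing_is_derive dF F'0 (lexx 0) x0.
by rewrite /F sin0 addr0 sinN; lra.
Qed.

Lemma norm_sinc_le1 (u : R) : `|sinc u| <= 1.
Proof.
have [->|u0] := eqVneq u 0; first by rewrite sinc0 normr1.
by rewrite sincE// normrM normfV ler_pdivrMr ?normr_gt0// mul1r norm_sin_le.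
Qed.

Lemma norm_sinc_le_inv (u : R) : u != 0 -> `|sinc u| <= `|u|^-1.
Proof.
move=> u0; rewrite sincE// normrM normfV ler_piMl ?invr_ge0//.
exact: sin_max.
Qed.

Lemma norm_sincX_le n (u : R) : `|sinc u ^+ n.+2| <= 2 / (1 + u ^+ 2).
Proof.
have D0 : 0 < 1 + u ^+ 2 by rewrite ltr_pwDl// sqr_ge0.
rewrite normrX; apply: (@le_trans _ _ (`|sinc u| ^+ 2)).
  by rewrite -addn2 exprD ler_piMl ?sqr_ge0// exprn_ile1// norm_sinc_le1.
rewrite ler_pdivlMr//.
have [u1|u1] := leP (u ^+ 2) 1.
  have := norm_sinc_le1 u; have : 0 <= `|sinc u| by []; nra.
have u0 : u != 0 by apply: contraTneq u1 => ->; rewrite expr0n /= ltNge ler01.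
have := norm_sinc_le_inv u0 => h.
have {}h : `|sinc u| ^+ 2 <= (u ^+ 2)^-1.
  rewrite -[u ^+ 2]real_normK ?num_real// -exprVn ler_pXn2r ?nnegrE ?invr_ge0//.
have h1 : `|sinc u| ^+ 2 * u ^+ 2 <= 1.
  by rewrite -ler_pdivlMr ?div1r//; apply: lt_trans u1.
have := norm_sinc_le1 u; have : 0 <= `|sinc u| by []; nra.
Qed.

Definition fourier_integrand n (x u : R) := sinc u ^+ n * cos (2 * x * u).

Lemma measurable_fourier_integrand n x : measurable_fun setT (fourier_integrand n x : mR -> mR).
Proof.
apply: measurable_funM; first by apply: measurable_funX; exact: measurable_sinc.
by apply: continuous_measurable_fun; cont.
Qed.

Lemma norm_fourier_integrand_le n x u : `|fourier_integrand n.+2 x u| <= 2 / (1 + u ^+ 2).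
Proof.
rewrite normrM; apply: le_trans (norm_sincX_le n u).
by rewrite ler_piMr// cos_max.
Qed.

Lemma intble_fourier_integrand n x : intble (fourier_integrand n.+2 x).
Proof.
apply: (@intble_dominated _ _ 2); first exact: measurable_fourier_integrand.
exact: norm_fourier_integrand_le.
Qed.

Lemma intble_dirichlet (a : R) : intble (dirichlet a).
Proof.
apply/integrableP; split; first by apply/measurable_EFinP; exact: measurable_dirichlet.
under eq_integral do rewrite /= ger0_norm ?dirichlet_ge0//.
by rewrite integral_dirichlet ltry.
Qed.

(** The induction starts at the square because sinc itself is not absolutely integrable. Product
    formulas turn the integrand into a second difference in [x] of Dirichlet kernels, and the second
    difference of the absolute value is the triangle function. *)
Lemma integral_fourier2 (x : R) :
  (\int[lambda]_u (fourier_integrand 2 x u)%:E = (pi * spline 1 x)%:E)%E.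
Proof.
have E u : fourier_integrand 2 x u = 4^-1 * (dirichlet (2 * (x + 1)) u + dirichlet (2 * (x - 1)) u) - 2^-1 * dirichlet (2 * x) u.
  rewrite /fourier_integrand /dirichlet; have [->|u0] := eqVneq u 0.
    by rewrite sinc0 !mulr0 cos0 subrr !mul0r ?eqxx !mul1r !add0r; field.
  rewrite sincE// !mul0r !addr0.
  have -> : 2 * (x + 1) * u = 2 * x * u + (u + u) by ring.
  have -> : 2 * (x - 1) * u = 2 * x * u - (u + u) by ring.
  have c2 : cos (u + u) = 1 - 2 * sin u ^+ 2 by rewrite cosD; have := cos2Dsin2 u; lra.
  by rewrite cosB (cosD (2 * x * u)) c2; field.
under eq_integral do rewrite E EFinB !EFinM EFinD.
have i1 := intble_dirichlet (2 * (x + 1)).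
have i2 := intble_dirichlet (2 * (x - 1)).
have i3 := intble_dirichlet (2 * x).
rewrite integralB//=; last 2 first.
- by apply: integrableZl => //; exact: integrableD.
- exact: integrableZl.
rewrite integralZl//=; last exact: integrableD.
rewrite integralD//= integralZl//= !integral_dirichlet.
transitivity ((4^-1 * (pi * `|2 * (x + 1)| + pi * `|2 * (x - 1)|) - 2^-1 * (pi * `|2 * x|))%:E); first by [].
congr EFin.
rewrite spline1E !normrM (@ger0_norm _ 2)//.
have [x0|x0] := leP 0 x; have [x1|x1] := leP 0 (x - 1); have [x2|x2] := leP 0 (x + 1);
  rewrite ?(ger0_norm x0) ?(ltr0_norm x0) ?(ger0_norm x1) ?(ltr0_norm x1) ?(ger0_norm x2) ?(ltr0_norm x2);
  (case: leP => ?; try (by field); try lra).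
by (have -> : x = 1 by lra); field.
Qed.

Lemma integral_cos_unit (z u : R) :
  (\int[lambda]_(x in `[0%R, 1%R]) (cos (2 * (z - (x - 1 / 2)) * u))%:E = (sinc u * cos (2 * z * u))%:E)%E.
Proof.
have [->|u0] := eqVneq u 0.
  rewrite (eq_integral (fun=> 1%E)); last by move=> x _; rewrite mulr0 cos0.
  by rewrite integral_cst//= lebesgue_measure_itv /= lte_fin ltr01 mul1e sinc0 mulr0 cos0 mul1r sube0.
pose F (x : R) := - sin (2 * (z - (x - 1 / 2)) * u) / (2 * u).
have dF (x : R) : is_derive x 1 F (cos (2 * (z - (x - 1 / 2)) * u)).
  by rewrite /F; derive_tac; field.
rewrite (integral_is_derive dF) //; last by cont.
congr EFin; rewrite /F sincE//.
have -> : 2 * (z - (1 - 1 / 2)) * u = 2 * z * u - u by field.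
have -> : 2 * (z - (0 - 1 / 2)) * u = 2 * z * u + u by field.
by rewrite sinB sinD; field.
Qed.

(** Each further convolution averages the argument over a unit interval, and by [integral_cos_unit]
    this average multiplies the cosine by [sinc u]. Fubini applies because the integrand is
    dominated by 2 / (1 + u^2) on a strip of width 1. *)
Theorem fourier_inversion k (x : R) :
  (\int[lambda]_u (fourier_integrand k.+2 x u)%:E = (pi * spline k.+1 x)%:E)%E.
Proof.
elim: k x => [|k IH] z; first exact: integral_fourier2.
pose f (p : mR * mR) := \1_(`[0, 1]%classic : set R) p.1 * (sinc p.2 ^+ k.+2 * cos (2 * (z - (p.1 - 1 / 2)) * p.2)).
have mf : measurable_fun setT (EFin \o f).
  apply/measurable_EFinP; rewrite /f; apply: measurable_funM.
    by apply: measurableT_comp => //; exact: measurable_indic.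
  apply: measurable_funM.
    by apply: measurable_funX; apply: measurableT_comp => //; exact: measurable_sinc.
  apply: measurableT_comp; first by apply: continuous_measurable_fun; exact: continuous_cos.
  apply: measurable_funM => //; apply: measurable_funM => //.
  by apply: measurable_funB => //; exact: measurable_funB.
have intf : (lambda \x lambda)%E.-integrable setT (EFin \o f).
  apply/integrable12ltyP => //.
  apply: (@le_lt_trans _ _ (\int[lambda]_x ((2 * pi)%:E * (\1_(`[0, 1]%classic : set R) x)%:E))%E).
    apply: ge0_le_integral => //.
    - by move=> x _; apply: integral_ge0 => u _; exact: abse_ge0.
    - have mF : measurable_fun setT (fubini_F lambda (fun p : mR * mR => `|(f p)%:E|)%E).
        by apply: measurable_fun_fubini_tonelli_F => //; exact: measurableT_comp.
      exact: mF.
    - apply/measurable_EFinP; apply: measurable_funM => //; exact: measurable_indic.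
    move=> x _; apply: (@le_trans _ _ (\int[lambda]_u ((2 * \1_(`[0, 1]%classic : set R) x)%:E * ((1 + u ^+ 2)^-1)%:E))%E).
      apply: ge0_le_integral => //.
      - apply: measurableT_comp => //.
        exact: (measurableT_comp mf (pair1_measurable x)).
      - by apply/measurable_EFinP; apply: measurable_funM => //; apply: continuous_measurable_fun; exact: cont_inv1sqr.
      move=> u _; have -> : (EFin \o f) (x, u) = (\1_(`[0, 1]%classic : set R) x * fourier_integrand k.+2 (z - (x - 1 / 2)) u)%:E by [].
      rewrite -EFinM lee_fin normrM ger0_norm// [2 * _]mulrC -mulrA.
      by apply: ler_wpM2l => //; exact: norm_fourier_integrand_le.
    rewrite ge0_integralZl//.
    - by rewrite integral_inv1sqr -!EFinM lee_fin mulrAC.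
    - by apply/measurable_EFinP; apply: continuous_measurable_fun; exact: cont_inv1sqr.
    - by move=> u _; rewrite lee_fin ltW ?inv1sqr_gt0.
  rewrite ge0_integralZl//.
  - by rewrite integral_indic//= setIT lebesgue_measure_itv /= lte_fin ltr01 -EFinB -EFinM ltry.
  - by apply/measurable_EFinP; exact: measurable_indic.
  - by rewrite lee_fin mulr_ge0 ?pi_ge0.
have fE (x u : R) : (EFin \o f) (x, u) =
    ((x \in (`[0, 1]%classic : set R))%:R * fourier_integrand k.+2 (z - (x - 1 / 2)) u)%:E.
  by rewrite /f /comp indicE.
have L : (\int[lambda]_x \int[lambda]_u (EFin \o f) (x, u) = (pi * spline k.+2 z)%:E)%E.
  rewrite EFinM -integral_spline// -ge0_integralZl//.
  - rewrite [RHS]integral_mkcond; apply: eq_integral => x _; rewrite patchE.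
    under eq_integral do rewrite fE.
    case: ifPn => x01.
      by rewrite -EFinM -IH; apply: eq_integral => u _; rewrite mulr1n mul1r.
    by rewrite integral0_eq// => u _; rewrite mulr0n mul0r.
  - apply/measurable_EFinP; apply: measurable_funTS.
    by apply: continuous_measurable_fun; apply: (@cont_comp _ (spline k.+1)); [exact: continuous_spline|cont].
  - by move=> x _; rewrite lee_fin -[spline _ _]/(box_density k.+1 _) box_density_ge0.
  - by rewrite lee_fin pi_ge0.
rewrite -L (Fubini intf); apply: eq_integral => u _; apply/esym.
transitivity (\int[lambda]_(x in `[0%R, 1%R]) ((sinc u ^+ k.+2)%:E * (cos (2 * (z - (x - 1 / 2)) * u))%:E))%E.
  rewrite [RHS]integral_mkcond; apply: eq_integral => x _; rewrite patchE fE.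
  by case: ifPn => x01; rewrite ?mulr1n ?mulr0n ?mul1r ?mul0r// EFinM.
rewrite integralZl//.
  by rewrite integral_cos_unit -EFinM /fourier_integrand [sinc u ^+ k.+3]exprSr mulrA.
apply: continuous_compact_integrable; first exact: segment_compact.
by apply: continuous_subspaceT; cont.
Qed.

End fourier_inversion.

(** * Gaussian integrals *)

Section gaussian_moments.
Context (R : realType).
Local Notation mR := (measurableTypeR R).
Local Notation lambda := (@lebesgue_measure R).

(** One condition for two uses: with continuity it gives integrability, and it makes boundary terms
    vanish at infinity. *)
Definition rapid (f : R -> R) := exists C, forall u, `|f u| <= C / (1 + u ^+ 2).

Lemma rapidD f g : rapid f -> rapid g -> rapid (fun u => f u + g u).
Proof.
move=> [C hC] [D hD]; exists (C + D) => u.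
by apply: (le_trans (ler_normD _ _)); rewrite mulrDl lerD.
Qed.

Lemma rapidM f g M : (forall u, `|f u| <= M) -> rapid g -> rapid (fun u => f u * g u).
Proof.
move=> hM [D hD]; exists (M * D) => u.
by rewrite normrM -mulrA ler_pM.
Qed.

Lemma rapidZ c g : rapid g -> rapid (fun u => c * g u).
Proof. exact: (@rapidM (fun=> c) g `|c|). Qed.

Lemma rapid_cos b g : rapid g -> rapid (fun u => cos (b * u) * g u).
Proof. by apply: rapidM => u; exact: cos_max. Qed.

Lemma rapid_sin b g : rapid g -> rapid (fun u => sin (b * u) * g u).
Proof. by apply: rapidM => u; exact: sin_max. Qed.

Definition gmono (a : R) k u := u ^+ k * expR (- (a * u ^+ 2)).

Lemma rapid_gmono a k : 0 < a -> rapid (gmono a k).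
Proof.
move=> a0; exists (2 * (1 + (k.+1)`!%:R / a ^+ k.+1)) => u.
have D0 : 0 < 1 + u ^+ 2 by rewrite ltr_pwDl// sqr_ge0.
have e0 := expR_ge0 (- (a * u ^+ 2)).
have q0 : 0 <= (k.+1)`!%:R / a ^+ k.+1 by rewrite divr_ge0// exprn_ge0 ?ltW.
rewrite normrM normrX (ger0_norm e0) ler_pdivlMr//.
have n0 := normr_ge0 u; have nu : u ^+ 2 = `|u| ^+ 2 by rewrite real_normK ?num_real.
have [u1|u1] := leP `|u| 1.
  have h1 : `|u| ^+ k <= 1 by rewrite exprn_ile1.
  have h2 : expR (- (a * u ^+ 2)) <= 1 by rewrite -expR0 ler_expR oppr_le0 mulr_ge0 ?sqr_ge0 ?ltW.
  have h3 : `|u| ^+ k * expR (- (a * u ^+ 2)) <= 1.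
    by rewrite -[leRHS]mulr1; apply: ler_pM => //; rewrite exprn_ge0.
  have h4 : 0 <= `|u| ^+ k * expR (- (a * u ^+ 2)) by rewrite mulr_ge0// exprn_ge0.
  have h5 : 1 + u ^+ 2 <= 2 by rewrite nu; nra.
  nra.
have y0 : 0 < a * u ^+ 2 by rewrite nu mulr_gt0// exprn_gt0// (lt_trans _ u1).
have h := expRN_le_inv k y0.
have up : 0 < `|u| by rewrite (lt_trans _ u1).
apply: (@le_trans _ _ (`|u| ^+ k * ((k.+1)`!%:R / (a * u ^+ 2) ^+ k.+1) * (2 * u ^+ 2))).
  apply: ler_pM; rewrite ?mulr_ge0 ?exprn_ge0 ?addr_ge0 ?sqr_ge0//.
    by rewrite ler_wpM2l ?exprn_ge0.
  by rewrite nu; nra.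
have -> : `|u| ^+ k * ((k.+1)`!%:R / (a * u ^+ 2) ^+ k.+1) * (2 * u ^+ 2) =
   2 * ((k.+1)`!%:R / a ^+ k.+1) * `|u|^-1 ^+ k.
  have -> : (a * u ^+ 2) ^+ k.+1 = a ^+ k.+1 * (`|u| ^+ k * `|u| ^+ k * u ^+ 2).
    by rewrite exprMn nu -!exprD -exprM; congr (_ * _ ^+ _); lia.
  rewrite nu exprVn; field.
  by rewrite !expf_eq0 !(gt_eqF up) !(gt_eqF a0) !andbF.
have : `|u|^-1 ^+ k <= 1 by rewrite exprn_ile1 ?invr_ge0// invf_le1// ltW.
nra.
Qed.

(** The common source of all the integrations by parts below. Adding C / (1 + u^2), the derivative
    of C atan, makes [f] nonnegative; the sum is symmetrized and integrated on the half-line, and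
    the contribution C pi is finally subtracted. *)
Lemma integral_derivative0 F f : (forall u : R, is_derive u 1 F (f u)) -> continuous f ->
  rapid F -> rapid f -> \int[lambda]_u f u = 0.
Proof.
move=> dF cf [C' hF] [C hf].
have cD := @cont_inv1sqr R.
pose g u := f u + C * (1 + u ^+ 2)^-1.
have g0 u : 0 <= g u by have := hf u; rewrite ler_norml /g => /andP[? _]; lra.
have cg : continuous g by apply: contD => //; apply: contM => //; exact: cont_cst.
have dat (u : R) : is_derive u 1 (@atan R) (1 + u ^+ 2)^-1 by exact: is_derive1_atan.
pose H u := F u + C * atan u - (F (- u) + C * atan (- u)).
have dH (u : R) : is_derive u 1 H (g u + g (- u)).
  notypeclasses refine (@derive_eq _ _ _ _ _ (derB (derD (dF _) (derM (der_cst _ _) (dat _)))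
     (derD (der_comp (dF _) (derN (der_id _))) (derM (der_cst _ _) (der_comp (dat _) (derN (der_id _)))))) _).
  by rewrite /g; ring.
have cgN : continuous (fun u => g (- u)) by exact: (cont_comp cg (contN (@cont_id R))).
have ch : continuous (fun u => g u + g (- u)) by exact: contD.
have iH : (\int[lambda]_(u in `[0%R, +oo[) (g u + g (- u))%:E = (C * pi)%:E)%E.
  rewrite (ge0_integral_halfline dH ch (l := C * pi)).
  - by congr EFin; rewrite /H oppr0 subrr subr0.
  - by move=> u _; rewrite addr_ge0.
  rewrite (_ : C * pi = (0 + C * (pi / 2)) - (0 + C * (- (pi / 2)))); last by field.
  have F0 (G : R -> R) : (forall u, `|G u| <= C' / (1 + u ^+ 2)) -> G x @[x --> +oo] --> (0 : R).
    move=> hG; apply: (@cvg_pinfty0_bound _ _ C') => x x0.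
    apply: (le_trans (hG x)); rewrite ler_wpM2l//.
      have := hG 0; rewrite expr0n addr0 divr1; exact: le_trans.
    by rewrite lef_pV2 ?posrE ?ltr_pwDl ?sqr_ge0//; nra.
  apply: cvgB; apply: cvgD.
  - exact: F0.
  - by apply: cvgM; [exact: cvg_cst|exact: cvgy_atan].
  - by apply: F0 => u; have := hF (- u); rewrite sqrrN.
  - apply: cvgM; first exact: cvg_cst.
    under eq_fun do rewrite atanN. apply: cvgN. exact: cvgy_atan.
have mg : measurable_fun setT (fun u : mR => (g u)%:E).
  by apply/measurable_EFinP; exact: continuous_measurable_fun.
have ig : (\int[lambda]_u (g u)%:E = (C * pi)%:E)%E.
  have E : (\int[lambda]_u (g u + g (- u))%:E = 2%:E * (C * pi)%:E)%E.
    rewrite integral_line_even ?iH//.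
    - by move=> u; rewrite addr_ge0.
    - by move=> u; rewrite opprK addrC.
  have Er : (\int[lambda]_u (g (- u))%:E = \int[lambda]_u (g u)%:E)%E.
    have := @ge0_integral_affine R (-1) 0 (fun u => (g u)%:E).
    rewrite oppr_eq0 oner_eq0 normrN normr1 invr1 mul1e => <- //.
    by apply: eq_integral => u _; rewrite mulN1r addr0.
  move: E; under eq_integral do rewrite EFinD.
  rewrite ge0_integralD//; last 3 first.
  - by move=> x _; rewrite lee_fin.
  - by move=> x _; rewrite lee_fin.
  - apply/measurable_EFinP; exact: continuous_measurable_fun.
  rewrite Er -mule2n -mule_natl => /(congr1 (fun x => (2^-1)%:E * x)%E).
  by rewrite !muleA -EFinM mulVf// !mul1e.
have ifi : intble f by apply: (@intble_dominated _ _ C) => //; exact: continuous_measurable_fun.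
have -> : \int[lambda]_u f u = \int[lambda]_u (g u - C * (1 + u ^+ 2)^-1).
  by apply: eq_Rintegral => u _; rewrite /g addrK.
have iC : intble (fun u => C * (1 + u ^+ 2)^-1).
  have := integrableZl measurableT C (@intble_inv1sqr R). exact.
rewrite RintegralB//; last first.
  exact: (integrableD measurableT ifi iC).
rewrite RintegralZl//; last exact: intble_inv1sqr.
by rewrite Rintegral_inv1sqr /Rintegral ig subrr.
Qed.

End gaussian_moments.

Section gaussian_integrals.
Context (R : realType).
Local Notation mR := (measurableTypeR R).
Local Notation lambda := (@lebesgue_measure R).

Lemma intble_rapid (f : R -> R) : continuous f -> rapid f -> intble f.
Proof.
move=> cf [C hC]; apply: (@intble_dominated _ _ C) => //.
exact: continuous_measurable_fun.
Qed.

Lemma cont_gmono (a : R) k : continuous (gmono a k).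
Proof. by rewrite /gmono; cont. Qed.

Definition gauss_cos (a : R) k (b : R) : R := \int[lambda]_u (cos (b * u) * gmono a k u).

Lemma cont_gcos (a b : R) k : continuous (fun u => cos (b * u) * gmono a k u).
Proof. by rewrite /gmono; cont. Qed.

Lemma cont_gsin (a b : R) k : continuous (fun u => sin (b * u) * gmono a k u).
Proof. by rewrite /gmono; cont. Qed.

Section positive_rate.
Context (a : R) (a0 : 0 < a).

Lemma rapid_gcos b k : rapid (fun u => cos (b * u) * gmono a k u).
Proof. exact/rapid_cos/rapid_gmono. Qed.

Lemma rapid_gsin b k : rapid (fun u => sin (b * u) * gmono a k u).
Proof. exact/rapid_sin/rapid_gmono. Qed.

Lemma intble_gcos b k : intble (fun u => cos (b * u) * gmono a k u).
Proof. by apply: intble_rapid; [exact: cont_gcos|exact: rapid_gcos]. Qed.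

Lemma intble_gsin b k : intble (fun u => sin (b * u) * gmono a k u).
Proof. by apply: intble_rapid; [exact: cont_gsin|exact: rapid_gsin]. Qed.

Lemma RintegralDZ (f g : R -> R) (c d : R) : intble f -> intble g ->
  \int[lambda]_u (c * f u + d * g u) = c * \int[lambda]_u f u + d * \int[lambda]_u g u.
Proof.
move=> hf hg; rewrite RintegralD//; first by rewrite !RintegralZl.
  by have := integrableZl measurableT c hf.
by have := integrableZl measurableT d hg.
Qed.

Lemma integral_gsin1 b : \int[lambda]_u (sin (b * u) * gmono a 1 u) = b / (2 * a) * gauss_cos a 0 b.
Proof.
pose F u := sin (b * u) * gmono a 0 u.
pose f u := (- (2 * a)) * (sin (b * u) * gmono a 1 u) + b * (cos (b * u) * gmono a 0 u).
have dF (u : R) : is_derive u 1 F (f u).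
  by rewrite /F /f /gmono; derive_tac; rewrite /=; ring.
have cf : continuous f by rewrite /f /gmono; cont.
have := integral_derivative0 dF cf (rapid_gsin b 0)
  (rapidD (rapidZ _ (rapid_gsin b 1)) (rapidZ _ (rapid_gcos b 0))).
rewrite RintegralDZ; [|exact: intble_gsin|exact: intble_gcos].
rewrite -/(gauss_cos a 0 b) => h; have an : a != 0 by rewrite gt_eqF.
set S := Rintegral _ _ _ in h *.
have -> : b / (2 * a) * gauss_cos a 0 b = (b * gauss_cos a 0 b) / (2 * a) by ring.
have -> : b * gauss_cos a 0 b = 2 * a * S by lra.
by field.
Qed.

Lemma gauss_cos4 b : gauss_cos a 4 b =
  (3 / (4 * a ^+ 2) - 3 * b ^+ 2 / (4 * a ^+ 3) + b ^+ 4 / (16 * a ^+ 4)) * gauss_cos a 0 b.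
Proof.
have an : a != 0 by rewrite gt_eqF.
(* The four coefficients are solved from the top degree down: in the derivative of [F], the term u^4
   cos gets coefficient 1, and the terms in u^3 sin, u^2 cos and u sin cancel. *)
pose p3 := - (2 * a)^-1; pose q2 := b / (4 * a ^+ 2).
pose p1 := (3 * p3 + b * q2) / (2 * a); pose q0 := (2 * q2 - b * p1) / (2 * a).
pose F u := (p1 * (cos (b * u) * gmono a 1 u) + p3 * (cos (b * u) * gmono a 3 u)) +
            (q0 * (sin (b * u) * gmono a 0 u) + q2 * (sin (b * u) * gmono a 2 u)).
pose f u := 1 * (cos (b * u) * gmono a 4 u) + (p1 + b * q0) * (cos (b * u) * gmono a 0 u).
have dF (u : R) : is_derive u 1 F (f u).
  rewrite /F /f /gmono; derive_tac; rewrite /=.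
  by rewrite /q0 /p1 /q2 /p3; field.
have cf : continuous f by rewrite /f /gmono; cont.
have := integral_derivative0 dF cf
  (rapidD (rapidD (rapidZ _ (rapid_gcos b 1)) (rapidZ _ (rapid_gcos b 3)))
          (rapidD (rapidZ _ (rapid_gsin b 0)) (rapidZ _ (rapid_gsin b 2))))
  (rapidD (rapidZ _ (rapid_gcos b 4)) (rapidZ _ (rapid_gcos b 0))).
rewrite RintegralDZ; [|exact: intble_gcos|exact: intble_gcos].
rewrite -!/(gauss_cos a _ b) mul1r => /eqP; rewrite addr_eq0 => /eqP ->.
by rewrite /q0 /p1 /q2 /p3; field.
Qed.

Lemma cos0gmono k : (fun u => cos (0 * u) * gmono a k u) = gmono a k.
Proof. by apply/funext => u; rewrite mul0r cos0 mul1r. Qed.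

Lemma rapid_gm k : rapid (gmono a k).
Proof. exact: rapid_gmono. Qed.

Lemma intble_gmono k : intble (gmono a k).
Proof. by apply: intble_rapid; [exact: cont_gmono|exact: rapid_gmono]. Qed.

Definition gauss_moment k := \int[lambda]_u gmono a k u.

Lemma gauss_momentSS k : gauss_moment k.+2 = k.+1%:R / (2 * a) * gauss_moment k.
Proof.
have an : a != 0 by rewrite gt_eqF.
pose F u := gmono a k.+1 u.
pose f u := k.+1%:R * gmono a k u + (- (2 * a)) * gmono a k.+2 u.
have dF (u : R) : is_derive u 1 F (f u).
  rewrite /F /f /gmono; derive_tac; rewrite /=; rewrite !exprS; ring.
have cf : continuous f by rewrite /f /gmono; cont.
have := integral_derivative0 dF cf (rapid_gm k.+1) (rapidD (rapidZ _ (rapid_gm k)) (rapidZ _ (rapid_gm k.+2))).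
rewrite RintegralDZ; [|exact: intble_gmono|exact: intble_gmono].
rewrite -!/(gauss_moment _) => h.
have -> : k.+1%:R / (2 * a) * gauss_moment k = (k.+1%:R * gauss_moment k) / (2 * a) by ring.
have -> : k.+1%:R * gauss_moment k = 2 * a * gauss_moment k.+2 by lra.
by field.
Qed.

Lemma gauss_moment0 : gauss_moment 0 = Num.sqrt (pi / a).
Proof.
have sa : 0 < Num.sqrt a by rewrite sqrtr_gt0.
have := @ge0_integral_affine R (Num.sqrt a) 0 (fun u => (gauss_fun u)%:E).
rewrite gt_eqF// => /(_ isT); rewrite integralT_gauss => h.
rewrite /gauss_moment /Rintegral.
rewrite (_ : (\int[lambda]_x _)%E = (\int[lambda]_x (gauss_fun (Num.sqrt a * x + 0))%:E)%E); last first.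
  apply: eq_integral => u _; rewrite /gauss_fun /gmono expr0 mul1r addr0 exprMn sqr_sqrtr ?ltW//.
rewrite h.
- by rewrite -EFinM /= gtr0_norm// sqrtrM ?pi_ge0// sqrtrV ?ltW// mulrC.
- by apply/measurable_EFinP; exact: measurable_gauss_fun.
- by move=> u; rewrite lee_fin gauss_fun_ge0.
Qed.

Lemma is_derive_gauss_cos0 (b : R) : is_derive b 1 (gauss_cos a 0) (- (b / (2 * a) * gauss_cos a 0 b)).
Proof.
have [C hC] := rapid_gm 1.
pose f (b u : R) := cos (b * u) * gmono a 0 u.
have df (x u : R) : is_derive x 1 (f ^~ u) (- sin (x * u) * gmono a 1 u).
  by rewrite /f /gmono; derive_tac; rewrite /=; ring.
have partialE (x u : R) : partial1of2 f x u = - sin (x * u) * gmono a 1 u.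
  by rewrite partial1of2E (@derive_val _ _ _ _ _ _ _ (df x u)).
have C0 : 0 <= C by have := hC 0; rewrite expr0n addr0 divr1; exact: le_trans.
have intf (x : R) : `]b - 1, b + 1[%classic x -> intble (f x) by move=> _; exact: intble_gcos.
have G0 u : 0 <= C / (1 + u ^+ 2) by rewrite divr_ge0// addr_ge0// sqr_ge0.
have iG : intble (fun u => C / (1 + u ^+ 2)).
  by have := integrableZl measurableT C (@intble_inv1sqr R).
have Gub (x u : R) : `]b - 1, b + 1[%classic x -> [set: R] u -> `|partial1of2 f x u| <= C / (1 + u ^+ 2).
  by move=> _ _; rewrite partialE normrM normrN; apply: le_trans (hC u); rewrite ler_piMl// sin_max.
have Ib : `]b - 1, b + 1[%classic b by rewrite /= in_itv /=; apply/andP; split; lra.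
have derf (x u : R) : `]b - 1, b + 1[%classic x -> [set: R] u -> derivable (f ^~ u) x 1.
  by move=> _ _; have [] := df x u.
have D1 := derivable_under_integral measurableT Ib intf derf G0 iG Gub.
have D2 := differentiation_under_integral measurableT Ib intf derf G0 iG Gub.
split; first exact: D1.
rewrite -derive1E [LHS]D2 -integral_gsin1.
rewrite (_ : (fun x => _) = fun u => (-1) * (sin (b * u) * gmono a 1 u)); last first.
  by apply/funext => u; rewrite partialE; ring.
by rewrite RintegralZl//; [rewrite mulN1r|exact: intble_gsin].
Qed.

(** As a function of b, [gauss_cos a 0] solves y' = - b y / (2 a), so its product with exp(b^2 / (4
    a)) is constant, equal to its value at 0. *)
Lemma gauss_cos0E b : gauss_cos a 0 b = Num.sqrt (pi / a) * expR (- (b ^+ 2 / (4 * a))).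
Proof.
have an : a != 0 by rewrite gt_eqF.
pose h x := gauss_cos a 0 x * expR (x ^+ 2 / (4 * a)).
have dh (x : R) : is_derive x 1 h 0.
  have dG := is_derive_gauss_cos0 x; rewrite /h; derive_tac; first exact: dG.
  by rewrite /=; field.
have := @is_derive_0_is_cst R h b 0 dh.
rewrite /h expr0n mul0r expR0 mulr1 {2}/gauss_cos cos0gmono -/(gauss_moment 0) gauss_moment0 => <-.
by rewrite -mulrA -expRD addrN expR0 mulr1.
Qed.

End positive_rate.
End gaussian_integrals.

(** * Gaussian approximation of powers of the sine cardinal *)

Section sinc_bounds.
Context (R : realType).

(** One rung of the Taylor estimates below: each signed remainder vanishes at 0 and has the previous
    remainder as derivative. *)
Lemma ge0_is_derive (F f : R -> R) : (forall x : R, is_derive x 1 F (f x)) -> F 0 = 0 ->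
  (forall x, 0 <= x -> 0 <= f x) -> forall x, 0 <= x -> 0 <= F x.
Proof.
move=> dF F0 f0 x x0; rewrite -F0.
by apply: (nondecreasing_is_derive dF _ (lexx 0) x0) => y /ltW; exact: f0.
Qed.

Lemma expRN_taylor (z : R) : 0 <= z ->
  [/\ 1 - z + z ^+ 2 / 2 - z ^+ 3 / 6 <= expR (- z),
      expR (- z) <= 1 - z + z ^+ 2 / 2 &
      expR (- z) <= 1 - z + z ^+ 2 / 2 - z ^+ 3 / 6 + z ^+ 4 / 24].
Proof.
have e1 (x : R) : 0 <= x -> 0 <= 1 - expR (- x).
  by move=> x0; rewrite subr_ge0 -expR0 ler_expR oppr_le0.
have e2 (x : R) : 0 <= x -> 0 <= expR (- x) - (1 - x).
  apply: (@ge0_is_derive (fun x => expR (- x) - (1 - x)) (fun x => 1 - expR (- x)) _ _ e1).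
  - by move=> y; derive_tac; ring.
  - by rewrite oppr0 expR0; ring.
have e3 (x : R) : 0 <= x -> 0 <= (1 - x + x ^+ 2 / 2) - expR (- x).
  apply: (@ge0_is_derive (fun x => (1 - x + x ^+ 2 / 2) - expR (- x)) (fun x => expR (- x) - (1 - x)) _ _ e2).
  - by move=> y; derive_tac; rewrite /=; field.
  - by rewrite oppr0 expR0; ring.
have e4 (x : R) : 0 <= x -> 0 <= expR (- x) - (1 - x + x ^+ 2 / 2 - x ^+ 3 / 6).
  apply: (@ge0_is_derive (fun x => expR (- x) - (1 - x + x ^+ 2 / 2 - x ^+ 3 / 6)) (fun x => (1 - x + x ^+ 2 / 2) - expR (- x)) _ _ e3).
  - by move=> y; derive_tac; rewrite /=; field.
  - by rewrite oppr0 expR0; ring.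
have e5 (x : R) : 0 <= x -> 0 <= (1 - x + x ^+ 2 / 2 - x ^+ 3 / 6 + x ^+ 4 / 24) - expR (- x).
  apply: (@ge0_is_derive (fun x => (1 - x + x ^+ 2 / 2 - x ^+ 3 / 6 + x ^+ 4 / 24) - expR (- x))
    (fun x => expR (- x) - (1 - x + x ^+ 2 / 2 - x ^+ 3 / 6)) _ _ e4).
  - by move=> y; derive_tac; rewrite /=; field.
  - by rewrite oppr0 expR0; ring.
by move=> z0; split; rewrite -subr_ge0; [exact: e4|exact: e3|exact: e5].
Qed.

(** The denominators [720 * 7] and [720 * 504] are 7! and 9!. Sine and cosine remainders alternate
    along the ladder. *)
Lemma sin_taylor (u : R) : 0 <= u ->
  u - u ^+ 3 / 6 + u ^+ 5 / 120 - u ^+ 7 / (720 * 7) <= sin u /\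
  sin u <= u - u ^+ 3 / 6 + u ^+ 5 / 120 - u ^+ 7 / (720 * 7) + u ^+ 9 / (720 * 504).
Proof.
have s1 (x : R) : 0 <= x -> 0 <= x - sin x by move=> /sin_le; rewrite subr_ge0.
have c2 (x : R) : 0 <= x -> 0 <= cos x - (1 - x ^+ 2 / 2).
  apply: (@ge0_is_derive (fun x => cos x - (1 - x ^+ 2 / 2)) (fun x => x - sin x) _ _ s1).
  - by move=> y; derive_tac; rewrite /=; field.
  - by rewrite cos0; ring.
have s3 (x : R) : 0 <= x -> 0 <= sin x - (x - x ^+ 3 / 6).
  apply: (@ge0_is_derive (fun x => sin x - (x - x ^+ 3 / 6)) (fun x => cos x - (1 - x ^+ 2 / 2)) _ _ c2).
  - by move=> y; derive_tac; rewrite /=; field.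
  - by rewrite sin0; ring.
have c4 (x : R) : 0 <= x -> 0 <= (1 - x ^+ 2 / 2 + x ^+ 4 / 24) - cos x.
  apply: (@ge0_is_derive (fun x => (1 - x ^+ 2 / 2 + x ^+ 4 / 24) - cos x) (fun x => sin x - (x - x ^+ 3 / 6)) _ _ s3).
  - by move=> y; derive_tac; rewrite /=; field.
  - by rewrite cos0; ring.
have s5 (x : R) : 0 <= x -> 0 <= (x - x ^+ 3 / 6 + x ^+ 5 / 120) - sin x.
  apply: (@ge0_is_derive (fun x => (x - x ^+ 3 / 6 + x ^+ 5 / 120) - sin x)
    (fun x => (1 - x ^+ 2 / 2 + x ^+ 4 / 24) - cos x) _ _ c4).
  - by move=> y; derive_tac; rewrite /=; field.
  - by rewrite sin0; ring.
have c6 (x : R) : 0 <= x -> 0 <= cos x - (1 - x ^+ 2 / 2 + x ^+ 4 / 24 - x ^+ 6 / 720).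
  apply: (@ge0_is_derive (fun x => cos x - (1 - x ^+ 2 / 2 + x ^+ 4 / 24 - x ^+ 6 / 720))
    (fun x => (x - x ^+ 3 / 6 + x ^+ 5 / 120) - sin x) _ _ s5).
  - by move=> y; derive_tac; rewrite /=; field.
  - by rewrite cos0; ring.
have s7 (x : R) : 0 <= x -> 0 <= sin x - (x - x ^+ 3 / 6 + x ^+ 5 / 120 - x ^+ 7 / (720 * 7)).
  apply: (@ge0_is_derive (fun x => sin x - (x - x ^+ 3 / 6 + x ^+ 5 / 120 - x ^+ 7 / (720 * 7)))
    (fun x => cos x - (1 - x ^+ 2 / 2 + x ^+ 4 / 24 - x ^+ 6 / 720)) _ _ c6).
  - by move=> y; derive_tac; rewrite /=; field.
  - by rewrite sin0; ring.
have c8 (x : R) : 0 <= x -> 0 <= (1 - x ^+ 2 / 2 + x ^+ 4 / 24 - x ^+ 6 / 720 + x ^+ 8 / (720 * 56)) - cos x.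
  apply: (@ge0_is_derive (fun x => (1 - x ^+ 2 / 2 + x ^+ 4 / 24 - x ^+ 6 / 720 + x ^+ 8 / (720 * 56)) - cos x)
    (fun x => sin x - (x - x ^+ 3 / 6 + x ^+ 5 / 120 - x ^+ 7 / (720 * 7))) _ _ s7).
  - by move=> y; derive_tac; rewrite /=; field.
  - by rewrite cos0; ring.
have s9 (x : R) : 0 <= x -> 0 <= (x - x ^+ 3 / 6 + x ^+ 5 / 120 - x ^+ 7 / (720 * 7) + x ^+ 9 / (720 * 504)) - sin x.
  apply: (@ge0_is_derive (fun x => (x - x ^+ 3 / 6 + x ^+ 5 / 120 - x ^+ 7 / (720 * 7) + x ^+ 9 / (720 * 504)) - sin x)
    (fun x => (1 - x ^+ 2 / 2 + x ^+ 4 / 24 - x ^+ 6 / 720 + x ^+ 8 / (720 * 56)) - cos x) _ _ c8).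
  - by move=> y; derive_tac; rewrite /=; field.
  - by rewrite sin0; ring.
by move=> u0; split; rewrite -subr_ge0; [exact: s7|exact: s9].
Qed.

Lemma sinc_even (u : R) : sinc (- u) = sinc u.
Proof. by rewrite /sinc sinN invrN mulrNN oppr_eq0. Qed.

(** The expansion behind it is log (sin u / u) = - u^2/6 - u^4/180 - u^6/2835 - ...; the coefficient
    1/2000 exceeds 1/2835 enough to cover the higher terms up to |u| = 2. *)
Lemma sinc_bounds (u : R) : u ^+ 2 <= 4 ->
  expR (- (u ^+ 2 / 6)) * (1 - u ^+ 4 / 180 - u ^+ 6 / 2000) <= sinc u /\
  sinc u <= expR (- (u ^+ 2 / 6)) * (1 - u ^+ 4 / 180).
Proof.
wlog u0 : u / 0 <= u => [h|].
  have [/h//|/ltW u0] := leP 0 u => hu.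
  have := h (- u); rewrite sinc_even sqrrN.
  rewrite (_ : (- u) ^+ 4 = u ^+ 4); last by ring.
  rewrite (_ : (- u) ^+ 6 = u ^+ 6); last by ring.
  by apply=> //; rewrite oppr_ge0.
have [->|un0] := eqVneq u 0.
  have z k : (0 : R) ^+ k.+1 = 0 by rewrite exprS mul0r.
  by rewrite sinc0 !z !mul0r oppr0 expR0 !addr0 mulr1.
have up : 0 < u by rewrite lt_neqAle eq_sym un0.
move=> hu; have [hl hh] := sin_taylor u0.
have v0 : 0 <= u ^+ 2 by exact: sqr_ge0.
have z0 : 0 <= u ^+ 2 / 6 by rewrite divr_ge0.
have [e3 _ e4] := expRN_taylor z0.
rewrite sincE//; set v := u ^+ 2 in hu v0 z0 e3 e4 *.
have -> : u ^+ 4 = v ^+ 2 by rewrite -exprM.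
have -> : u ^+ 6 = v ^+ 3 by rewrite -exprM.
have v3 : 0 <= v ^+ 3 by rewrite exprn_ge0.
split.
  apply: (@le_trans _ _ (1 - v / 6 + v ^+ 2 / 120 - v ^+ 3 / (720 * 7))); last first.
    rewrite ler_pdivlMr//; apply: le_trans hl; rewrite /v le_eqVlt; apply/orP; left; apply/eqP; by field.
  have h1 : 0 <= 1 - v ^+ 2 / 180 - v ^+ 3 / 2000 by nra.
  apply: (le_trans (ler_wpM2r h1 e4)); rewrite -subr_ge0.
  (* In v = u^2 the two polynomials agree up to degree 2; the remaining factor is positive on
     [0, 4]. *)
  rewrite (_ : _ - _ = v ^+ 3 * ((576 * 1002 - 1008 * 149 * v + 24 * 434 * v ^+ 2 - 812 * v ^+ 3 + 63 * v ^+ 4) / (720 * 7 * 720 * 1080))); last by field.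
  apply: mulr_ge0; [exact: v3|]; apply: divr_ge0; last by lra.
  have h2 : 0 <= (4 - v) * v ^+ 2 by rewrite mulr_ge0 ?sqr_ge0// subr_ge0.
  have h3 : 0 <= v ^+ 4 by rewrite exprn_ge0.
  have h4 : 0 <= (4 - v) ^+ 2 by exact: sqr_ge0.
  nra.
apply: (@le_trans _ _ (1 - v / 6 + v ^+ 2 / 120 - v ^+ 3 / (720 * 7) + v ^+ 4 / (720 * 504))).
  rewrite ler_pdivrMr//; apply: (le_trans hh); rewrite /v le_eqVlt; apply/orP; left; apply/eqP; by field.
have h1 : 0 <= 1 - v ^+ 2 / 180 by nra.
apply: le_trans (ler_wpM2r h1 e3); rewrite -subr_ge0.
rewrite (_ : _ - _ = v ^+ 3 * ((1152 - 261 * v + 14 * v ^+ 2) / (720 * 4536))); last by field.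
apply: mulr_ge0; [exact: v3|]; apply: divr_ge0; last by lra.
have h4 : 0 <= (4 - v) ^+ 2 by exact: sqr_ge0.
nra.
Qed.

Lemma bernoulli_ineq n (y : R) : y <= 1 -> 1 - n%:R * y <= (1 - y) ^+ n.
Proof.
move=> y1; elim: n => [|n IH]; first by rewrite mul0r subr0 expr0.
rewrite exprS; apply: le_trans (ler_wpM2l _ IH); last by rewrite subr_ge0.
rewrite -natr1 -subr_ge0 (_ : _ - _ = n%:R * y ^+ 2); last by ring.
by rewrite mulr_ge0 ?sqr_ge0.
Qed.

Lemma ler_pX n (x y : R) : 0 <= x -> x <= y -> x ^+ n <= y ^+ n.
Proof. by move=> x0 xy; rewrite lerXn2r// nnegrE// (le_trans x0). Qed.

(** For |u| <= 2 the bounds of [sinc_bounds] are raised to the power n, by (1 - y)^n <= exp(- n y)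
    <= 1 - n y + (n y)^2 / 2 above and by Bernoulli below. For |u| > 2 both terms are small
    separately. *)
Lemma sincX_approx n (u : R) : (14 <= n)%N ->
  `|sinc u ^+ n - expR (- (n%:R / 6 * u ^+ 2)) * (1 - n%:R * u ^+ 4 / 180)| <=
  expR (- (n%:R / 6 * u ^+ 2)) * ((n%:R * u ^+ 4 / 180) ^+ 2 / 2 + n%:R * u ^+ 6 / 2000) +
  5 / 2 ^+ n / (1 + u ^+ 2).
Proof.
move=> n14; have [m nE] : exists m, n = m.+2 by move: n14; clear; case: n => [|[|m]] // _; exists m.
set E := expR _; set w := n%:R * u ^+ 4 / 180.
have n14' : (14 : R) <= n%:R by rewrite (ler_nat R 14).
have E0 : 0 <= E by exact: expR_ge0.
have D0 : 0 < 1 + u ^+ 2 by rewrite ltr_pwDl// sqr_ge0.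
have T0 : 0 <= 5 / 2 ^+ n / (1 + u ^+ 2) by rewrite !divr_ge0 ?exprn_ge0// ltW.
have u4 : 0 <= u ^+ 4 by rewrite (exprM u 2 2) sqr_ge0.
have u6 : 0 <= u ^+ 6 by rewrite (exprM u 2 3) exprn_ge0 ?sqr_ge0.
have w0 : 0 <= w by rewrite /w divr_ge0//; exact: mulr_ge0 (ler0n _ _) u4.
have EnE : expR (- (u ^+ 2 / 6)) ^+ n = E.
  by rewrite -expRM_natl /E; congr expR; rewrite mulrN; congr (- _); field.
have [u2|u2] := leP (u ^+ 2) 4.
  have [hl hh] := sinc_bounds u2.
  have u4' : u ^+ 4 <= 16 by rewrite (exprM u 2 2); have := sqr_ge0 u; nra.
  have u6' : u ^+ 6 <= 64.
    rewrite (_ : u ^+ 6 = u ^+ 4 * u ^+ 2); last by rewrite -exprD.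
    by have := sqr_ge0 u; nra.
  have y1 : 0 <= 1 - u ^+ 4 / 180 - u ^+ 6 / 2000 by lra.
  have s0 : 0 <= sinc u by apply: le_trans hl; rewrite mulr_ge0 ?expR_ge0.
  have up : sinc u ^+ n <= E * (1 - w + w ^+ 2 / 2).
    apply: (@le_trans _ _ ((expR (- (u ^+ 2 / 6)) * (1 - u ^+ 4 / 180)) ^+ n)).
      exact: ler_pX.
    rewrite exprMn EnE ler_wpM2l//.
    have [_ h _] := expRN_taylor w0; apply: le_trans h.
    rewrite (_ : - w = n%:R * - (u ^+ 4 / 180)); last by rewrite /w; ring.
    rewrite expRM_natl; apply: ler_pX; first by lra.
    exact: expR_ge1Dx.
  have lo : E * (1 - w - n%:R * u ^+ 6 / 2000) <= sinc u ^+ n.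
    apply: (@le_trans _ _ ((expR (- (u ^+ 2 / 6)) * (1 - u ^+ 4 / 180 - u ^+ 6 / 2000)) ^+ n)); last first.
      by apply: ler_pX hl; apply: mulr_ge0 y1; exact: expR_ge0.
    rewrite exprMn EnE ler_wpM2l//.
    rewrite (_ : 1 - w - n%:R * u ^+ 6 / 2000 = 1 - n%:R * (u ^+ 4 / 180 + u ^+ 6 / 2000)); last by rewrite /w; ring.
    rewrite (_ : 1 - u ^+ 4 / 180 - u ^+ 6 / 2000 = 1 - (u ^+ 4 / 180 + u ^+ 6 / 2000)); last by ring.
    by apply: bernoulli_ineq; lra.
  have Ew : 0 <= E * w ^+ 2 by rewrite mulr_ge0 ?sqr_ge0.
  have Eu : 0 <= E * (n%:R * u ^+ 6) by exact: mulr_ge0 E0 (mulr_ge0 (ler0n _ _) u6).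
  rewrite ler_norml; apply/andP; split; lra.
have u0 : u != 0 by apply: contraTneq u2 => ->; rewrite expr0n /= -leNgt.
(* Here u^4 >= 16 and n >= 14. Then |1 - w| = w - 1 <= w^2 / 2, so the Gaussian term disappears into
   the quadratic error. *)
have w1 : 1 <= w.
  have : 16 <= u ^+ 4 by rewrite (exprM u 2 2); nra.
  by rewrite /w => ?; nra.
have h1 : `|E * (1 - w)| <= E * (w ^+ 2 / 2 + n%:R * u ^+ 6 / 2000).
  rewrite normrM ger0_norm// ler_wpM2l// ler0_norm ?subr_le0//.
  have : 0 <= n%:R * u ^+ 6 by exact: mulr_ge0 (ler0n _ _) u6.
  nra.
(* Two of the n factors give 1 / u^2 <= (5/4) / (1 + u^2), and the other n - 2 give 4 / 2^n. *)
have h2 : `|sinc u ^+ n| <= 5 / 2 ^+ n / (1 + u ^+ 2).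
  rewrite normrX; have hu := norm_sinc_le_inv u0.
  have au : 2 <= `|u|.
    rewrite -(ler_pXn2r (_ : 0 < 2)%N) ?nnegrE// real_normK ?num_real//.
    by apply: le_trans (ltW u2); rewrite -natrX ler_nat.
  have ap : 0 < `|u| by apply: lt_le_trans au.
  rewrite nE -addn2 exprD.
  have a1 : `|sinc u| ^+ m <= (1 / 2) ^+ m.
    apply: ler_pX => //; apply: (le_trans hu).
    by rewrite div1r lef_pV2 ?posrE.
  have a2 : `|sinc u| ^+ 2 <= (u ^+ 2)^-1.
    by rewrite -[u ^+ 2]real_normK ?num_real// -exprVn lerXn2r ?nnegrE ?invr_ge0.
  apply: (@le_trans _ _ ((1 / 2) ^+ m * (u ^+ 2)^-1)).
    by apply: ler_pM a1 a2; apply: exprn_ge0.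
  rewrite exprD expr_div_n expr1n -subr_ge0.
  rewrite (_ : _ - _ = (2 ^+ m)^-1 * ((u ^+ 2 - 4) / (4 * u ^+ 2 * (1 + u ^+ 2)))); last first.
    by field; rewrite gt_eqF // u0 expf_neq0.
  rewrite mulr_ge0 ?invr_ge0 ?exprn_ge0// divr_ge0 ?subr_ge0 ?(ltW u2)//.
  by apply: mulr_ge0; [apply: mulr_ge0 => //; exact: sqr_ge0|exact: ltW].
apply: (le_trans (ler_normB _ _)); rewrite addrC.
exact: lerD.
Qed.

End sinc_bounds.

(** * Explicit second-order upper bound for the diagonal sections *)

Section volume_upper_bound.
Context (R : realType).
Local Notation mR := (measurableTypeR R).
Local Notation lambda := (@lebesgue_measure R).

Lemma intbleDZ (f g : R -> R) (c d : R) : intble f -> intble g ->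
  intble (fun u => c * f u + d * g u).
Proof.
move=> hf hg.
exact: (integrableD measurableT (integrableZl measurableT c hf) (integrableZl measurableT d hg)).
Qed.

(** The main terms keep their cosine; in the error terms it is bounded by 1, which leaves plain
    Gaussian moments. *)
Lemma spline_upper k (n x : R) : (14 <= k.+2)%N -> k.+2%:R = n ->
  pi * spline k.+1 x <= gauss_cos (n / 6) 0 (2 * x) - n / 180 * gauss_cos (n / 6) 4 (2 * x) +
    (n ^+ 2 / (180 * 360) * gauss_moment (n / 6) 8 + n / 2000 * gauss_moment (n / 6) 6) +
    5 / 2 ^+ k.+2 * pi.
Proof.
move=> n14 nE; set a := n / 6; set b := 2 * x.
have a0 : 0 < a by rewrite /a -nE divr_gt0// ltr0n.
have := fourier_inversion k x => /(congr1 fine) /= inv.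
rewrite -[X in X <= _]inv -/(Rintegral _ _ _).
pose A u := 1 * (cos (b * u) * gmono a 0 u) + (- (n / 180)) * (cos (b * u) * gmono a 4 u).
pose B u := (n ^+ 2 / (180 * 360)) * gmono a 8 u + (n / 2000) * gmono a 6 u.
pose AB u := 1 * A u + 1 * B u.
pose G u := 1 * AB u + (5 / 2 ^+ k.+2) * (1 + u ^+ 2)^-1.
have iA : intble A by apply: intbleDZ; exact: intble_gcos.
have iB : intble B by apply: intbleDZ; exact: intble_gmono.
have iAB : intble AB by exact: intbleDZ.
have iD := @intble_inv1sqr R.
have iG : intble G by exact: intbleDZ.
apply: (@le_trans _ _ (\int[lambda]_u G u)).
  apply: le_Rintegral => //; first exact: intble_fourier_integrand.
  move=> u _; change (fourier_integrand k.+2 x u <= G u); have := sincX_approx u n14; rewrite nE -/a.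
  set E := expR _; set D := _ - _ => hD.
  have hc := cos_max (2 * x * u).
  have -> : fourier_integrand k.+2 x u = cos (b * u) * (E * (1 - n * u ^+ 4 / 180)) + D * cos (2 * x * u).
    by rewrite /fourier_integrand /D /b; ring.
  have h1 : D * cos (2 * x * u) <= `|D|.
    by apply: (le_trans (ler_norm _)); rewrite normrM ler_piMr.
  have -> : G u = cos (b * u) * (E * (1 - n * u ^+ 4 / 180)) +
      (E * ((n * u ^+ 4 / 180) ^+ 2 / 2 + n * u ^+ 6 / 2000) + 5 / 2 ^+ k.+2 / (1 + u ^+ 2)).
    rewrite /G /AB /A /B /gmono -/E; field.
    by rewrite expf_neq0//= gt_eqF// ltr_pwDl// sqr_ge0.
  by rewrite lerD2l; apply: le_trans h1 hD.
rewrite (RintegralDZ _ _ iAB iD) (RintegralDZ _ _ iA iB).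
rewrite (RintegralDZ _ _ (intble_gcos a0 b 0) (intble_gcos a0 b 4)).
rewrite (RintegralDZ _ _ (intble_gmono a0 8) (intble_gmono a0 6)).
by rewrite Rintegral_inv1sqr !mul1r mulNr lexx.
Qed.

(** The polynomial is the Hermite polynomial x^4 - 6 x^2 + 3 at x^2 = 12 t^2, as in an Edgeworth
    expansion. With a = n / 6, the eighth and sixth moments contribute 21/160 and 81/400 to the
    coefficient of 1 / n^2, whose sum is 267/800. *)
Theorem volume_upper k (n t : R) : (14 <= k.+2)%N -> k.+2%:R = n ->
  Num.sqrt n * spline k.+1 (Num.sqrt n * t) <=
  Num.sqrt (6 / pi) * (expR (- (6 * t ^+ 2)) * (1 - (3 - 72 * t ^+ 2 + 144 * t ^+ 4) / (20 * n)) +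
    267 / 800 / n ^+ 2) + 5 * Num.sqrt n / 2 ^+ k.+2.
Proof.
move=> n14 nE; set q := Num.sqrt n.
have n0 : 0 < n by rewrite -nE ltr0n.
have q0 : 0 < q by rewrite sqrtr_gt0.
have q2 : q ^+ 2 = n by rewrite sqr_sqrtr ?ltW.
have a0 : 0 < n / 6 by rewrite divr_gt0.
have := spline_upper (q * t) n14 nE.
rewrite (gauss_cos4 a0) !(gauss_momentSS a0) !(gauss_cos0E a0) (gauss_moment0 a0).
have p0 := pi_gt0 R.
pose M := Num.sqrt (pi / (n / 6)).
have ME : M = pi * Num.sqrt (6 / pi) / q.
  have E0 (p : R) : 0 < p -> p / (n / 6) = (p / q) ^+ 2 * (6 / p).
    by move=> pp; rewrite -q2; field; rewrite (gt_eqF pp) (gt_eqF q0).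
  rewrite /M (E0 _ p0).
  rewrite sqrtrM ?sqr_ge0// sqrtr_sqr gtr0_norm ?divr_gt0//; ring.
rewrite -/M ME => h.
rewrite -(ler_pM2l p0) mulrCA; apply: (le_trans (ler_wpM2l (ltW q0) h)).
have -> : (2 * (q * t)) ^+ 2 / (4 * (n / 6)) = 6 * t ^+ 2.
  by rewrite -q2; field; rewrite gt_eqF.
rewrite le_eqVlt; apply/orP; left; apply/eqP.
have q4 : q ^+ 4 = n ^+ 2 by rewrite (exprM q 2 2) q2.
set P := Num.sqrt (6 / pi); set E := expR _.
rewrite -q2; field.
by rewrite expf_neq0//= gt_eqF.
Qed.

End volume_upper_bound.

(** * Exact evaluation for small faces *)

Section rational_evaluation.
Context (R : realType).

Local Notation Z := BinNums.Z.
Local Notation zp x := (BinNums.Zpos x%positive).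
Local Notation "x *z y" := (BinInt.Z.mul x y) (at level 40, left associativity).
Local Notation "x -z y" := (BinInt.Z.sub x y) (at level 50, left associativity).

(** Numerator of the i-th term of [spline n.-1] at p / q, over the common denominator (2 q)^(n - 1):
    [y] is 2 q times the argument of [tpow]. *)
Definition zterm (n i : nat) (p q : Z) : Z :=
  let y := BinInt.Z.of_nat n *z q -z zp 2 *z p -z zp 2 *z BinInt.Z.of_nat i *z q in
  if BinInt.Z.leb BinNums.Z0 y then
    (if odd i then BinNums.Zneg 1 else zp 1) *z BinInt.Z.of_nat 'C(n, i) *z
    BinInt.Z.pow y (BinInt.Z.of_nat n.-1)
  else BinNums.Z0.

Fixpoint zsum (n k : nat) (p q : Z) : Z :=
  if k is k'.+1 then BinInt.Z.add (zsum n k' p q) (zterm n k' p q) else BinNums.Z0.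

Fixpoint zfact (m : nat) : Z :=
  if m is m'.+1 then BinInt.Z.of_nat m *z zfact m' else zp 1.

(* Locked, so that no unification problem converts a large numeral to unary. *)
Definition zr : Z -> R := locked (fun z => (int_of_Z z)%:~R).

Lemma zrE z : zr z = (int_of_Z z)%:~R.
Proof. by rewrite /zr -lock. Qed.

Lemma zrD x y : zr (BinInt.Z.add x y) = zr x + zr y.
Proof. by rewrite !zrE (raddfD int_of_Z) intrD. Qed.

Lemma zrM x y : zr (BinInt.Z.mul x y) = zr x * zr y.
Proof. by rewrite !zrE (rmorphM int_of_Z) intrM. Qed.

Lemma zrN x : zr (BinInt.Z.opp x) = - zr x.
Proof. by rewrite !zrE (raddfN int_of_Z) intrN. Qed.

Lemma zrB x y : zr (BinInt.Z.sub x y) = zr x - zr y.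
Proof. by rewrite -zrN -zrD. Qed.

Lemma zr_nat n : zr (BinInt.Z.of_nat n) = n%:R.
Proof.
by rewrite !zrE -[BinInt.Z.of_nat n]/(Z_of_int (Posz n)) Z_of_intK -pmulrn.
Qed.

Lemma zr2 : zr (zp 2) = 2.
Proof. by rewrite zrE. Qed.

Lemma zr0 : zr BinNums.Z0 = 0.
Proof. by rewrite zrE. Qed.

Lemma zrN1 : zr (BinNums.Zneg 1) = -1.
Proof. by rewrite zrE. Qed.

Lemma zr1 : zr (zp 1) = 1.
Proof. by rewrite zrE. Qed.

Lemma zrX y n : zr (BinInt.Z.pow y (BinInt.Z.of_nat n)) = zr y ^+ n.
Proof.
elim: n => [|n IH]; first by rewrite expr0 -zr1.
rewrite Znat.Nat2Z.inj_succ BinInt.Z.pow_succ_r; last exact: Znat.Nat2Z.is_nonneg.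
by rewrite zrM IH exprS.
Qed.

Lemma zr_fact m : zr (zfact m) = m`!%:R.
Proof.
elim: m => [|m IH]; first by rewrite zr1.
by rewrite /zfact -/zfact zrM zr_nat IH -natrM -factS.
Qed.

Lemma zr_gt0 x : BinInt.Z.ltb BinNums.Z0 x -> 0 < zr x.
Proof. by case: x => // p _; rewrite !zrE /= ltr0z ltz_nat; lia. Qed.

Lemma zr_lt x y : BinInt.Z.ltb x y -> zr x < zr y.
Proof.
move=> /BinInt.Z.ltb_lt xy; rewrite -subr_gt0 -zrB zr_gt0//.
by apply/BinInt.Z.ltb_lt/BinInt.Z.lt_0_sub.
Qed.

Lemma zr_le x y : BinInt.Z.leb x y -> zr x <= zr y.
Proof.
move=> /BinInt.Z.leb_le/BinInt.Z.lt_eq_cases[/BinInt.Z.ltb_lt xy|-> //].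
exact/ltW/zr_lt.
Qed.

Lemma spline_ge0 m (x : R) : (0 < m)%N -> 0 <= spline m x.
Proof. by case: m => // m _; exact: (box_density_ge0 m.+1 x). Qed.

Lemma spline_zsum m (p q : Z) : (0 < m)%N -> BinInt.Z.ltb BinNums.Z0 q ->
  spline m (zr p / zr q) = zr (zsum m.+1 m.+2 p q) / ((2 * zr q) ^+ m * m`!%:R).
Proof.
move=> m0 q0; have zq := zr_gt0 q0; have zqn : zr q != 0 by rewrite gt_eqF.
rewrite /spline invfM mulrA; congr (_ / _).
have E k : \sum_(i < k) (-1 : R) ^+ i * 'C(m.+1, i)%:R * tpow m (m.+1%:R / 2 - zr p / zr q - i%:R) =
    zr (zsum m.+1 k p q) / (2 * zr q) ^+ m.
  elim: k => [|k IH]; first by rewrite big_ord0 /= zr0 mul0r.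
  rewrite big_ord_recr /= IH zrD; rewrite [in RHS]mulrDl; congr (_ + _).
  rewrite /zterm; set y := BinInt.Z.sub _ _.
  have yE : (m.+1%:R : R) / 2 - zr p / zr q - k%:R = zr y / (2 * zr q).
    rewrite /y !zrB !zrM !zr_nat; rewrite zr2; field.
    exact: zqn.
  rewrite yE; have [y0|y0] := boolP (BinInt.Z.leb BinNums.Z0 y).
    have zy : 0 <= zr y by rewrite -zr0; exact: zr_le.
    have dy : 0 <= zr y / (2 * zr q) by rewrite divr_ge0// mulr_ge0// ltW.
    rewrite /tpow max_r//.
    rewrite expr_div_n zrM zrM zr_nat zrX mulrA; congr (_ * _ * _ / _).
    by rewrite -signr_odd; case: (odd k); rewrite ?zrN1 ?zr1 ?expr1 ?expr0.
  have zy : zr y <= 0.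
    by rewrite -zr0; apply: zr_le; apply/BinInt.Z.leb_le/BinInt.Z.lt_le_incl/BinInt.Z.leb_gt/negbTE.
  rewrite /tpow max_l; last by rewrite pmulr_lle0// invr_gt0 mulr_gt0.
  by rewrite expr0n (gtn_eqF m0) mulr0 zr0 mul0r.
exact: E.
Qed.

(* [a / 10 ^ 5] and [b / 10 ^ 5] bracket [sqrt (m + 1)] from above and below;
   [T / 10 ^ 6] is an abscissa and [l / 10 ^ 4] the bound to be beaten. *)
Definition vcheck (m : nat) (a b T l : Z) : bool :=
  [&& BinInt.Z.leb BinNums.Z0 a, BinInt.Z.leb BinNums.Z0 b, BinInt.Z.leb BinNums.Z0 T,
      BinInt.Z.leb (BinInt.Z.of_nat m.+1 *z zp 10000000000) (a *z a),
      BinInt.Z.leb (b *z b) (BinInt.Z.of_nat m.+1 *z zp 10000000000) &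
      BinInt.Z.ltb (a *z zsum m.+1 m.+2 (b *z T) (zp 100000000000) *z zp 10000)
        (l *z (zp 100000 *z (BinInt.Z.pow (zp 2 *z zp 100000000000) (BinInt.Z.of_nat m) *z zfact m)))].

Lemma zp_mul : zp 100000000000 = zp 100000 *z zp 1000000.
Proof. by vm_compute. Qed.

(** The spline decreases on the half-line, so the value at the rational point b T / 10^11, which is
    at most sqrt (m + 1) t, bounds it from above. The factor in front is bounded by a / 10^5. *)
Lemma vcheckP m a b T l (t : R) : (0 < m)%N -> vcheck m a b T l ->
  zr T / zr (zp 1000000) <= t ->
  Num.sqrt m.+1%:R * spline m (Num.sqrt m.+1%:R * t) < zr l / zr (zp 10000).
Proof.
move=> m0 /and5P[a0 b0 T0 ha /andP[hb hc]] Tt.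
set q := Num.sqrt _; have q0 : 0 <= q by exact: sqrtr_ge0.
have q2 : q ^+ 2 = m.+1%:R by rewrite sqr_sqrtr.
have za : 0 <= zr a by rewrite -zr0; exact: zr_le.
have zb : 0 <= zr b by rewrite -zr0; exact: zr_le.
have zT : 0 <= zr T by rewrite -zr0; exact: zr_le.
have k0 : 0 < zr (zp 100000) by exact: zr_gt0.
have M0 : 0 < zr (zp 1000000) by exact: zr_gt0.
have ME : zr (zp 10000000000) = zr (zp 100000) ^+ 2.
  by rewrite expr2 -zrM; congr zr; vm_compute.
have aK : 0 <= zr a / zr (zp 100000) by rewrite divr_ge0// ltW.
have bK : 0 <= zr b / zr (zp 100000) by rewrite divr_ge0// ltW.
have TK : 0 <= zr T / zr (zp 1000000) by rewrite divr_ge0// ltW.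
have Ha := zr_le ha; rewrite !zrM (zr_nat m.+1) ME in Ha.
have Hb := zr_le hb; rewrite !zrM (zr_nat m.+1) ME in Hb.
have qa : q <= zr a / zr (zp 100000).
  rewrite -(ler_pXn2r (isT : (0 < 2)%N)) ?nnegrE// expr_div_n q2.
  by rewrite ler_pdivlMr ?exprn_gt0// [_ a ^+ 2]expr2.
have qb : zr b / zr (zp 100000) <= q.
  rewrite -(ler_pXn2r (isT : (0 < 2)%N)) ?nnegrE// expr_div_n q2.
  by rewrite ler_pdivrMr ?exprn_gt0// [_ b ^+ 2]expr2.
have E9 : zr (zp 100000000000) = zr (zp 100000) * zr (zp 1000000) by rewrite -zrM; congr zr; exact: zp_mul.
pose x := zr (b *z T) / zr (zp 100000000000).
have xE : x = zr b / zr (zp 100000) * (zr T / zr (zp 1000000)).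
  rewrite /x zrM E9; move: (zr (zp 100000)) (zr (zp 1000000)) k0 M0 => K M k0 M0.
  by field; rewrite !gt_eqF.
have x0 : 0 <= x by rewrite xE mulr_ge0.
have xt : x <= q * t by rewrite xE; exact: ler_pM.
have s0 : 0 <= spline m x.
  exact: spline_ge0.
apply: (@le_lt_trans _ _ (zr a / zr (zp 100000) * spline m x)).
  apply: ler_pM => //.
    exact: spline_ge0.
  exact: spline_nonincreasing.
rewrite /x spline_zsum//.
have f0 : 0 < zr (zp 100000000000) by exact: zr_gt0.
have f4 : 0 < zr (zp 10000) by exact: zr_gt0.
have D0 : 0 < (2 * zr (zp 100000000000)) ^+ m * m`!%:R.
  by rewrite mulr_gt0 ?exprn_gt0 ?mulr_gt0// ltr0n fact_gt0.
have := zr_lt hc; rewrite !zrM zrX !zrM zr2 zr_fact.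
move: (_ ^+ m * _) D0 (zr (zsum _ _ _ _)) => D D0 S.
move: (zr (zp 100000)) k0 (zr (zp 10000)) f4 (zr a) (zr l) => K K0 F F0 A L h.
rewrite ltr_pdivlMr// (_ : _ * F = A * S * F / (K * D)); last by field; rewrite !gt_eqF.
by rewrite ltr_pdivrMr ?mulr_gt0.
Qed.

(** The entry of index i brackets sqrt (i + 3), so the list covers faces of dimension 3 to 15. *)
Definition sqrt_brackets : seq (Z * Z) :=
  [:: (zp 173206, zp 173205); (zp 200000, zp 200000); (zp 223607, zp 223606);
      (zp 244949, zp 244948); (zp 264576, zp 264575); (zp 282843, zp 282842);
      (zp 300000, zp 300000); (zp 316228, zp 316227); (zp 331663, zp 331662);
      (zp 346411, zp 346410); (zp 360556, zp 360555); (zp 374166, zp 374165);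
      (zp 387299, zp 387298)].

(* Each [l] is at most the corner volume at the right end of the interval starting at
   its abscissa; that end is 182 / 10 ^ 4 for the first one and 1 / 2 for the last. *)
Lemma vcheck_all : all (fun i : nat =>
    let ab := nth (BinNums.Z0, BinNums.Z0) sqrt_brackets i in
    [&& vcheck i.+2 ab.1 ab.2 BinNums.Z0 (zp 13700), vcheck i.+2 ab.1 ab.2 (zp 165625) (zp 11682),
        vcheck i.+2 ab.1 ab.2 (zp 169480) (zp 11595), vcheck i.+2 ab.1 ab.2 (zp 178080) (zp 11396),
        vcheck i.+2 ab.1 ab.2 (zp 198880) (zp 10941) & vcheck i.+2 ab.1 ab.2 (zp 254110) (zp 10000)])
  (iota 0 13).
Proof. by vm_compute. Qed.

End rational_evaluation.

(** * Comparison with the section through a vertex *)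

Section corner_bounds.
Context (R : realType).
Implicit Types (t l : R).

Local Notation cden t := (2 * t + Num.sqrt (2 - 4 * t ^+ 2)).

Lemma cden_sqrt t : 0 <= t -> t < 1 / 2 ->
  0 < Num.sqrt (2 - 4 * t ^+ 2) /\ Num.sqrt (2 - 4 * t ^+ 2) ^+ 2 = 2 - 4 * t ^+ 2.
Proof.
move=> t0 t1; have h : 0 < 2 - 4 * t ^+ 2 by nra.
by rewrite sqrtr_gt0 h sqr_sqrtr ?ltW.
Qed.

Lemma corner_gt1 t : 0 <= t -> t < 1 / 2 -> 1 < corner_volume t.
Proof.
move=> t0 t1; rewrite corner_volumeE//; have [s0 s2] := cden_sqrt t0 t1.
by rewrite ltr_pdivlMr ?mul1r; nra.
Qed.

(** Squaring l sqrt (2 - 4 t^2) <= 2 - 2 l t gives the last hypothesis with [t] in place of [tau].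
    That quadratic in l t decreases as long as 2 l t <= 1, so checking it at [tau] is enough. *)
Lemma corner_ge l tau t : 0 <= t -> t <= tau -> t < 1 / 2 -> 0 < l -> 2 * l * tau <= 1 ->
  0 <= 8 * (l * tau) ^+ 2 - 8 * (l * tau) + 4 - 2 * l ^+ 2 -> l <= corner_volume t.
Proof.
move=> t0 tt t1 l0 h1 h2; rewrite corner_volumeE//; have [s0 s2] := cden_sqrt t0 t1.
set s := Num.sqrt _ in s0 s2 *.
rewrite ler_pdivlMr; last by nra.
have lt : l * t <= l * tau by rewrite ler_pM2l.
have lt0 : 0 <= l * t by rewrite mulr_ge0// ltW.
have h3 : (l * s) ^+ 2 <= (2 - 2 * (l * t)) ^+ 2.
  rewrite exprMn s2; have : 0 <= (l * tau - l * t) * (1 - (l * t + l * tau)) by apply: mulr_ge0; lra.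
  by nra.
have : l * s <= 2 - 2 * (l * t).
  rewrite -(ler_pXn2r (isT : (0 < 2)%N)) ?nnegrE//; first by rewrite mulr_ge0// ltW.
  by lra.
by lra.
Qed.

Definition gauss_volume (t : R) := Num.sqrt (6 / pi) * expR (- (6 * t ^+ 2)).

Lemma beta_equationE b : beta_equation b <-> corner_volume b = gauss_volume b.
Proof. by []. Qed.

Lemma gauss_volume_shift b t :
  gauss_volume t = gauss_volume b * expR (6 * (b ^+ 2 - t ^+ 2)).
Proof. by rewrite /gauss_volume -mulrA -expRD; congr (_ * expR _); ring. Qed.

Lemma gauss_volume_ge0 t : 0 <= gauss_volume t.
Proof. by rewrite mulr_ge0 ?sqrtr_ge0 ?expR_ge0. Qed.

Lemma cden_le b t : 0 <= b -> b <= t -> t < 1 / 2 -> cden t <= cden b + 2 * (t - b).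
Proof.
move=> b0 bt t1; have : Num.sqrt (2 - 4 * t ^+ 2) <= Num.sqrt (2 - 4 * b ^+ 2).
  by rewrite ler_wsqrtr//; nra.
lra.
Qed.

(* Compares [1 / corner_volume], whose slope is at most 1, with the exponential
   decay of [gauss_volume]. *)
Lemma gauss_volume_le_right b t : 1656 / 10 ^+ 4 <= b -> b <= t -> t < 1 / 2 ->
  corner_volume b = gauss_volume b ->
  (1 + 198 / 100 * (t - b)) * gauss_volume t <= (1 + 118 / 100 * (t - b)) * corner_volume t.
Proof.
move=> hb bt t1 E; rewrite (gauss_volume_shift b) -E.
have b0 : 0 <= b by lra.
have t0 : 0 <= t by lra.
have b1 : b < 1 / 2 by lra.
rewrite !corner_volumeE//.
have [sb0 sb2] := cden_sqrt b0 b1; have [st0 st2] := cden_sqrt t0 t1.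
have hD := cden_le b0 bt t1.
have Db : 170 / 100 <= cden b by nra.
set D := cden b in hD Db *; set D' := cden t in hD *.
have D'0 : 0 < D' by rewrite /D'; lra.
have D0 : 0 < D by lra.
set y := 6 * _; pose z := - y.
(* The exponent is 6 (t - b)(t + b), and 6 * 2 * 0.1656 > 1.98. *)
have z0 : 198 / 100 * (t - b) <= z by rewrite /z /y; nra.
have e1 : expR y * (1 + z) <= 1.
  rewrite -[leRHS](mulrV (unitf_gt0 (expR_gt0 z))) /z expRN invrK mulrC.
  by rewrite ler_wpM2r ?expR_ge0// -expRN expR_ge1Dx.
have e0 := expR_gt0 y.
have e2 : expR y * (1 + 198 / 100 * (t - b)) <= 1.
  by apply: le_trans e1; rewrite ler_pM2l//; lra.
(* The denominator grows by at most 2 (t - b) from a value at least 1.70, and 2 / 1.70 < 1.18. *)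
have r1 : 2 / D <= (1 + 118 / 100 * (t - b)) * (2 / D').
  rewrite mulrA ler_pdivrMr// mulrAC ler_pdivlMr//.
  have : 0 <= (t - b) * (D - 170 / 100) by apply: mulr_ge0; lra.
  nra.
apply: le_trans r1; rewrite mulrCA ler_piMr//; first by rewrite divr_ge0// ltW.
by rewrite mulrC.
Qed.

(** Going left from the crossing point, [gauss_volume] has logarithmic growth rate at most 6 * 2 *
    0.0182 < 0.22, while the denominator of [corner_volume] shrinks at a larger relative rate. *)
Lemma gauss_volume_le_left b t : 0 <= t -> t <= b -> b <= 182 / 10 ^+ 4 ->
  corner_volume b = gauss_volume b -> gauss_volume t <= corner_volume t.
Proof.
move=> t0 tb hb E; rewrite (gauss_volume_shift b) -E.
have b0 : 0 <= b by lra.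
have b1 : b < 1 / 2 by lra.
have t1 : t < 1 / 2 by lra.
rewrite !corner_volumeE//.
have [sb0 sb2] := cden_sqrt b0 b1; have [st0 st2] := cden_sqrt t0 t1.
set sb := Num.sqrt (2 - 4 * b ^+ 2) in sb0 sb2 *; set st := Num.sqrt _ in st0 st2 *.
have sb1 : 141 / 100 <= sb by nra.
have sb3 : sb <= 142 / 100 by nra.
have st1 : sb <= st by nra.
have sd : st - sb <= 6 / 100 * (b - t) by nra.
set y := 6 * _.
have y1 : y <= 22 / 100 * (b - t) by rewrite /y; nra.
have e1 : expR y * (1 - y) <= 1.
  rewrite -[leRHS](mulrV (unitf_gt0 (expR_gt0 (- y)))) expRN invrK mulrC.
  by rewrite ler_wpM2r ?expR_ge0// -expRN expR_ge1Dx.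
have e0 := expR_gt0 y.
have e2 : expR y * (1 - 22 / 100 * (b - t)) <= 1.
  by apply: le_trans e1; rewrite ler_pM2l//; lra.
have d0 : 0 < 2 * b + sb by lra.
have d1 : 0 < 2 * t + st by lra.
have hD : 2 * t + st <= (1 - 22 / 100 * (b - t)) * (2 * b + sb) by nra.
rewrite -mulrA ler_pM2l// ler_pdivrMl// ler_pdivlMr//.
apply: (le_trans (ler_wpM2l (ltW e0) hD)); rewrite mulrA.
by rewrite ler_piMl// ltW.
Qed.

End corner_bounds.

(** * Comparison for faces of dimension at least 16 *)

Section volume_comparison.
Context (R : realType).
Implicit Types (t : R).

Local Notation zp x := (BinNums.Zpos x%positive).

Lemma zr_xO p : zr R (BinNums.Zpos (BinNums.xO p)) = 2 * zr R (BinNums.Zpos p).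
Proof. by rewrite -zr2 -zrM. Qed.

Lemma zr_xI p : zr R (BinNums.Zpos (BinNums.xI p)) = 2 * zr R (BinNums.Zpos p) + 1.
Proof. by rewrite -zr2 -zrM -(zr1 R) -zrD. Qed.

(** Expands a binary integer digit by digit into real arithmetic that [lra] can evaluate. *)
Definition zr_digits := (zr_xO, zr_xI, zr1).

(** At n = 16 this reads 512000 <= 524288, and at n = 15 it fails: this fixes the border between the
    asymptotic regime and the finite check. *)
Lemma cube_le_exp n : (16 <= n)%N -> 125 * n%:R ^+ 3 <= 8 * 2 ^+ n :> R.
Proof.
move=> n16; rewrite -(subnKC n16); elim: (n - 16)%N => [|j IH]; first by rewrite addn0; lra.
rewrite addnS (exprS 2) -(@natr1 R (16 + j)); have : 16 <= (16 + j)%:R :> R by rewrite ler_nat leq_addr.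
move: (2 ^+ _) ((16 + j)%:R) IH => p x IH x16; suff : (x + 1) ^+ 3 <= 2 * x ^+ 3 by lra.
have : 0 <= x * x * (x - 16) by rewrite !mulr_ge0//; lra.
have : 0 <= x * (x - 16) by rewrite !mulr_ge0//; lra.
lra.
Qed.

Lemma volume_large k (b t : R) : (16 <= k.+2)%N -> beta_equation b ->
  181 / 10 ^+ 4 < b -> b < 182 / 10 ^+ 4 ->
  exists2 w : R, 0 < w <= 1 / 16 &
  Num.sqrt k.+2%:R * spline k.+1 (Num.sqrt k.+2%:R * t) <=
  gauss_volume t * (1 - (3 - 72 * t ^+ 2 + 144 * t ^+ 4) / 20 * w) + 345 / 10 ^+ 4 * w.
Proof.
move=> n16 hb b1 b2; set N : R := k.+2%:R.
have N16 : 16 <= N by rewrite (ler_nat R 16).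
have N0 : 0 < N by lra.
have w1 : N^-1 <= 1 / 16 by rewrite div1r lef_pV2 ?posrE.
have w0 : 0 < N^-1 by rewrite invr_gt0.
exists N^-1; first by rewrite w0.
have := @volume_upper R k N t (leq_trans (isT : (14 <= 16)%N) n16) erefl; rewrite -/N.
set P := Num.sqrt (6 / pi); set e := expR _; set He := 3 - _ + _.
have P0 : 0 <= P by exact: sqrtr_ge0.
(* This numerical bound is drawn from the equation at [b] rather than from an estimate of pi: the
   corner volume is at most 1.38 there, and exp(- 6 b^2) >= 1 - 6 b^2. *)
have P1 : P <= 139 / 100.
  have bh : b < 1 / 2 by lra.
  have b0 : 0 <= b by lra.
  have [s0 s2] := cden_sqrt b0 bh.
  have h1 : corner_volume b <= 138 / 100.
    rewrite corner_volumeE// ler_pdivrMr; last by lra.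
    by set s := Num.sqrt _ in s0 s2 *; nra.
  move/beta_equationE : hb; rewrite /gauss_volume -/P => E.
  have h2 : P * (1 - 6 * b ^+ 2) <= corner_volume b.
    by rewrite E ler_wpM2l// expR_ge1Dx.
  have h3 : b ^+ 2 <= 4 / 10 ^+ 4 by nra.
  have : 0 <= P * (4 / 10 ^+ 4 - b ^+ 2) by rewrite mulr_ge0//; lra.
  lra.
have tail : 5 * Num.sqrt N / 2 ^+ k.+2 <= 8 / 100 * N^-1 ^+ 2.
  have q : Num.sqrt N <= N / 4.
    have E : Num.sqrt N ^+ 2 = N by rewrite sqr_sqrtr// ltW.
    have := sqrtr_ge0 N; rewrite -[X in _ <= X / 4]E; rewrite -E in N16.
    move: (Num.sqrt N) N16 => s N16 s0; have : 4 <= s by nra.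
    nra.
  have h : (125 : R) * N ^+ 3 <= 8 * 2 ^+ k.+2.
    exact: cube_le_exp.
  have p0 : 0 < 2 ^+ k.+2 :> R by rewrite exprn_gt0.
  rewrite ler_pdivrMr// mulrAC exprVn ler_pdivlMr ?exprn_gt0//.
  have : Num.sqrt N * N ^+ 2 <= N / 4 * N ^+ 2 by rewrite ler_wpM2r// exprn_ge0// ltW.
  lra.
move=> h; apply: (le_trans h); rewrite /gauss_volume -/P -/e.
have -> : P * (e * (1 - He / (20 * N)) + 267 / 800 / N ^+ 2) =
    P * e * (1 - He / 20 * N^-1) + P * (267 / 800) * N^-1 ^+ 2 by field; lra.
rewrite -addrA lerD2l.
move: (N^-1) w0 w1 tail => w w0 w1 tail.
(* One factor [w] is traded for 1/16: (1.39 * 267/800 + 0.08) / 16 < 0.0345. *)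
have w2 : w ^+ 2 <= 1 / 16 * w by rewrite expr2 ler_wpM2r// ltW.
have : P * (267 / 800) * w ^+ 2 <= 139 / 100 * (267 / 800) * w ^+ 2.
  by rewrite ler_wpM2r ?sqr_ge0//; lra.
lra.
Qed.

Lemma volume_large_lt k (bm bp t : R) : (16 <= k.+2)%N ->
  beta_equation bm -> 181 / 10 ^+ 4 < bm -> bm < 182 / 10 ^+ 4 ->
  beta_equation bp -> 1656 / 10 ^+ 4 < bp -> bp < 1657 / 10 ^+ 4 ->
  0 < t -> t < 1 / 2 -> t <= bm \/ bp < t ->
  Num.sqrt k.+2%:R * spline k.+1 (Num.sqrt k.+2%:R * t) < corner_volume t.
Proof.
move=> n16 hbm bm1 bm2 hbp bp1 bp2 t0 t1 ht.
have [w /andP[w0 w1] V] := volume_large t n16 hbm bm1 bm2.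
apply: (le_lt_trans V); set He := 3 - _ + _; set g := gauss_volume t.
have g0 : 0 <= g by exact: gauss_volume_ge0.
have L1 := corner_gt1 (ltW t0) t1; set L := corner_volume t in L1 *.
have HeE : He = (12 * t ^+ 2 - 3) ^+ 2 - 6 by rewrite /He; ring.
clearbody He.
case: ht => [tb|bt].
  (* Left of the first crossing there may be no gap between g and L; the correction gains (2.9 / 20)
     w, against an error of 0.0345 w, and L > 1. *)
  have gL : g <= L by apply: (@gauss_volume_le_left _ bm) => //; lra.
  have t2 : t <= 2 / 100 by lra.
  clear hbm hbp V n16 bm1 bm2 bp1 bp2 tb; clearbody g L.
  have He1 : 29 / 10 <= He.
    have : t ^+ 2 <= 1 / 1000 by nra.
    by have := sqr_ge0 t; rewrite HeE; nra.
  have : 0 <= g * w * (He - 29 / 10) by rewrite !mulr_ge0//; lra.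
  have : 0 <= (L - g) * (1 - 29 / 200 * w) by apply: mulr_ge0; lra.
  have : 0 < (L - 1) * w by apply: mulr_gt0; lra.
  lra.
have bp0 : 1656 / 10 ^+ 4 <= bp by lra.
have gR := gauss_volume_le_right bp0 (ltW bt) t1 hbp.
rewrite -/g -/L in gR.
clear hbm hbp V n16; clearbody g L.
have [d dE] : exists d, d = t - bp by exists (t - bp).
rewrite -dE in gR; have d0 : 0 < d by rewrite dE; lra.
have d17 : t - 1657 / 10 ^+ 4 < d by rewrite dE; lra.
clear bm1 bm2 bp1 bp2 bp0 bt dE.
have gL : g <= L by nra.
have v0 := sqr_ge0 t.
(* Just after the second crossing the gap may again be negligible: the correction still gains (1.03
   / 20) w = 0.0515 w. *)
have [t2|t2] := leP t (17 / 100).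
  have He1 : 103 / 100 <= He.
    have : t ^+ 2 <= 289 / 10 ^+ 4 by nra.
    by rewrite HeE; nra.
  have : 0 <= g * w * (He - 103 / 100) by rewrite !mulr_ge0//; lra.
  have : 0 <= (L - g) * (1 - 103 / 2000 * w) by apply: mulr_ge0; lra.
  have : 0 < (L - 1) * w by apply: mulr_gt0; lra.
  lra.
(* In this middle range only [0 <= He] is used, but t is 0.0043 past the crossing: the relative gap
   0.0034 exceeds the error 0.0345 / 16. *)
have [t3|t3] := leP t (20 / 100).
  have He1 : 0 <= He.
    have : t ^+ 2 <= 4 / 100 by nra.
    by rewrite HeE; nra.
  have d1 : 43 / 10 ^+ 4 <= d by lra.
  have : g <= (1 - 34 / 10 ^+ 4) * L by nra.
  have : 0 <= g * w * He by rewrite !mulr_ge0//; lra.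
  have : 0 <= (1 / 16 - w) by lra.
  lra.
(* Now [He] may be negative, down to -6 at worst. The loss 6 / (20 * 16) plus 0.0345 / 16 is about
   0.021, below the relative gap, which is about 0.0255. *)
have d1 : 343 / 10 ^+ 4 <= d by lra.
have g1 : g * (10 ^+ 4 + 262) <= 10 ^+ 4 * L by nra.
have He1 : -6 <= He by rewrite HeE; have := sqr_ge0 (12 * t ^+ 2 - 3); lra.
have : 0 <= g * w * (He + 6) by rewrite !mulr_ge0//; lra.
have : 0 <= g * (1 / 16 - w) by rewrite mulr_ge0//; lra.
lra.
Qed.

End volume_comparison.

Section small_dimensions.
Context (R : realType).
Implicit Types (t : R).

Local Notation zp x := (BinNums.Zpos x%positive).

Lemma volume_small m t : (m < 13)%N -> 0 < t -> t < 1 / 2 ->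
  t <= 182 / 10 ^+ 4 \/ zr R (zp 165625) / zr R (zp 1000000) < t ->
  Num.sqrt m.+3%:R * spline m.+2 (Num.sqrt m.+3%:R * t) < corner_volume t.
Proof.
move=> m13 t0 t1 ht; have tg0 := ltW t0.
have /allP/(_ m) := vcheck_all; rewrite mem_iota => /(_ m13) /=.
set a := (_.1); set b := (_.2) => /and5P[c1 c2 c3 c4 /andP[c5 c6]].
have E4 : zr R (zp 10000) = 10 ^+ 4 by rewrite !zr_digits; ring.
have E6 : zr R (zp 1000000) = 10 ^+ 6 by rewrite !zr_digits; ring.
have step T l tau : vcheck m.+2 a b T l -> zr R T / zr R (zp 1000000) <= t -> t <= tau ->
    0 < zr R l / zr R (zp 10000) -> 2 * (zr R l / zr R (zp 10000)) * tau <= 1 ->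
    0 <= 8 * (zr R l / zr R (zp 10000) * tau) ^+ 2 - 8 * (zr R l / zr R (zp 10000) * tau) + 4
      - 2 * (zr R l / zr R (zp 10000)) ^+ 2 ->
    Num.sqrt m.+3%:R * spline m.+2 (Num.sqrt m.+3%:R * t) < corner_volume t.
  move=> c Tt tt l0 h1 h2; have h : (0 < m.+2)%N by [].
  apply: lt_le_trans (vcheckP h c Tt) _.
  exact: (corner_ge tg0 tt).
case: ht => [ht|/ltW ht].
  apply: (step _ _ _ c1 _ ht); first by rewrite zr0 mul0r.
  - by rewrite ?E4 ?E6 !zr_digits; lra.
  - by rewrite ?E4 ?E6 !zr_digits; lra.
  - by rewrite ?E4 ?E6 !zr_digits; lra.
(* The cut points 0.16948, 0.17808, 0.19888 and 0.25411 are the successive abscissas of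
   [vcheck_all]; past the last one, the bound 1 suffices by [corner_gt1]. *)
have [u|/ltW u1] := leP t (1695 / 10 ^+ 4 - 2 / 10 ^+ 5).
  by apply: (step _ _ _ c2 ht u); rewrite ?E4 ?E6 !zr_digits; lra.
have [u|/ltW u2] := leP t (1781 / 10 ^+ 4 - 2 / 10 ^+ 5).
  by apply: (step _ _ _ c3 _ u); rewrite ?E4 ?E6 !zr_digits; lra.
have [u|/ltW u3] := leP t (1989 / 10 ^+ 4 - 2 / 10 ^+ 5).
  by apply: (step _ _ _ c4 _ u); rewrite ?E4 ?E6 !zr_digits; lra.
have [u|/ltW u4] := leP t (2541 / 10 ^+ 4 + 1 / 10 ^+ 5).
  by apply: (step _ _ _ c5 _ u); rewrite ?E4 ?E6 !zr_digits; lra.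
have h : (0 < m.+2)%N by [].
apply: (lt_trans (vcheckP h c6 _)).
  by rewrite ?E4 ?E6 !zr_digits; lra.
by rewrite divff ?corner_gt1// E4 lt0r_neq0 ?exprn_gt0.
Qed.

End small_dimensions.

(** * All face dimensions together, and the conclusion *)

Section threshold.
Context (R : realType).
Implicit Types (t : R).

Local Notation zp x := (BinNums.Zpos x%positive).

Lemma diagonal_lt_corner k (bm bp t : R) : is_beta_minus bm -> is_beta_plus bp ->
  0 < t -> t < 1 / 2 -> t <= bm \/ bp < t ->
  Num.sqrt k.+1%:R * box_density k (Num.sqrt k.+1%:R * t) < corner_volume t.
Proof.
move=> [Em bm12] [Ep bp12] t0 t1 ht.
have E1 : 181611%:R = zr R (zp 181611) by rewrite -zr_nat; congr (zr R _); vm_compute.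
have E2 : 181612%:R = zr R (zp 181612) by rewrite -zr_nat; congr (zr R _); vm_compute.
have E3 : 165625%:R = zr R (zp 165625) by rewrite -zr_nat; congr (zr R _); vm_compute.
have E4 : 165626%:R = zr R (zp 165626) by rewrite -zr_nat; congr (zr R _); vm_compute.
have E6 : zr R (zp 1000000) = 10 ^+ 6 by rewrite !zr_digits; ring.
rewrite E1 E2 in bm12; rewrite E3 E4 in bp12.
clear E1 E2 E4; case/andP: bm12 => bm1 bm2; case/andP: bp12 => bp1 bp2.
have small : t <= 182 / 10 ^+ 4 \/ zr R (zp 165625) / zr R (zp 1000000) < t.
  case: ht => ht; [left|right].
    apply: (le_trans ht); clear -bm2; rewrite !zr_digits in bm2; lra.
  by rewrite E6 (lt_trans bp1 ht).
have {bm1} hbm1 : 181 / 10 ^+ 4 < bm by clear -bm1; rewrite !zr_digits in bm1; lra.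
have {bm2} hbm2 : bm < 182 / 10 ^+ 4 by clear -bm2; rewrite !zr_digits in bm2; lra.
have {bp1} hbp1 : 1656 / 10 ^+ 4 < bp by clear -bp1; rewrite !zr_digits in bp1; lra.
have {bp2} hbp2 : bp < 1657 / 10 ^+ 4 by clear -bp2; rewrite !zr_digits in bp2; lra.
case: k => [|[|k]].
- rewrite sqrtr1 !mul1r; apply: le_lt_trans (corner_gt1 (ltW t0) t1).
  by rewrite /box_density lern1 leq_b1.
- have E : box_density 1 = spline 1 :> (R -> R) by [].
  have [s0 s2] := cden_sqrt (ltW t0) t1.
  rewrite E spline1E corner_volumeE ?ltW// ltr_pdivlMr; last by lra.
  have q0 : 0 <= Num.sqrt 2 :> R by exact: sqrtr_ge0.
  have q2 : Num.sqrt 2 ^+ 2 = 2 :> R by rewrite sqr_sqrtr.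
  move: (Num.sqrt 2) (Num.sqrt (2 - _)) q0 q2 s0 s2 => q s q0 q2 s0 s2.
  have sq : s <= q.
    have sn := ltW s0; rewrite -(ler_pXn2r (isT : (0 < 2)%N)) ?nnegrE// s2 q2.
    by have := sqr_ge0 t; lra.
  rewrite ger0_norm; last exact: mulr_ge0 (ltW t0).
  have [m0|/ltW m0] := leP (1 - q * t) 0; first by rewrite mulr0 mul0r.
  have e : q * (1 - q * t) = q - 2 * t by rewrite mulrBr mulr1 mulrA -expr2 q2.
  have a0 : 0 <= q - 2 * t by rewrite -e mulr_ge0.
  (* For a face of dimension 2 the comparison reduces to (q - 2t)(q + 2t) = 2 - 4 t^2 < 2, where q
     is the square root of 2. *)
  rewrite e; apply: (@le_lt_trans _ _ ((q - 2 * t) * (2 * t + q))).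
    by rewrite ler_wpM2l// lerD2l.
  nra.
have -> : box_density k.+2 = spline k.+2 :> (R -> R) by [].
have [k13|k13] := ltnP k 13; first exact: volume_small.
by apply: (volume_large_lt _ Em hbm1 hbm2 Ep hbp1 hbp2) => //; lia.
Qed.

End threshold.

Theorem theorem1p4 (R : realType) (d : nat) (hd : (2 <= d)%N)
    (betam betap delta t : R)
    (hbetam : is_beta_minus betam) (hbetap : is_beta_plus betap)
    (hdelta : is_delta delta)
    (H : set 'rV[R]_d) (hH : hyperplane H) (hHt : dist_to (cube_center R d) H = t)
    (ht : 0 < t <= betam \/ betap < t <= 20916%:R / 10 ^+ 5 \/
          delta < t < 1 / 2)
    (hdiag : orthogonal_to_face_diagonal H) :
  ~ maximal_section t H.
Proof.
have D k : (k%:R : R) = zr R (BinInt.Z.of_nat k) by rewrite zr_nat.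
have E1 : 181612%:R = zr R (BinNums.Zpos 181612) by rewrite D; congr (zr R _); vm_compute.
have E2 : 165625%:R = zr R (BinNums.Zpos 165625) by rewrite D; congr (zr R _); vm_compute.
have E3 : 165626%:R = zr R (BinNums.Zpos 165626) by rewrite D; congr (zr R _); vm_compute.
have E4 : 222924%:R = zr R (BinNums.Zpos 222924) by rewrite D; congr (zr R _); vm_compute.
have E5 : 20916%:R = zr R (BinNums.Zpos 20916) by rewrite D; congr (zr R _); vm_compute.
have bm : betam < 2 / 100.
  by case: hbetam => _ /andP[_]; rewrite E1 !zr_digits; lra.
have bp : 16 / 100 < betap < 17 / 100.
  by case: hbetap => _ /andP[]; rewrite E2 E3 !zr_digits; lra.
have hd2 : 22 / 100 < delta.
  by case: hdelta => _ /andP[+ _]; rewrite E4 !zr_digits; lra.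
rewrite E5 !zr_digits in ht.
clear D E1 E2 E3 E4 E5 hdelta.
(* The third range lies to the right of [betap] because [betap] < 0.17 < 0.22 < [delta]. *)
have [t0 t1 tb] : [/\ 0 < t, t < 1 / 2 & t <= betam \/ betap < t].
  by case: ht => [/andP[u v]|[/andP[u v]|/andP[u v]]]; (split; [lra|lra|]);
    [left|right|right; lra].
case: d hd H hH hHt hdiag => [//|[//|d]] _ H hH hHt hdiag [_ _ maxH].
have [k Hk] := diagonal_section_volume hH hHt hdiag.
have [H' [hH' hH't vH']] := corner_section d t0 t1.
have := maxH H' hH' hH't; rewrite vH' Hk lee_fin leNgt.
by rewrite (diagonal_lt_corner k hbetam hbetap t0 t1 tb).
Qed.
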